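(* Let $F$ be a field, let $A$ be a finitely generated free abelian group, and let $F * A$ be a twisted group algebra of $A$ over $F$ such that $\dim(F * A) = \operatorname{rk}(A) - 1$. Let $Z$ be the subgroup of $A$ such that the center of $F * A$ is $\mathcal{Z}(F * A) = F * Z$. Let $M$ be a simple $F * A$-module. Then either $\operatorname{GKdim}(M) = 1$, or $$\operatorname{GKdim}(M) \ge \operatorname{rk}(A) - \operatorname{rk}(Z) - 1.$$
   Context: A twisted group algebra $F * A$ of a finitely generated free abelian group $A$ over a field $F$ is an associative unital $F$-algebra with an $F$-basis $\overline{A} = \{\bar a : a \in A\}$ that is a copy of $A$, with multiplication satisfying $\bar a_1 \bar a_2 = \tau(a_1,a_2)\,\overline{a_1a_2}$ for all $a_1,a_2 \in A$, where $\tau : A \times A \to F^* = F\setminus\{0\}$ satisfies $\tau(a_1,a_2)\tau(a_1a_2,a_3) = \tau(a_2,a_3)\tau(a_1,a_2a_3)$. (These algebras are the quantum tori: the $F$-algebras generated by $x_1,\dots,x_n$ and their inverses subject to $x_ix_j = q_{ij}x_jx_i$, with $n = \operatorname{rk}(A)$.) For a subgroup $B \le A$, $F * B$ denotes the subalgebra consisting of the elements $\sum_a \lambda_a \bar a$ of $F * A$ with $\lambda_a = 0$ for $a \notin B$. The center of $F*A$ is always of the form $F * Z$ for a unique subgroup $Z \le A$. $\operatorname{rk}$ denotes the (torsion-free) rank of an abelian group. $\dim(F * A)$ denotes either the Krull dimension or the global dimension of $F * A$; by a theorem of Brookes these both equal the supremum of the ranks of subgroups $B \le A$ such that $F * B$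 is commutative. Modules are right modules. $\operatorname{GKdim}(M)$ is the Gelfand–Kirillov dimension of $M$ as an $F * A$-module; for finitely generated $M$ it equals the supremum of the ranks of the subgroups $B \le A$ such that $M$ is not $F * B$-torsion, where $M$ is $F*B$-torsion if every $m \in M$ satisfies $mx = 0$ for some nonzero $x \in F * B$. *)

(* Defs.v *)
From mathcomp Require Import all_boot all_order all_algebra finmap.
From mathcomp Require Import all_classical all_reals all_analysis.

Set Implicit Arguments.
Unset Strict Implicit.
Unset Printing Implicit Defensive.

Import Order.TTheory GRing.Theory Num.Theory.
Import numFieldNormedType.Exports.

Local Open Scope classical_set_scope.
Local Open Scope ring_scope.

(* Abelian groups are written additively. *)
Definition fg_free_abelian (A : zmodType) : Prop :=
  exists (n : nat) (e : 'I_n -> A),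
    forall a : A, exists! c : {ffun 'I_n -> int}, a = \sum_(i < n) e i *~ c i.

Definition int_free (A : zmodType) (s : seq A) : Prop :=
  forall c : 'I_(size s) -> int,
    \sum_(i < size s) s`_i *~ c i = 0 -> forall i, c i = 0.

Definition rk (R : realType) (A : zmodType) (B : set A) : \bar R :=
  ereal_sup [set (size s)%:R%:E | s in
    [set s : seq A | (forall a, a \in s -> B a) /\ int_free s]].

(* [S] is an algebra F * A: it has an F-basis (bar a)_(a : A) whose
   multiplication is twisted by the 2-cocycle tau. *)
Record twisted_group_algebra (F : fieldType) (A : zmodType) (S : algType F) :=
  TwistedGroupAlgebra {
    tga_bar : A -> S;
    tga_tau : A -> A -> F;
    tga_tau_neq0 : forall a b, tga_tau a b != 0;
    tga_tau_cocycle : forall a b c,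
      tga_tau a b * tga_tau (a + b) c = tga_tau b c * tga_tau a (b + c);
    tga_mul : forall a b,
      tga_bar a * tga_bar b = tga_tau a b *: tga_bar (a + b);
    tga_basis : forall x : S, exists! l : {fsfun A -> F with 0},
      x = \sum_(a <- finsupp l) l a *: tga_bar a
  }.

Definition tga_sub (F : fieldType) (A : zmodType) (S : algType F)
    (T : twisted_group_algebra A S) (B : set A) : set S :=
  [set x | exists l : {fsfun A -> F with 0},
     (forall a, ~ B a -> l a = 0) /\
     x = \sum_(a <- finsupp l) l a *: tga_bar T a].

Definition ring_center (S : nzRingType) : set S :=
  [set x | forall y : S, GRing.comm x y].
Arguments ring_center S : clear implicits.

(* A right S-module is a left module over the converse ring S^c. *)
Definition ract (S : nzRingType) (M : lmodType S^c) (m : M) (x : S) : M :=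
  (x : S^c) *: m.

Definition simple_module (S : nzRingType) (M : lmodType S) : Prop :=
  (exists m : M, m != 0) /\
  forall N : set M, submod_closed (mem N) -> N = [set 0] \/ N = [set: M].

(* [kdim_lt k N P]: for submodules N `<=` P of M, the Gabriel-Rentschler Krull
   dimension of P / N, i.e. the deviation of the poset of submodules between N
   and P, is < k; the zero module is the only one of dimension < 0. *)
Fixpoint kdim_lt (S : nzRingType) (M : lmodType S) (k : nat) (N P : set M)
    : Prop :=
  if k is k'.+1 then
    forall C : nat -> set M,
      (forall i, submod_closed (mem (C i))) ->
      (forall i, N `<=` C i /\ C i `<=` P) ->
      (forall i, C i.+1 `<=` C i) ->
      exists i0, forall i, (i0 <= i)%N -> kdim_lt k' (C i.+1) (C i)
  else P `<=` N.

Definition module_kdim (S : nzRingType) (M : lmodType S) (d : nat) : Prop :=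
  kdim_lt d.+1 [set 0] [set: M] /\ ~ kdim_lt d [set 0] [set: M].

(* The regular module of S^c is S as a right module over itself. *)
Definition right_kdim (S : nzRingType) (d : nat) : Prop :=
  @module_kdim S^c (S^c)^o d.

Section GKdim.
Variables (R : realType) (F : fieldType) (S : algType F) (M : lmodType S^c).

(* The F-dimension of the span of the family [s], where F acts on M through
   the structure map k |-> k%:A of S. *)
Definition span_dim (s : seq M) : nat :=
  \max_(I : {set 'I_(size s)} |
      `[< forall c : 'I_(size s) -> F,
            \sum_(i in I) ract s`_i (c i)%:A = 0 ->
            forall i, i \in I -> c i = 0 >]) #|I|.

(* With V and W the F-spans of [v] and [w], these elements span W V^n. *)
Definition gk_gens (v : seq S) (w : seq M) (n : nat) : seq M :=
  iter n (fun s => [seq ract m x | m <- s, x <- v]) w.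

(* The supremum is over the finite-dimensional subspaces V = span (1 :: v) of S
   containing 1 and W = span w of M. Since ln 0 = 0 in the library, W = 0
   contributes 0. *)
Definition GKdim : \bar R :=
  ereal_sup [set limn_esup (fun n : nat =>
      (ln (span_dim (gk_gens (1 :: v) w n))%:R / ln n%:R)%:E)
    | v in [set: seq S] & w in [set: seq M]].

End GKdim.

(* Main.v *)
Require Import Defs.

(** Write [n = rk A].

    Krull dimension.  Leading exponents with respect to a graded monomial order
    turn right ideals into upward closed subsets of [N^n], and a descending chain
    [C_i] into a descending chain of such sets.  If the difference of the leading
    sets of [P] and [N] contains no translated coordinate orthant of dimension
    [> e + 1], then in any chain between [N] and [P] all but finitely many factors
    contain none of dimension [> e].  So if the Krull dimension is at least
    [n - 1], some nonzero factor [P / N] has only linear growth.  Then either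
    [P / N] contains a nonzero finite-dimensional module, or it has finite nonzero
    rank [k] over [F[x]] for some basis element [x].  In both cases the basis of
    [A] acts by semilinear matrices; comparing the leading coefficients of their
    determinants in the commutation relations gives
    [chi(a, b)^k = chi(x, a)^psi(b) * chi(x, b)^(-psi(a))] for the commutator
    pairing [chi] and an additive map [psi] with [psi(x) <> 0].  Hence [chi] is
    torsion on the corank one subgroup [D = ker psi].

    Simple modules.  Some subgroup [B] of finite index in [D] spans a commutative
    subalgebra centralised by [F * D].  Choose [u <> 0] in [M] whose annihilator
    [p] in [F * B] is maximal; [p] is prime.
    - If [p] is stable under some [h] with [psi(h) <> 0], then [p] is spanned by
      eigenvectors of [h], so it meets [F * C] trivially for every [C <= B] on
      which [chi(-, h)] is injective; [C] can be chosen of rank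
      [>= n - rk Z - 1].
    - Otherwise the conjugates of [p] by elements with distinct values of [psi]
      are distinct, [M] is the direct sum of their annihilator spaces, and the one
      of [p] is simple over [F * D].  As in Zariski's lemma it has finite
      dimension: every polynomial outside [p] acts bijectively on it, whereas it
      has finite rank over a polynomial ring meeting [p] trivially.  So [M] grows
      linearly. *)

From HB Require Import structures.
From mathcomp Require Import all_boot all_order all_algebra finmap.
From mathcomp Require Import zify ring lra.
From mathcomp Require mpoly.
From mathcomp Require Import boolp classical_sets.

Set Implicit Arguments.
Unset Strict Implicit.
Unset Printing Implicit Defensive.

Import Order.TTheory GRing.Theory Num.Theory.

Module QuantumTorus.
Import mpoly.
Local Open Scope ring_scope.

(** * Upward closed sets of monomials *)

Section Monomials.
Variable n : nat.
Implicit Types (m a b c : 'X_{1..n}) (X Y : 'X_{1..n} -> Prop) (J : {set 'I_n}).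

(** From each index one jumps to a later one at which [u] is minimal among all later values. *)
Lemma nondecreasing_subseq (u : nat -> nat) :
  exists s : nat -> nat, (forall i, (s i < s i.+1)%N) /\
    forall i, (u (s i) <= u (s i.+1))%N.
Proof.
have nxt (i : nat) : exists j, (i < j)%N /\ forall k, (i < k)%N -> (u j <= u k)%N.
  have exv : exists v, `[< exists j, (i < j)%N /\ u j = v >].
    by exists (u i.+1); apply/asboolP; exists i.+1.
  case: (ex_minnP exv) => v /asboolP [j [ij ujv]] vmin.
  by exists j; split=> // k ik; rewrite ujv; apply/vmin/asboolP; exists k.
have [f fP] := choice nxt.
(* The extra iteration makes even the first term such a minimiser. *)
pose s i := iter i.+1 f 0%N.
have s_lt i : (s i < s i.+1)%N by rewrite /s [in X in (_ < X)%N]iterS; case: (fP (iter i.+1 f 0)).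
exists s; split=> // i; case: (fP (iter i f 0)) => h1 h2.
by apply: h2; apply: (leq_trans h1); apply: ltnW; exact: s_lt.
Qed.

(** The coordinates are made monotone one after the other by passing to subsequences; [H] treats the
    first [k] of them. *)
Lemma dickson (u : nat -> 'X_{1..n}) : exists i j, (i < j)%N /\ (u i <= u j)%MM.
Proof.
have H k : (k <= n)%N -> exists s : nat -> nat, (forall i, (s i < s i.+1)%N) /\
    forall i (l : 'I_n), (l < k)%N -> (u (s i) l <= u (s i.+1) l)%N.
  elim: k => [_|k IH kn].
    by exists id; split.
  have [s [s_lt sP]] := IH (ltnW kn).
  have [t [t_lt tP]] := nondecreasing_subseq (fun i => u (s i) (Ordinal kn)).
  have s_mono i j : (i < j)%N -> (s i < s j)%N
    by elim: j => // j IHj; rewrite ltnS leq_eqVlt => /orP[/eqP->//|/IHj h]; exact: ltn_trans (s_lt j).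
  exists (s \o t); split=> [i|i l]; first exact: s_mono.
  rewrite ltnS leq_eqVlt => /orP[/eqP lk|lk].
    have -> : l = Ordinal kn by apply/val_inj.
    exact: tP.
  have: (t i <= t i.+1)%N by exact: ltnW.
  rewrite /=; elim: (t i.+1) => [|j IHj]; first by rewrite leqn0 => /eqP->.
  rewrite leq_eqVlt => /orP[/eqP->//|]; rewrite ltnS => /IHj h.
  exact: leq_trans h (sP _ _ lk).
have [s [s_lt sP]] := H n (leqnn n).
exists (s 0%N), (s 1%N); split; first exact: s_lt.
by apply/mnm_lepP => l; exact: sP.
Qed.

Definition upclosed X := forall a b, X a -> (a <= b)%MM -> X b.

(** Otherwise elements of [X] not above any earlier choice could be picked forever, against
    [dickson]. *)
Lemma upclosed_fg X : upclosed X ->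
  exists G : seq 'X_{1..n}, {in G, forall g, X g} /\
    forall a, X a -> exists2 g, g \in G & (g <= a)%MM.
Proof.
move=> Xup; apply: contrapT => /forallNP nG.
pose P (G : seq 'X_{1..n}) := {in G, forall g, X g}.
have nxt (G : seq 'X_{1..n}) : exists a, P G -> X a /\ {in G, forall g, ~~ (g <= a)%MM}.
  have [PG|nPG] := pselect (P G); last by exists 0%MM.
  have := nG G => /not_andP [//|/existsNP [a /not_implyP [Xa na]]].
  exists a => _; split=> // g gG; apply/negP => ga; apply: na; by exists g.
have [f fP] := choice nxt.
pose s i := iter i (fun G => f G :: G) [::].
have Ps i : P (s i).
  elim: i => [|i IH] //= g; rewrite inE => /orP[/eqP->|/IH//].
  by have [] := fP _ IH.
have [i [j [ij le_ij]]] := dickson (f \o s).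
have [_ /(_ (f (s i)))] := fP _ (Ps j).
rewrite le_ij /= => H; suff: f (s i) \in s j by move/H.
elim: j ij {le_ij H} => // j IHj; rewrite ltnS leq_eqVlt /= inE => /orP[/eqP->|/IHj ->].
  by rewrite eqxx.
by rewrite orbT.
Qed.

(** If each step gained a new point [u i], Dickson's lemma would put some [u i] below a later [u j],
    which would then not be new. *)
Lemma upclosed_acc (X : nat -> 'X_{1..n} -> Prop) :
  (forall i, upclosed (X i)) -> (forall i a, X i a -> X i.+1 a) ->
  exists i, forall a, X i.+1 a -> X i a.
Proof.
move=> Xup Xinc; apply: contrapT => /forallNP nX.
have nxt i : exists a, X i.+1 a /\ ~ X i a.
  have /existsNP [a /not_implyP [h1 h2]] := nX i; by exists a.
have [u uP] := choice nxt.
have [i [j [ij le_ij]]] := dickson u.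
have [_ []] := uP j.
have mono k l : (k <= l)%N -> forall a, X k a -> X l a.
  elim: l => [|l IH]; first by rewrite leqn0 => /eqP->.
  rewrite leq_eqVlt => /orP[/eqP-> //|]; rewrite ltnS => /IH H a /H; exact: Xinc.
apply: mono ij _ _; apply: (Xup _ _ _ _ le_ij).
by have [] := uP i.
Qed.

Definition supported J m := [forall i, (i \notin J) ==> (m i == 0%N)].

Lemma supportedP J m : reflect (forall i, i \notin J -> m i = 0%N) (supported J m).
Proof.
apply: (iffP forallP) => H i; last by apply/implyP => /H /eqP.
by move=> iJ; have /implyP /(_ iJ) /eqP := H i.
Qed.

Lemma supportedD J a b : supported J a -> supported J b -> supported J (a + b)%MM.
Proof.
move=> /supportedP Ha /supportedP Hb; apply/supportedP => i iJ.
by rewrite mnmDE Ha ?Hb.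
Qed.

Lemma supported0 J : supported J 0%MM.
Proof. by apply/supportedP => i _; rewrite mnm0E. Qed.

Definition has_orthant X Y a J := forall b, supported J b -> X (a + b)%MM /\ ~ Y (a + b)%MM.

(** For leading sets of right ideals this dimension of [X] minus [Y] measures the growth of the
    quotient. *)
Definition mdim_le X Y (e : nat) := forall a J, (e < #|J|)%N -> ~ has_orthant X Y a J.

Definition covered X Y (s : seq ('X_{1..n} * {set 'I_n})) (e : nat) :=
  (forall g, g \in s -> (#|g.2| <= e)%N) /\
  forall a, X a -> ~ Y a -> exists2 g, g \in s &
     exists2 b, supported g.2 b & a = (g.1 + b)%MM.

(** For a generator [g] of [X] and a set [J] of more than [e] directions, [g] plus the orthant of
    [J] meets [Y]. Hence a point of [X] outside [Y] is far from the generator below it in at most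
    [e] directions. *)
Lemma mdim_covered X Y e : upclosed X -> upclosed Y -> mdim_le X Y e ->
  exists s, covered X Y s e.
Proof.
move=> Xup Yup dimXY.
have [G [GX Ggen]] := upclosed_fg Xup.
have ex (x : 'X_{1..n} * {set 'I_n}) : exists b, x.1 \in G -> (e < #|x.2|)%N ->
    supported x.2 b /\ Y (x.1 + b)%MM.
  have [xG|xG] := boolP (x.1 \in G); last by exists 0%MM.
  have [xe|xe] := boolP (e < #|x.2|)%N; last by exists 0%MM.
  have /existsNP [b /not_implyP [bJ nb]] := dimXY x.1 x.2 xe.
  exists b => _ _; split=> //; apply: contrapT => nY; apply: nb; split=> //.
  by apply: (Xup x.1); [exact: GX | rewrite lem_addr].
have [f fP] := choice ex.
(* [B] bounds all coordinates of the chosen points of [Y], relative to their generators. *)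
pose B := (\max_(x <- [seq (g, J) | g <- G, J <- enum {set 'I_n}]) \max_(i < n) f x i)%N.
have fB g J i : g \in G -> (f (g, J) i <= B)%N.
  move=> gG; apply: (@leq_trans (\max_(i < n) f (g, J) i)%N).
    exact: (leq_bigmax (F := fun i : 'I_n => f (g, J) i)).
  rewrite /B; apply: (@leq_bigmax_seq _ _ xpredT (fun x => \max_(i < n) f x i)%N) => //.
  by apply/allpairsP; exists (g, J); rewrite mem_enum.
pose mk (g : 'X_{1..n}) (c : {ffun 'I_n -> 'I_B.+1}) := (g + [multinom (c i : nat) | i < n])%MM.
exists [seq (mk g x.1, x.2) | g <- G, x <- enum (fun x : {ffun 'I_n -> 'I_B.+1} * {set 'I_n} => (#|x.2| <= e)%N)].
split.
  by move=> _ /allpairsP [[g [c J]] [/= gG xP ->]]; move: xP; rewrite mem_enum.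
move=> a Xa nYa; have [g gG ga] := Ggen _ Xa.
pose w := (a - g)%MM.
have aE : a = (g + w)%MM by rewrite addmC submK.
(* Cutting [w] off at [B] leaves finitely many base points; the excess is supported on the set [J]
   of coordinates above [B]. *)
pose c : {ffun 'I_n -> 'I_B.+1} := [ffun i => inord (minn (w i) B)].
have cE i : c i = minn (w i) B :> nat by rewrite ffunE inordK // ltnS geq_minr.
pose J := [set i | (B < w i)%N].
exists (mk g c, J).
  apply/allpairsP; exists (g, (c, J)); split=> //=.
  rewrite mem_enum unfold_in /= leqNgt; apply/negP => eJ.
  have [fJ fY] := fP (g, J) gG eJ.
  apply: nYa; apply: (Yup _ _ fY); rewrite aE; apply/mnm_lepP => i /=.
  rewrite !mnmDE leq_add2l; have [iJ|iJ] := boolP (i \in J).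
    by apply: leq_trans (fB _ _ _ gG) _; move: iJ; rewrite inE => /ltnW.
  by move/supportedP: fJ => ->.
exists (w - [multinom (c i : nat) | i < n])%MM.
  apply/supportedP => i; rewrite inE mnmBE mnmE cE; lia.
rewrite /= /mk -addmA aE; congr (_ + _)%MM; rewrite addmC submK //.
by apply/mnm_lepP => i; rewrite mnmE cE geq_minl.
Qed.

(** A point of degree at most [t] in a slab is determined by at most [e] coordinates, each at most
    [t]. *)
Lemma covered_count X Y s e : covered X Y s e ->
  forall t, exists l : seq 'X_{1..n}, (size l <= size s * t.+1 ^ e)%N /\
    forall m, X m -> ~ Y m -> (mdeg m <= t)%N -> m \in l.
Proof.
move=> [se sc] t.
pose sl (g : 'X_{1..n} * {set 'I_n}) :=
  [seq (g.1 + [multinom (f i : nat) | i < n])%MM |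
    f : {ffun 'I_n -> 'I_t.+1} in pffun_on (ord0 : 'I_t.+1) (mem g.2) predT].
exists (flatten [seq sl g | g <- s]); split.
  rewrite size_flatten sumnE !big_map.
  rewrite -[X in (_ <= X * _)%N](size_map id) -sum1_size big_map big_distrl /=.
  rewrite big_seq [in X in (_ <= X)%N]big_seq; apply: leq_sum => g /se ge.
  rewrite mul1n size_map -cardE card_pffun_on cardT size_enum_ord.
  exact: leq_pexp2l.
move=> m Xm nYm mt; have [g gs [b bJ mE]] := sc _ Xm nYm.
apply/flattenP; exists (sl g); first exact: map_f.
apply/mapP; exists [ffun i => inord (b i)].
  rewrite mem_enum; apply/pffun_onP; split=> //.
  apply/fintype.subsetP => i; rewrite inE ffunE => bi; apply: contraNT bi => iJ.
  by move/supportedP: bJ => -> //; apply/eqP/val_inj; rewrite /= inordK.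
rewrite mE; congr (_ + _)%MM; apply/mnmP => i; rewrite mnmE ffunE inordK // ltnS.
apply: leq_trans mt; rewrite mE mdegD mdegE; apply: leq_trans (leq_addl _ _).
by rewrite mdegE (bigD1 i) //= leq_addr.
Qed.

(* Two disjoint translates of [N^J] cannot agree off [J], so each of the finitely
   many slabs covering [X] minus [Y] accounts for at most one orthant of top
   dimension in the successive differences. *)
Lemma mdim_chain X Y (C : nat -> 'X_{1..n} -> Prop) e :
  upclosed X -> upclosed Y -> mdim_le X Y e.+1 ->
  (forall i, upclosed (C i)) -> (forall i a, C i.+1 a -> C i a) ->
  (forall i a, C i a -> X a) -> (forall i a, Y a -> C i a) ->
  exists i0, forall i, (i0 <= i)%N -> mdim_le (C i) (C i.+1) e.
Proof.
move=> Xup Yup dimXY Cup Cdec CX YC.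
have [s [se sc]] := mdim_covered Xup Yup dimXY.
have Cmono i j a : (i <= j)%N -> C j a -> C i a.
  move=> ij; rewrite -(subnK ij) addnC; elim: (_ - _)%N => [|k IH]; first by rewrite addn0.
  by rewrite addnS => /Cdec /IH.
pose bad i (g : 'X_{1..n} * {set 'I_n}) := exists a,
  [/\ has_orthant (C i) (C i.+1) a g.2 & forall k, k \notin g.2 -> a k = g.1 k].
have bad1 i j g : bad i g -> bad j g -> (i < j)%N -> False.
  move=> [a [aO aE]] [b [bO bE]] ij.
  (* As [a] and [b] agree off [g.2], their join lies in both orthants. *)
  pose c := [multinom maxn (a k) (b k) | k < n].
  have ca : c = (a + (c - a))%MM.
    by rewrite addmC submK //; apply/mnm_lepP => k; rewrite mnmE leq_maxl.
  have cb : c = (b + (c - b))%MM.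
    by rewrite addmC submK //; apply/mnm_lepP => k; rewrite mnmE leq_maxr.
  have [|_] := aO (c - a)%MM.
    by apply/supportedP => k kg; rewrite mnmBE mnmE aE ?bE // maxnn subnn.
  have [|+ _] := bO (c - b)%MM.
    by apply/supportedP => k kg; rewrite mnmBE mnmE aE ?bE // maxnn subnn.
  by rewrite -ca -cb => Cj nC; apply: nC; apply: Cmono Cj.
have bnd g : exists k, forall i, bad i g -> (i <= k)%N.
  have [[i ib]|nb] := pselect (exists i, bad i g); last first.
    by exists 0%N => i ib; case: nb; exists i.
  exists i => j jb; rewrite leqNgt; apply/negP; exact: bad1 jb.
have [f fP] := choice bnd.
exists (\max_(g <- s) f g).+1 => i i0 a J eJ aO.
(* A shift by [t] along [J] exceeds every base point, so the slab containing the shifted point must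
   extend in all directions of [J]. *)
pose t := (\max_(g <- s) \max_(k < n) g.1 k).+1.
have [||g gs [b bJ aE]] := sc (a + [multinom if k \in J then t else 0%N | k < n])%MM.
- apply: (CX i); apply: (aO _ _).1.
  by apply/supportedP => k kJ; rewrite mnmE (negbTE kJ).
- apply: contra_not (aO _ _).2; first by exact: YC.
  by apply/supportedP => k kJ; rewrite mnmE (negbTE kJ).
have JE : J = g.2.
  apply/eqP; rewrite eqEcard (leq_trans (se _ gs) eJ) andbT; apply/fintype.subsetP => k kJ.
  apply: contraT => kg; move/mnmP: aE => /(_ k); rewrite !mnmDE mnmE kJ.
  move/supportedP: bJ => -> //; rewrite addn0.
  have gt : (g.1 k < t)%N.
    rewrite /t ltnS; apply: (@leq_trans (\max_(k < n) g.1 k)%N).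
      exact: (leq_bigmax (F := fun k : 'I_n => g.1 k)).
    by apply: (@leq_bigmax_seq _ _ xpredT (fun g : 'X_{1..n} * {set 'I_n} => \max_(k < n) g.1 k)%N).
  by move=> gE; move: gt; rewrite -gE; lia.
have: bad i g.
  exists a; rewrite -JE; split=> // k kJ.
  move/mnmP: aE => /(_ k); rewrite !mnmDE mnmE (negbTE kJ) addn0 => ->.
  by move/supportedP: bJ => ->; rewrite -?JE // addn0.
move/fP; rewrite leqNgt => /negP; apply.
apply: leq_trans i0; rewrite ltnS.
by apply: (@leq_bigmax_seq _ _ xpredT f).
Qed.

End Monomials.

(** * Linear algebra modulo a subspace *)

Section Spans.
Variables (F : fieldType) (V : lmodType F).

Definition subsp (N : V -> Prop) := N 0 /\ forall (c : F) x y, N x -> N y -> N (c *: x + y).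

Definition spans (N : V -> Prop) (w : seq V) (v : V) :=
  exists c : nat -> F, N (v - \sum_(i < size w) c i *: w`_i).

Lemma subspD N x y : subsp N -> N x -> N y -> N (x + y).
Proof. by move=> [_ H] Nx Ny; rewrite -[x]scale1r; exact: H. Qed.

Lemma subspZ N c x : subsp N -> N x -> N (c *: x).
Proof. by move=> [H0 H] Nx; rewrite -[_ *: _]addr0; exact: H. Qed.

Lemma subspB N x y : subsp N -> N x -> N y -> N (x - y).
Proof.
by move=> sN Nx Ny; rewrite -scaleN1r; apply: subspD => //; exact: subspZ.
Qed.

Lemma subsp_sum N (I : Type) (r : seq I) (P : pred I) (f : I -> V) : subsp N ->
  (forall i, P i -> N (f i)) -> N (\sum_(i <- r | P i) f i).
Proof.
move=> sN H; elim/big_rec : _ => [|i x Pi Nx]; first exact: sN.1.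
by apply: subspD => //; exact: H.
Qed.

(** Steinitz modulo [N]: were [w] shorter, the coefficient matrix would have a nonzero left kernel
    vector, which is a relation among the [v x]. *)
Lemma spans_card (N : V -> Prop) (w : seq V) (E : finType) (v : E -> V) :
  subsp N -> (forall x, spans N w (v x)) ->
  (forall a : E -> F, N (\sum_x a x *: v x) -> forall x, a x = 0) ->
  (#|E| <= size w)%N.
Proof.
move=> sN sv iv; rewrite leqNgt; apply/negP => wE.
have [c cP] := choice sv.
pose C : 'M[F]_(#|E|, size w) := \matrix_(i, j) c (enum_val i) j.
have /rowV0Pn [u uK u0] : kermx C != 0.
  rewrite kermx_eq0; apply/negP => /eqP rC.
  by have := rank_leq_col C; rewrite rC leqNgt wE.
have uC : u *m C = 0 by apply/sub_kermxP.
pose a x := u 0 (enum_rank x).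
have /iv a0 : N (\sum_x a x *: v x).
  have -> : \sum_x a x *: v x =
     \sum_x a x *: (v x - \sum_(i < size w) c x i *: w`_i).
    under [RHS]eq_bigr do rewrite scalerBr.
    rewrite sumrB [X in _ - X](_ : _ = 0) ?subr0 //.
    under eq_bigr do rewrite scaler_sumr.
    rewrite exchange_big /= big1 // => j _.
    under eq_bigr do rewrite scalerA.
    rewrite -scaler_suml; have /rowP/(_ j) := uC.
    rewrite !mxE (reindex _ (onW_bij _ (enum_rank_bij E))) /=.
    under eq_bigr do rewrite mxE enum_rankK.
    by move->; rewrite scale0r.
  by apply: subsp_sum => // x _; exact: subspZ.
by case/eqP: u0; apply/rowP => i; rewrite mxE -[i]enum_valK; exact: a0.
Qed.

Lemma spansD N w w' v v' : subsp N -> spans N w v -> spans N w' v' -> spans N (w ++ w') (v + v').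
Proof.
move=> sN [c cP] [c' cP'].
exists (fun i => if (i < size w)%N then c i else c' (i - size w)%N).
rewrite size_cat big_split_ord /=.
under eq_bigr => i _ do rewrite ltn_ord nth_cat ltn_ord.
under [X in _ - (_ + X)]eq_bigr => i _ do
  rewrite ltnNge leq_addr /= nth_cat ltnNge leq_addr /= addKn.
by rewrite opprD addrACA; exact: subspD.
Qed.

Lemma spans_sum N (I : Type) (r : seq I) (w : I -> seq V) (f : I -> V) : subsp N ->
  (forall i, spans N (w i) (f i)) -> spans N (flatten [seq w i | i <- r]) (\sum_(i <- r) f i).
Proof.
move=> sN H; elim: r => [|i r IH] /=; last by rewrite big_cons; exact: spansD.
by exists (fun=> 0); rewrite big_nil big_ord0 subrr; exact: sN.1.
Qed.

End Spans.

Lemma spans_map (F : fieldType) (V V' : lmodType F) (L : V -> V') (N : V -> Prop)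
    (N' : V' -> Prop) w v :
  (forall c x y, L (c *: x + y) = c *: L x + L y) -> (forall x, N x -> N' (L x)) ->
  spans N w v -> spans N' (map L w) (L v).
Proof.
move=> HL NN [c /NN cP]; exists c; move: cP; congr N'.
have L0 : L 0 = 0 by have := HL (-1) 0 0; rewrite scaler0 addr0 scaleN1r addNr.
have LZ d x : L (d *: x) = d *: L x by have := HL d x 0; rewrite !addr0 L0 addr0.
have LB x y : L (x - y) = L x - L y by rewrite -scaleN1r addrC HL scaleN1r addrC.
rewrite LB; congr (_ - _); rewrite size_map.
rewrite (eq_bigr (fun i : 'I_(size w) => L (c i *: w`_i))) => [|i _]; last first.
  by rewrite (nth_map 0).
have LD x y : L (x + y) = L x + L y by rewrite -{1}[x]scale1r HL scale1r.
by elim/big_rec2 : _ => [|i x y _ <-].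
Qed.

Section MaxFamily.
Variables (V : zmodType) (R0 : nzRingType) (act : V -> R0 -> V) (dom : R0 -> Prop).
Variables (N Q : V -> Prop).
Hypothesis act0 : forall v, act v 0 = 0.

(** The coefficients will be scalars, polynomials in one basis element, or polynomials in a chosen
    set of variables. *)
Definition indep k (v : 'I_k -> V) := forall c : 'I_k -> R0, (forall i, dom (c i)) ->
  N (\sum_i act (v i) (c i)) -> forall i, c i = 0.

(** A longest independent family replaces a basis over the fraction field: adjoining [u] creates a
    relation, and its coefficient at [u] is nonzero because [v] is independent. *)
Lemma max_indep B :
  (forall k (v : 'I_k -> V), (forall i, Q (v i)) -> indep v -> (k <= B)%N) ->
  exists k (v : 'I_k -> V), [/\ forall i, Q (v i), indep v & forall u, Q u ->
    exists c : 'I_k -> R0, exists d : R0, [/\ forall i, dom (c i), dom d, d != 0 &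
      N (act u d + \sum_i act (v i) (c i))]].
Proof.
move=> bnd.
pose p k := `[< exists v : 'I_k -> V, (forall i, Q (v i)) /\ indep v >].
have exp : exists k, p k.
  by exists 0%N; apply/asboolP; exists (fun=> 0); split=> [[]//|c _ _ []].
have pB k : p k -> (k <= B)%N by move=> /asboolP [v [Qv iv]]; exact: bnd iv.
case: (ex_maxnP exp pB) => k /asboolP [v [Qv iv]] kmax.
exists k, v; split=> // u Qu.
pose v' (i : 'I_k.+1) := if unlift ord0 i is Some j then v j else u.
have v'0 : v' ord0 = u by rewrite /v' unlift_none.
have v'S i : v' (lift ord0 i) = v i by rewrite /v' liftK.
have : ~ indep v'.
  move=> iv'; suff: (k.+1 <= k)%N by rewrite ltnn.
  apply/kmax/asboolP; exists v'; split=> // i; rewrite /v'.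
  by case: unliftP => [j _|_].
move=> /existsNP [c /not_implyP [cd /not_implyP [cN /existsNP [i ci]]]].
have c0 : c ord0 != 0.
  apply/eqP => c0; apply: ci; case: (unliftP ord0 i) => [j ->|->] //.
  move: cN; rewrite big_ord_recl c0 act0 add0r.
  under eq_bigr do rewrite v'S.
  by move=> /iv /(_ _) ->.
exists (fun i => c (lift ord0 i)), (c ord0); split=> //.
move: cN; rewrite big_ord_recl v'0.
by under eq_bigr do rewrite v'S.
Qed.
End MaxFamily.

(* [N] plays the role of a right ideal, and [m] of a basis of [P] modulo [N] over
   the ring [R0], up to torsion; right multiplication by [y j] is semilinear with
   respect to [sg j].  The identity of [semilinear_det] is the relation [yy] after
   taking determinants, the [d j] being the denominators. *)
Section SemilinearDet.
Variables (S : nzRingType) (R0 : idomainType) (phi : {rmorphism R0 -> S}).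
Variables (J : Type) (y y' : J -> S) (sg : J -> {rmorphism R0 -> R0}) (sg' : J -> R0 -> R0).
Variable q : J -> J -> R0.
Hypothesis yK : forall j, y j * y' j = 1.
Hypothesis sgK : forall j, cancel (sg' j) (sg j).
Hypothesis phiy : forall j r, phi r * y j = y j * phi (sg j r).
Hypothesis yy : forall i j, y i * y j = y j * y i * phi (q i j).
Variables (P N : S -> Prop).
Hypothesis N0 : N 0.
Hypothesis ND : forall x z, N x -> N z -> N (x + z).
Hypothesis NM : forall x s, N x -> N (x * s).
Hypothesis Py : forall x j, P x -> P (x * y j).
Variables (k : nat) (m : 'I_k -> S).
Hypothesis mP : forall a, P (m a).
Hypothesis m_indep : forall c : 'I_k -> R0, N (\sum_a m a * phi (c a)) -> forall a, c a = 0.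
Hypothesis m_span : forall u, P u -> exists c : 'I_k -> R0, exists2 d : R0, d != 0 &
   N (u * phi d + \sum_a m a * phi (c a)).

Let NB x z : N x -> N z -> N (x - z).
Proof. by move=> Nx Nz; rewrite -[z]mulr1 -mulrN; apply: ND => //; exact: NM. Qed.

Let Nsum (I : finType) (f : I -> S) : (forall i, N (f i)) -> N (\sum_i f i).
Proof. by move=> H; elim/big_rec : _ => // i x _; exact: ND. Qed.

Let ev (v : 'cV[R0]_k) := \sum_b m b * phi (v b 0).

Let evD u v : ev (u - v) = ev u - ev v.
Proof. by rewrite /ev -sumrB; apply: eq_bigr => b _; rewrite !mxE rmorphB mulrBr. Qed.

Let evZ r v : ev v * phi r = ev (r *: v).
Proof. by rewrite /ev mulr_suml; apply: eq_bigr => b _; rewrite !mxE mulrC rmorphM mulrA. Qed.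

Let ev_inj u v : N (ev u - ev v) -> u = v.
Proof.
rewrite -evD => /m_indep H; apply/colP => b.
by apply/eqP; rewrite -subr_eq0; have := H b; rewrite !mxE => ->.
Qed.

Let mat j : exists D : 'M[R0]_k * R0, D.2 != 0 /\
  forall a, N (m a * y j * phi D.2 - \sum_b m b * phi (D.1 b a)).
Proof.
have H a : exists x : ('I_k -> R0) * R0, x.2 != 0 /\
   N (m a * y j * phi x.2 + \sum_b m b * phi (x.1 b)).
  by have [c [d d0 Nd]] := m_span (Py j (mP a)); exists (c, d).
have [x xP] := choice H.
(* One common denominator for all columns. *)
pose d := \prod_a (x a).2.
pose d' a := \prod_(b | b != a) (x b).2.
have dE a : d = (x a).2 * d' a by rewrite /d (bigD1 a).
exists (\matrix_(b, a) - ((x a).1 b * d' a), d); split=> /= [|a].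
  by rewrite prodf_seq_neq0; apply/allP => a _; rewrite (xP a).1.
have -> : m a * y j * phi d - \sum_b m b * phi ((\matrix_(b, a) - ((x a).1 b * d' a)) b a) =
   (m a * y j * phi (x a).2 + \sum_b m b * phi ((x a).1 b)) * phi (d' a).
  rewrite (dE a) rmorphM mulrA mulrDl mulr_suml; congr (_ + _).
  rewrite -sumrN; apply: eq_bigr => b _.
  by rewrite mxE rmorphN mulrN opprK rmorphM mulrA.
by apply: NM; exact: (xP a).2.
Qed.

Lemma semilinear_det : exists dl d : J -> R0,
  (forall j, dl j != 0) /\ (forall j, d j != 0) /\ forall i j,
  dl j * sg j (dl i) * (sg i (d j) * d i) ^+ k =
  q i j ^+ k * dl i * sg i (dl j) * (sg j (d i) * d j) ^+ k.
Proof.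
have [D DP] := choice mat.
pose Mt j := (D j).1; pose d j := (D j).2.
have d0 j : d j != 0 by exact: (DP j).1.
have step j v : N (ev v * y j * phi (d j) - ev (Mt j *m map_mx (sg j) v)).
  have -> : ev v * y j * phi (d j) - ev (Mt j *m map_mx (sg j) v) =
     \sum_a (m a * y j * phi (d j) - \sum_b m b * phi (Mt j b a)) * phi (sg j (v a 0)).
    under [RHS]eq_bigr do rewrite mulrBl.
    rewrite sumrB; congr (_ - _).
      rewrite /ev !mulr_suml; apply: eq_bigr => a _.
      by rewrite -!mulrA; congr (_ * _); rewrite mulrA phiy -mulrA -!rmorphM mulrC.
    under [RHS]eq_bigr do rewrite mulr_suml.
    rewrite exchange_big /ev; apply: eq_bigr => b _ /=.
    rewrite mxE rmorph_sum /= mulr_sumr; apply: eq_bigr => a _.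
    by rewrite !mxE rmorphM mulrA.
  by apply: Nsum => a; apply: NM; exact: (DP j).2.
(* A kernel vector, pulled back by [sg' j], gives a combination of the [m b] that [y j] sends into
   [N] up to a denominator; [y j] is invertible, so independence makes it zero. *)
have dl0 j : \det (Mt j) != 0.
  apply/negP; rewrite -det_tr => /det0P [v v0 vP].
  pose w : 'cV_k := map_mx (sg' j) v^T.
  have wE : map_mx (sg j) w = v^T by apply/matrixP => a b; rewrite !mxE sgK.
  have := step j w; rewrite wE.
  have -> : Mt j *m v^T = 0 by apply: trmx_inj; rewrite trmx_mul trmxK vP trmx0.
  rewrite [ev 0](_ : _ = 0) ?subr0; last first.
    by rewrite /ev big1 // => b _; rewrite mxE rmorph0 mulr0.
  rewrite -mulrA -{1}[d j](sgK j) -phiy mulrA => /(NM (y' j)).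
  rewrite -mulrA yK mulr1 evZ -[ev _]subr0 => H.
  have w0 : sg' j (d j) *: w = 0.
    apply: ev_inj; move: H; congr (N (_ - _)).
    by rewrite /ev big1 // => b _; rewrite mxE rmorph0 mulr0.
  case/eqP: v0; apply: trmx_inj; rewrite trmx0 -wE.
  have sd0 : sg' j (d j) != 0.
    by apply/eqP => /(congr1 (sg j)); rewrite sgK rmorph0; apply/eqP.
  suff -> : w = 0 by rewrite map_mx0.
  move: (w) w0 => u u0; apply/colP => b; move/colP/(_ b): u0; rewrite !mxE => /eqP.
  by rewrite mulf_eq0 (negbTE sd0) => /eqP.
exists (fun j => \det (Mt j)), d; split=> //; split=> // i j.
(* The matrix of the product [y i0 * y j0]. Both orders are then brought to the common denominator
   [A * B] and compared by the relation [yy]. *)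
have two i0 j0 a : N (ev (delta_mx a 0) * (y i0 * y j0) * phi (sg j0 (d i0) * d j0)
    - ev (Mt j0 *m map_mx (sg j0) (Mt i0) *m delta_mx a 0)).
  have dE : map_mx (sg i0) (delta_mx a 0 : 'cV[R0]_k) = delta_mx a 0.
    by apply/matrixP => b c; rewrite !mxE; case: (_ && _); rewrite ?rmorph1 ?rmorph0.
  have dE' : map_mx (sg j0) (delta_mx a 0 : 'cV[R0]_k) = delta_mx a 0.
    by apply/matrixP => b c; rewrite !mxE; case: (_ && _); rewrite ?rmorph1 ?rmorph0.
  have := step i0 (delta_mx a 0); rewrite dE => /(NM (y j0 * phi (d j0))).
  have := step j0 (Mt i0 *m delta_mx a 0).
  rewrite map_mxM dE' mulmxA => H1 H2; have := ND H2 H1.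
  congr N; rewrite mulrBl -!mulrA addrA addrNK; congr (_ * _ - _).
  by rewrite rmorphM !mulrA -[y i0 * phi _ * y j0]mulrA phiy !mulrA.
set A := sg j (d i) * d j; set B := sg i (d j) * d i.
have E : B *: (Mt j *m map_mx (sg j) (Mt i)) = (q i j * A) *: (Mt i *m map_mx (sg i) (Mt j)).
  apply/matrixP => b a.
  have := two i j a; have := two j i a.
  set M1 := Mt i *m _; set M2 := Mt j *m _ => H1 H2.
  have H3 := NM (phi (q i j * A)) H1; have H4 := NM (phi B) H2.
  have := NB H3 H4; rewrite !mulrBl !evZ (yy i j) -/A -/B.
  have -> : ev (delta_mx a 0) * (y j * y i) * phi B * phi (q i j * A)
    = ev (delta_mx a 0) * (y j * y i * phi (q i j)) * phi A * phi B.
    by rewrite -!mulrA -!rmorphM; do 3! congr (_ * _); congr (phi _); rewrite mulrC mulrA.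
  rewrite opprB addrC addrA addrNK => /ev_inj/colP/(_ b).
  by rewrite !scalemxAl -!colE !mxE.
have := congr1 determinant E; rewrite !detZ !det_mulmx !det_map_mx [(q i j * A) ^+ k]exprMn.
move=> H; rewrite [LHS]mulrC H -!mulrA; congr (_ * _).
by rewrite mulrC mulrA.
Qed.

End SemilinearDet.

(** * Leading monomials and division with remainder *)

Section Leading.
Variables (F : fieldType) (n : nat).
Implicit Types (P N : {mpoly F[n]} -> Prop).

Definition lead_set P (m : 'X_{1..n}) := exists p, [/\ P p, p != 0 & mlead p = m].

Lemma mlead_cancel (p q : {mpoly F[n]}) : p != 0 -> q != 0 -> mlead q = mlead p ->
  let r := p - (mleadc p / mleadc q) *: q in r = 0 \/ (mlead r < mlead p)%O.
Proof.
move=> p0 q0 qp r; have [->|r0] := eqVneq r 0; [by left|right].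
rewrite lt_neqAle; apply/andP; split; last first.
  apply: (le_trans (mleadB_le _ _)); rewrite leUx lexx /=.
  by apply: (le_trans (mleadZ_le _ _)); rewrite qp.
apply/eqP => rp; have: mleadc r != 0 by rewrite mleadc_eq0.
rewrite rp /r mcoeffB mcoeffZ -qp divfK ?mleadc_eq0 //.
by rewrite subrr eqxx.
Qed.

(** Division with remainder: a leading monomial is cancelled by an element of [N] when possible,
    otherwise by the fixed [g m] with leading monomial [m]. Only monomials counted by
    [covered_count] need the latter. *)
Lemma lead_spans P N s e : subsp P -> subsp N -> (forall p, N p -> P p) ->
  covered (lead_set P) (lead_set N) s e ->
  forall t, exists w : seq {mpoly F[n]}, [/\ (size w <= size s * t.+1 ^ e)%N,
    {in w, forall g, P g} &
    forall p, P p -> (msize p <= t.+1)%N -> spans N w p].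
Proof.
move=> sP sN NP cov t; have [l [lsz lP]] := covered_count cov t.
have ex m : exists g, lead_set P m -> [/\ P g, g != 0 & mlead g = m].
  have [[g gP]|ng] := pselect (lead_set P m); first by exists g.
  by exists 0.
have [g gP] := choice ex.
have Pex m : exists g', P g' /\ (lead_set P m -> [/\ P g', g' != 0 & mlead g' = m]).
  have [h|h] := pselect (lead_set P m); first by exists (g m); split=> //; have [] := gP _ h.
  by exists 0; split=> //; exact: sP.1.
have {g gP} [g gP] := choice Pex.
have H p : P p -> (msize p <= t.+1)%N ->
    exists c : 'X_{1..n} -> F, N (p - \sum_(m <- undup l) c m *: g m).
  move: {2}(mlead p) (erefl (mlead p)) => m; elim/(@ltmwf n): m p => m IH p pm Pp pt.
  have [->|p0] := eqVneq p 0.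
    by exists (fun=> 0); rewrite sub0r big1 => [|i _]; rewrite ?scale0r ?oppr0 //; exact: sN.1.
  have next q : P q -> q != 0 -> mlead q = m -> exists c : 'X_{1..n} -> F,
      N (p - (mleadc p / mleadc q) *: q - \sum_(m <- undup l) c m *: g m).
    move=> Pq q0 qm; have := @mlead_cancel p q p0 q0; rewrite qm pm => /(_ erefl) /=.
    set r := p - _; case=> [->|rm].
      by exists (fun=> 0); rewrite sub0r big1 => [|i _]; rewrite ?scale0r ?oppr0 //; exact: sN.1.
    apply: (IH _ rm) => //; first by apply: subspB => //; exact: subspZ.
    have [->|r0] := eqVneq r 0; first by rewrite msize0.
    (* The monomial order is graded, so a smaller leading monomial does not raise the degree. *)
    rewrite -mlead_deg //; apply: leq_trans pt; rewrite -(mlead_deg p0) pm ltnS.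
    by apply: lemc_mdeg; exact: ltW.
  have [[q [Nq q0 qm]]|nNm] := pselect (lead_set N m).
    have [|//|//|c cP] := next q; first exact: NP.
    exists c; have := subspD sN cP (subspZ (mleadc p / mleadc q) sN Nq).
    by congr N; rewrite addrAC addrNK.
  have Pm : lead_set P m by exists p.
  have [_ /(_ Pm) [Pg g0 gm]] := gP m.
  have [//|//|//|c cP] := next (g m).
  exists (fun m' => c m' + (m' == m)%:R * (mleadc p / mleadc (g m))).
  move: cP; congr N; under [in RHS]eq_bigr do rewrite scalerDl.
  rewrite big_split /= opprD addrA [LHS]addrAC; congr (_ - _).
  rewrite (bigD1_seq m) ?undup_uniq ?mem_undup //=.
    rewrite eqxx mul1r big1 ?addr0 // => i /negbTE ->.
    by rewrite mul0r scale0r.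
  by apply: lP => //; rewrite -ltnS -pm mlead_deg.
exists [seq g m | m <- undup l]; split.
- by rewrite size_map; apply: leq_trans lsz; exact: size_undup.
- by move=> _ /mapP [m _ ->]; case: (gP m).
- move=> p Pp pt; have [c cP] := H p Pp pt.
  exists (fun i => c (nth 0%MM (undup l) i)); move: cP; congr N; congr (_ - _).
  rewrite (big_nth 0%MM) big_mkord size_map; apply: eq_bigr => i _.
  by rewrite (nth_map 0%MM).
Qed.

(** The difference of the leading sets is covered by no slab, so [lead_spans] produces an empty
    spanning family. *)
Lemma lead_set_eq P N : subsp P -> subsp N -> (forall p, N p -> P p) ->
  (forall m, lead_set P m -> lead_set N m) -> forall p, P p -> N p.
Proof.
move=> sP sN NP H p Pp.
have cov : covered (lead_set P) (lead_set N) [::] 0.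
  by split=> // a /H Na /(_ Na).
have [w [wsz _ wP]] := lead_spans sP sN NP cov (msize p).
have [c] := wP p Pp (leqnSn _).
by move: wsz; rewrite mul0n leqn0 size_eq0 => /eqP->; rewrite big_ord0 subr0.
Qed.

End Leading.

(** * Twisted group algebras *)

Section MLin.
Variables (F : fieldType) (n : nat) (V : lmodType F) (X : 'X_{1..n} -> V).

Definition mlin (p : {mpoly F[n]}) : V := \sum_(m <- msupp p) p@_m *: X m.

Lemma mlinE (l : seq 'X_{1..n}) p : uniq l -> {subset msupp p <= l} ->
  mlin p = \sum_(m <- l) p@_m *: X m.
Proof.
move=> ul sl; rewrite (bigID (fun m => m \in msupp p)) /= [X in _ + X]big1 ?addr0; last first.
  by move=> m mp; rewrite memN_msupp_eq0 // scale0r.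
rewrite -big_filter; apply: perm_big; apply: uniq_perm; rewrite ?filter_uniq ?msupp_uniq //.
by move=> m; rewrite mem_filter; case: (boolP (m \in msupp p)) => // /sl ->.
Qed.

Lemma mlin_is_linear : linear mlin.
Proof.
move=> c p q; pose l := undup (msupp (c *: p + q) ++ msupp p ++ msupp q).
have ul : uniq l by exact: undup_uniq.
rewrite !(mlinE ul); try by move=> m; rewrite mem_undup !mem_cat => ->; rewrite ?orbT.
rewrite scaler_sumr -big_split; apply: eq_bigr => m _ /=.
by rewrite mcoeffD mcoeffZ scalerDl scalerA.
Qed.

HB.instance Definition _ := GRing.isLinear.Build F {mpoly F[n]} V _ mlin mlin_is_linear.

Lemma mlinX m : mlin 'X_[m] = X m.
Proof. by rewrite /mlin msuppX big_seq1 mcoeffX eqxx scale1r. Qed.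

End MLin.

Record tbasis (F : fieldType) (A : zmodType) (S : algType F) (bar : A -> S) (tau : A -> A -> F) : Prop := {
  tau_neq0 : forall a b, tau a b != 0;
  tau_cocycle : forall a b c, tau a b * tau (a + b) c = tau b c * tau a (b + c);
  barM : forall a b, bar a * bar b = tau a b *: bar (a + b);
  bar_span : forall x : S, exists (l : seq A) (c : A -> F), x = \sum_(a <- l) c a *: bar a;
  bar_free : forall (l : seq A) (c : A -> F), uniq l -> \sum_(a <- l) c a *: bar a = 0 ->
    forall a, a \in l -> c a = 0 }.

Section Twisted.
Variables (F : fieldType) (A : zmodType) (S : algType F) (bar : A -> S) (tau : A -> A -> F).
Hypothesis T : tbasis bar tau.
Implicit Types a b : A.

Lemma bar_neq0 a : bar a != 0.
Proof.
apply/eqP => a0; have /eqP := oner_neq0 F; apply.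
by apply: (bar_free T (l := [:: a]) (c := fun=> 1)) => //; rewrite ?inE ?big_seq1 ?a0 ?scaler0.
Qed.

(** The cocycle identity makes [tau 0 a] independent of [a], so [bar 0] multiplies every term of the
    expansion of 1 by the same scalar. *)
Lemma bar0 : bar 0 = tau 0 0 *: 1.
Proof.
have t0 a : tau 0 a = tau 0 0.
  apply: (mulfI (tau_neq0 T 0 a)).
  by have := tau_cocycle T 0 0 a; rewrite !add0r mulrC => <-.
have [l [c E]] := bar_span T 1.
rewrite -[LHS]mulr1 E mulr_sumr scaler_sumr; apply: eq_bigr => a _.
by rewrite -scalerAr (barM T) add0r t0 !scalerA mulrC.
Qed.

Definition ibar a := (tau a (- a) * tau 0 0)^-1 *: bar (- a).

Lemma barK a : bar a * ibar a = 1.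
Proof.
rewrite /ibar -scalerAr (barM T) subrr bar0 !scalerA -mulrA mulVf ?scale1r //.
by rewrite mulf_neq0 ?(tau_neq0 T).
Qed.

Lemma ibarK a : ibar a * bar a = 1.
Proof.
have E : bar (- a) * bar a = (tau (- a) a * tau 0 0) *: 1.
  by rewrite (barM T) addNr bar0 scalerA.
have -> : ibar a = (tau (- a) a * tau 0 0)^-1 *: bar (- a).
  rewrite -[LHS]mul1r -(scale1r 1) -(@mulVf _ (tau (- a) a * tau 0 0)) ?mulf_neq0 ?(tau_neq0 T) //.
  by rewrite -scalerA -E -scalerAl -mulrA barK mulr1.
by rewrite -scalerAl E scalerA mulVf ?scale1r // mulf_neq0 ?(tau_neq0 T).
Qed.

(** The commutator pairing, an alternating bicharacter. *)
Definition chi a b := tau a b / tau b a.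

Lemma chi_neq0 a b : chi a b != 0.
Proof. by rewrite mulf_neq0 ?invr_eq0 ?(tau_neq0 T). Qed.

Lemma bar_comm a b : bar a * bar b = chi a b *: (bar b * bar a).
Proof. by rewrite !(barM T) scalerA divfK ?(tau_neq0 T) // addrC. Qed.

Lemma scale_bar_inj a c d : c *: bar a = d *: bar a -> c = d.
Proof.
move/eqP; rewrite -subr_eq0 -scalerBl scaler_eq0 (negbTE (bar_neq0 a)) orbF.
by rewrite subr_eq0 => /eqP.
Qed.

Lemma chiV a b : chi a b * chi b a = 1.
Proof. by rewrite /chi mulrA divfK ?(tau_neq0 T) // mulfV ?(tau_neq0 T). Qed.

Lemma chixx a : chi a a = 1.
Proof. by rewrite /chi mulfV ?(tau_neq0 T). Qed.

(** [bar c] is moved past [bar a * bar b] at once and in two steps. *)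
Lemma chiDl a b c : chi (a + b) c = chi a c * chi b c.
Proof.
have t0 := tau_neq0 T.
apply: (@scale_bar_inj (c + (a + b))); apply: (scalerI (t0 c (a + b))).
apply: (scalerI (t0 a b)).
have -> : tau a b *: (tau c (a + b) *: (chi (a + b) c *: bar (c + (a + b)))) =
    bar a * bar b * bar c.
  rewrite (barM T a b) -scalerAl bar_comm (barM T c) !scalerA; congr (_ *: _).
  by ring.
rewrite -mulrA (bar_comm b c) -scalerAr mulrA (bar_comm a c) -scalerAl scalerA -mulrA.
rewrite (barM T a b) -scalerAr (barM T c) !scalerA; congr (_ *: _).
by ring.
Qed.

Lemma chiDr a b c : chi c (a + b) = chi c a * chi c b.
Proof.
apply: (mulfI (chi_neq0 (a + b) c)); rewrite chiV chiDl.
by rewrite mulrACA !chiV mulr1.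
Qed.

Lemma chi0l b : chi 0 b = 1.
Proof. by apply: (mulfI (chi_neq0 0 b)); rewrite -chiDl addr0 mulr1. Qed.

Lemma chi0r b : chi b 0 = 1.
Proof. by apply: (mulfI (chi_neq0 b 0)); rewrite -chiDr addr0 mulr1. Qed.

Lemma chiNl a b : chi (- a) b = (chi a b)^-1.
Proof.
apply: (mulfI (chi_neq0 a b)); rewrite -chiDl subrr chi0l mulfV //; exact: chi_neq0.
Qed.

Lemma chiNr a b : chi b (- a) = (chi b a)^-1.
Proof.
apply: (mulfI (chi_neq0 b a)); rewrite -chiDr subrr chi0r mulfV //; exact: chi_neq0.
Qed.

Lemma chiMn_l a b k : chi (a *+ k) b = chi a b ^+ k.
Proof. by elim: k => [|k IH]; rewrite ?chi0l ?expr0 // mulrS chiDl IH exprS. Qed.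

Lemma chiMn_r a b k : chi b (a *+ k) = chi b a ^+ k.
Proof. by elim: k => [|k IH]; rewrite ?chi0r ?expr0 // mulrS chiDr IH exprS. Qed.

Lemma chiMz_l a b (k : int) : chi (a *~ k) b = chi a b ^ k.
Proof. by case: k => k; rewrite ?NegzE ?mulrNz ?chiNl -?pmulrn ?chiMn_l // -exprnP. Qed.

Lemma chiMz_r a b (k : int) : chi b (a *~ k) = chi b a ^ k.
Proof. by case: k => k; rewrite ?NegzE ?mulrNz ?chiNr -?pmulrn ?chiMn_r // -exprnP. Qed.

End Twisted.

Record coordinates (A : zmodType) (n : nat) (e : 'I_n -> A) (co : A -> 'I_n -> int) : Prop := {
  coE : forall a, a = \sum_i e i *~ co a i;
  coD : forall a b i, co (a + b) i = co a i + co b i;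
  co_e : forall i j, co (e i) j = (i == j)%:R }.

Section Coord.
Variables (A : zmodType) (n : nat) (e : 'I_n -> A) (co : A -> 'I_n -> int).
Hypothesis C : coordinates e co.

Lemma co0 i : co 0 i = 0.
Proof. by apply: (addrI (co 0 i)); rewrite -(coD C) !addr0. Qed.

Lemma coN a i : co (- a) i = - co a i.
Proof. by apply: (addrI (co a i)); rewrite -(coD C) !subrr co0. Qed.

Lemma coMn a k i : co (a *+ k) i = co a i *+ k.
Proof. by elim: k => [|k IH]; rewrite ?co0 ?mulr0n // !mulrS (coD C) IH. Qed.

Lemma coMz a (k : int) i : co (a *~ k) i = co a i *~ k.
Proof. by case: k => k; rewrite ?NegzE ?mulrNz ?coN -!pmulrn coMn. Qed.

Lemma co_sum (I : Type) (r : seq I) (P : pred I) (f : I -> A) i :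
  co (\sum_(k <- r | P k) f k) i = \sum_(k <- r | P k) co (f k) i.
Proof. by elim/big_rec2 : _ => [|k x y _ <-]; rewrite ?co0 // (coD C). Qed.

Lemma co_inj a b : (forall i, co a i = co b i) -> a = b.
Proof. by move=> H; rewrite (coE C a) (coE C b); under eq_bigr do rewrite H. Qed.

Definition monA (m : 'X_{1..n}) : A := \sum_i e i *+ m i.

Lemma co_monA m i : co (monA m) i = (m i)%:Z.
Proof.
rewrite /monA co_sum (bigD1 i) //= coMn (co_e C) eqxx big1 ?addr0 => [|j ji].
  by rewrite -[RHS]natz.
by rewrite coMn (co_e C) (negbTE ji) mul0rn.
Qed.

Lemma monAD m m' : monA (m + m')%MM = monA m + monA m'.
Proof. by rewrite -big_split; apply: eq_bigr => i _; rewrite mnmDE mulrnDr. Qed.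

Lemma monA_lift a : (forall i, 0 <= co a i) -> exists m, a = monA m.
Proof.
move=> a0; exists [multinom `|co a i|%N | i < n]; apply: co_inj => i.
by rewrite co_monA mnmE gez0_abs.
Qed.

Lemma monAMn i k : monA (U_(i) *+ k)%MM = e i *+ k.
Proof.
apply: co_inj => j; rewrite co_monA mulmnE mnm1E coMn (co_e C).
by case: eqP => _; rewrite ?mul1n ?mul0n ?mul0rn // -[LHS]natz.
Qed.

Lemma morph_coord (F : fieldType) (f : A -> F) : (forall a, f a != 0) ->
  (forall a b, f (a + b) = f a * f b) -> (forall i, f (e i) = 1) -> forall a, f a = 1.
Proof.
move=> f0 fD fe a.
have f1 : f 0 = 1 by apply: (mulfI (f0 0)); rewrite -fD addr0 mulr1.
have fN b : f b = 1 -> f (- b) = 1.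
  by move=> fb; apply: (mulfI (f0 b)); rewrite -fD subrr f1 fb mulr1.
have fMn b k : f b = 1 -> f (b *+ k) = 1.
  by move=> fb; elim: k => [|k IH]; rewrite ?mulr0n // mulrS fD fb IH mulr1.
rewrite (coE C a); elim/big_rec : _ => // i x _ fx; rewrite fD fx mulr1.
by case: (co a i) => k; rewrite ?NegzE ?mulrNz; [|apply: fN]; exact: fMn.
Qed.

End Coord.

(** * Right ideals with small quotients *)

Lemma mlead_eq (F : fieldType) n (p : {mpoly F[n]}) m : p@_m != 0 ->
  (forall k, p@_k != 0 -> (k <= m)%O) -> mlead p = m.
Proof.
move=> pm H; apply/le_anti/andP; split; last by apply: msupp_le_mlead; rewrite mcoeff_msupp.
apply: H; rewrite mleadc_eq0; apply: contraNneq pm => ->; by rewrite mcoeff0.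
Qed.

Section RightIdeals.
Variables (F : fieldType) (A : zmodType) (S : algType F) (bar : A -> S) (tau : A -> A -> F).
Hypothesis T : tbasis bar tau.
Variables (n : nat) (e : 'I_n -> A) (co : A -> 'I_n -> int).
Hypothesis C : coordinates e co.

Local Notation monA := (monA e).
(* Only a linear map: polynomials merely encode the elements of the algebra that
   are supported on the positive orthant. *)
Definition Phi : {mpoly F[n]} -> S := mlin (fun m => bar (monA m)).
HB.instance Definition _ := GRing.Linear.on Phi.

Lemma PhiX m : Phi 'X_[m] = bar (monA m).
Proof. exact: mlinX. Qed.

(* Right multiplication by a monomial, transported along [Phi]. *)
Definition star (p : {mpoly F[n]}) (m : 'X_{1..n}) : {mpoly F[n]} :=
  \sum_(k <- msupp p) (p@_k * tau (monA k) (monA m)) *: 'X_[k + m].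

Lemma Phi_star p m : Phi (star p m) = Phi p * bar (monA m).
Proof.
rewrite linear_sum /= [in RHS]/Phi /mlin mulr_suml; apply: eq_bigr => k _.
by rewrite linearZ /= PhiX -scalerAl (barM T) monAD scalerA.
Qed.

Lemma mcoeff_star p m k : (star p m)@_(k + m) = p@_k * tau (monA k) (monA m).
Proof.
rewrite /star linear_sum /=.
have [kp|kp] := boolP (k \in msupp p).
  rewrite (bigD1_seq k) ?msupp_uniq //= mcoeffZ mcoeffX eqxx mulr1 big1 ?addr0 // => j jk.
  by rewrite mcoeffZ mcoeffX eqm_add2r (negbTE jk) mulr0.
rewrite memN_msupp_eq0 // mul0r big_seq big1 // => j jp.
by rewrite mcoeffZ mcoeffX eqm_add2r; case: eqP => [jk|]; rewrite ?mulr0 //; rewrite jk (negbTE kp) in jp.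
Qed.

Lemma msupp_star p m x : (star p m)@_x != 0 -> exists2 k, x = (k + m)%MM & p@_k != 0.
Proof.
move=> H; have : has (fun k => x == (k + m)%MM) (msupp p).
  apply: contraNT H; rewrite -all_predC => /allP H.
  rewrite /star linear_sum /= big_seq big1 // => k /H /= /negbTE xk.
  by rewrite mcoeffZ mcoeffX eq_sym xk mulr0.
by case/hasP => k kp /eqP ->; exists k => //; rewrite -mcoeff_msupp.
Qed.

(** The cocycle only rescales coefficients by nonzero scalars, so the support is translated. *)
Lemma mlead_star p m : p != 0 -> star p m != 0 /\ mlead (star p m) = (mlead p + m)%MM.
Proof.
move=> p0; have l0 : (star p m)@_(mlead p + m) != 0.
  by rewrite mcoeff_star mulf_neq0 ?(tau_neq0 T) // mleadc_eq0.
split; first by apply: contraNneq l0 => ->; rewrite mcoeff0.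
apply: mlead_eq => // x /msupp_star [k -> pk].
by rewrite lemc_add2l msupp_le_mlead // mcoeff_msupp.
Qed.

Lemma msize_star p m : (msize (star p m) <= msize p + mdeg m)%N.
Proof.
have [->|p0] := eqVneq p 0; first by rewrite /star msupp0 big_nil msize0.
have [s0 sl] := mlead_star m p0.
by rewrite -mlead_deg // sl mdegD -(mlead_deg p0) addSn.
Qed.

Definition rideal (P : S -> Prop) :=
  P 0 /\ (forall x y, P x -> P y -> P (x + y)) /\ forall x s, P x -> P (x * s).

Definition pull (P : S -> Prop) p := P (Phi p).

Lemma rideal_subsp P : rideal P -> subsp P.
Proof.
move=> [P0 [PD PM]]; split=> // c x y Px Py; apply: PD => //.
by rewrite -[c *: x]mulr1 -scalerAl scalerAr; exact: PM.
Qed.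

Lemma pull_subsp P : subsp P -> subsp (pull P).
Proof.
move=> [P0 PZ]; split; first by rewrite /pull linear0.
by move=> c x y Px Py; rewrite /pull linearP; exact: PZ.
Qed.

Lemma pull_upclosed P : rideal P -> upclosed (lead_set (pull P)).
Proof.
move=> [P0 [PD PM]] a b [p [Pp p0 pa]] ab.
have [s0 sl] := mlead_star (b - a)%MM p0.
exists (star p (b - a)%MM); split=> //; first by rewrite /pull Phi_star; exact: PM.
by rewrite sl pa addmC submK.
Qed.

(** A unit clears all negative exponents, so a right ideal is determined by its pullback to
    polynomials. *)
Lemma pushX (x : S) : exists m p, x * bar (monA m) = Phi p.
Proof.
have [l [c ->]] := bar_span T x.
pose M := (\sum_(a <- l) \sum_i `|co a i|)%N.
exists [multinom M | _ < n].
have H a : a \in l -> exists p, c a *: bar a * bar (monA [multinom M | _ < n]) = Phi p.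
  move=> al; have [|m mE] := monA_lift C (a := a + monA [multinom M | _ < n]).
    move=> i; rewrite (coD C) (co_monA C) mnmE.
    have aM : (`|co a i| <= M)%N.
      apply: (@leq_trans (\sum_i `|co a i|)%N); first by rewrite (bigD1 i) //= leq_addr.
      by rewrite /M (big_rem a) //= leq_addr.
    by lia.
  exists ((c a * tau a (monA [multinom M | _ < n])) *: 'X_[m]).
  by rewrite linearZ /= PhiX -scalerAl (barM T) mE scalerA.
rewrite mulr_suml big_seq; elim/big_rec : _ => [|a y al [p ->]].
  by exists 0; rewrite linear0.
by have [q ->] := H a al; exists (q + p); rewrite linearD.
Qed.

Lemma spans_Phi N w q : spans (pull N) w q -> spans N (map Phi w) (Phi q).
Proof.
case=> c cP; exists c; move: cP; rewrite /pull linearB; congr (N (_ - _)).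
rewrite (linear_sum Phi) size_map; apply: eq_bigr => l _.
by rewrite linearZ /= (nth_map 0).
Qed.

Definition virtually_commutative :=
  exists psi : A -> int, [/\ forall a b, psi (a + b) = psi a + psi b,
    exists a, psi a != 0 & exists2 K, (0 < K)%N &
    forall a b, psi a = 0 -> psi b = 0 -> chi tau a b ^+ K = 1].

Definition ev i : {rmorphism {poly F} -> S} := horner_alg (bar (e i)).

Lemma evE i (r : {poly F}) : ev i r = \sum_(s < size r) r`_s *: bar (e i) ^+ s.
Proof.
rewrite -{1}[r]coefK poly_def /= linear_sum /=; apply: eq_bigr => s _.
by rewrite linearZ /= rmorphXn /= horner_algX mulr_algl.
Qed.

Lemma bar_exp i s : exists2 c, c != 0 & bar (e i) ^+ s = c *: bar (e i *+ s).
Proof.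
elim: s => [|s [c c0 IH]].
  exists (tau 0 0)^-1; first by rewrite invr_eq0 (tau_neq0 T).
  by rewrite expr0 mulr0n (bar0 T) scalerA mulVf ?scale1r ?(tau_neq0 T).
exists (c * tau (e i *+ s) (e i)); first by rewrite mulf_neq0 ?(tau_neq0 T).
by rewrite exprSr IH -scalerAl (barM T) scalerA -mulrSr.
Qed.

Lemma Phi_exp p i s : exists2 q, Phi p * bar (e i) ^+ s = Phi q & (msize q <= msize p + s)%N.
Proof.
have [c _ ->] := bar_exp i s; exists (c *: star p (U_(i) *+ s)%MM).
  by rewrite linearZ /= Phi_star (monAMn C) scalerAr.
apply: (leq_trans (msizeZ_le _ _)); apply: (leq_trans (msize_star _ _)).
by rewrite mdegMn mdeg1 mul1n.
Qed.

(** Conjugation by [bar (e j)] on polynomials in [bar (e i)]. *)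
Definition sg i j : {rmorphism {poly F} -> {poly F}} := comp_poly (chi tau (e i) (e j) *: 'X).
Definition sg' i j (r : {poly F}) : {poly F} := r \Po ((chi tau (e i) (e j))^-1 *: 'X).

Lemma sgK i j : cancel (sg' i j) (sg i j).
Proof.
move=> r; rewrite /sg /sg' /= -comp_polyA comp_polyZ comp_polyX scalerA mulVf ?scale1r ?comp_polyXr //.
exact: (chi_neq0 T).
Qed.

Lemma ev_comm i j r : ev i r * bar (e j) = bar (e j) * ev i (sg i j r).
Proof.
elim/poly_ind: r => [|r c IH]; first by rewrite !rmorph0 mul0r mulr0.
rewrite [sg i j _]/= comp_poly_MXaddC !rmorphD !rmorphM mulrDl mulrDr; congr (_ + _).
  rewrite -[r \Po _]/(sg i j r) [ev i 'X]horner_algX.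
  rewrite [X in _ = _ * (_ * X)](_ : _ = chi tau (e i) (e j) *: bar (e i)).
    by rewrite -mulrA (bar_comm T) -!scalerAr !mulrA IH.
  by rewrite /= linearZ /= horner_algX mulr_algl.
by rewrite /= !horner_algC -scalerAl -scalerAr mul1r mulr1.
Qed.

Lemma lead_sg i j r : lead_coef (sg i j r) = lead_coef r * chi tau (e i) (e j) ^+ (size r).-1.
Proof.
have c0 := chi_neq0 T (e i) (e j).
have sX : size (chi tau (e i) (e j) *: 'X : {poly F}) = 2 by rewrite size_scale // size_polyX.
rewrite /= lead_coef_comp ?sX // lead_coefZ lead_coefX mulr1 //.
Qed.

Lemma max_of (I : finType) (f : I -> nat) : exists t, forall i, (f i <= t)%N.
Proof. by exists (\max_i f i)%N => i; exact: leq_bigmax. Qed.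

Lemma rideal_exp P x i s : rideal P -> P x -> P (x * bar (e i) ^+ s).
Proof. by move=> [_ [_ PM]] Px; exact: PM. Qed.

Section Torsionfree.
Variables (P N : S -> Prop) (i0 : 'I_n).
Hypotheses (rP : rideal P) (rN : rideal N) (NP : forall x, N x -> P x).

Let Q x := P x /\ exists p, x = Phi p.

(** Multiplying [k] independent elements of size at most [t] by the powers of [bar (e i0)] up to [t]
    gives [k * t.+1] elements independent over [F], while linear growth leaves room for at most
    [size s * (t + t).+1]. *)
Lemma rank_bound s : covered (lead_set (pull P)) (lead_set (pull N)) s 1 ->
  forall k (v : 'I_k -> S), (forall i, Q (v i)) ->
  indep (fun x r => x * ev i0 r) (fun=> True) N v -> (k <= (size s).*2)%N.
Proof.
move=> cov k v Qv iv.
have [p pE] := choice (fun i => (Qv i).2).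
have [t tP] := max_of (fun i => msize (p i)).
have sP := pull_subsp (rideal_subsp rP); have sN := pull_subsp (rideal_subsp rN).
have [w [wsz _ wP]] := lead_spans sP sN (fun p => @NP (Phi p)) cov (t + t).
pose u (x : 'I_k * 'I_t.+1) := v x.1 * bar (e i0) ^+ x.2.
have : (#|{: 'I_k * 'I_t.+1}| <= size (map Phi w))%N.
  apply: (spans_card (v := u) (rideal_subsp rN)) => [[i j]|a].
    have [q qE qt] := Phi_exp (p i) i0 j.
    have uq : u (i, j) = Phi q by rewrite /u /= pE qE.
    have [||c cP] := wP q.
    - by rewrite /pull -uq; apply: rideal_exp => //; exact: (Qv i).1.
    - apply: (leq_trans qt); rewrite -addnS; apply: leq_add; first exact: tP.
      by apply: ltnW.
    by rewrite uq; apply: spans_Phi; exists c.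
  pose r i : {poly F} := \poly_(j < t.+1) a (i, inord j).
  have -> : \sum_x a x *: u x = \sum_i v i * ev i0 (r i).
    rewrite (eq_bigr (fun x => a (x.1, x.2) *: u (x.1, x.2))) => [|[i j] _ //].
    rewrite -(pair_bigA _ (fun i j => a (i, j) *: u (i, j))) /=; apply: eq_bigr => i _.
    rewrite /r poly_def rmorph_sum mulr_sumr; apply: eq_bigr => j _ /=.
    by rewrite linearZ /= rmorphXn /= horner_algX mulr_algl -scalerAr inord_val.
  move=> /(iv _ (fun=> Logic.I)) r0 [i j].
  by have := congr1 (fun r : {poly F} => r`_j) (r0 i); rewrite coef_poly ltn_ord coef0 inord_val.
rewrite card_prod !card_ord size_map => h.
have := leq_trans h wsz; rewrite expn1.
case: t {tP wsz wP u h} => [|t]; nia.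
Qed.

Lemma torsionfree_commutative : mdim_le (lead_set (pull P)) (lead_set (pull N)) 1 ->
  forall p, P (Phi p) -> (forall r, N (Phi p * ev i0 r) -> r = 0) -> virtually_commutative.
Proof.
move=> dimPN p Pp p_free.
have [s cov] := mdim_covered (pull_upclosed rP) (pull_upclosed rN) dimPN.
have act0 (v : S) : v * ev i0 0 = 0 by rewrite rmorph0 mulr0.
have [k [v [Qv iv sv]]] := max_indep act0 (rank_bound cov).
have k0 : (0 < k)%N.
  case: k v Qv iv sv => // v _ _ sv; have [|c [d [_ _ d0]]] := sv (Phi p).
    by split=> //; exists p.
  by rewrite big_ord0 addr0 => /p_free d0'; rewrite d0' eqxx in d0.
have Qy x j : Q x -> Q (x * bar (e j)).
  move=> [Px [r xE]]; split; first exact: rP.2.2.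
  by exists (star r U_(j)%MM); rewrite xE Phi_star -[U_(j)%MM]mulm1n (monAMn C) mulr1n.
have [N0 [ND NM]] := rN.

have yy i j : bar (e i) * bar (e j) = bar (e j) * bar (e i) * ev i0 (chi tau (e i) (e j))%:P.
  by rewrite (bar_comm T) /= horner_algC -scalerAr mulr1.
have iv' (c : 'I_k -> {poly F}) : N (\sum_a v a * ev i0 (c a)) -> forall a, c a = 0.
  exact: iv.
have sv' u : Q u -> exists c : 'I_k -> {poly F}, exists2 d : {poly F}, d != 0 &
    N (u * ev i0 d + \sum_a v a * ev i0 (c a)).
  by move=> /sv [c [d [_ _ d0 h]]]; exists c; exists d.
have [dl [d [dl0 [d0 H]]]] := semilinear_det (fun j => barK T (e j)) (sgK i0)
  (ev_comm i0) yy N0 ND NM Qy Qv iv' sv'.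
pose x := e i0.
pose deg (r : {poly F}) := (size r).-1.
(* The values of [psi] on the basis. At [i0] the value is the one for multiplication by [x] itself,
   with determinant [x ^+ k] and denominator 1. *)
pose t j : int := if j == i0 then - k%:Z else (k * deg (d j))%:Z - (deg (dl j))%:Z.
have c0 := chi_neq0 T.
(* In the determinant relation the leading coefficients of [dl] and [d] cancel; by [lead_sg] each
   [sg] leaves a power of the pairing with [x], the exponent being a degree. *)
have key i j : chi tau (e i) (e j) ^+ k = chi tau x (e i) ^ t j * chi tau x (e j) ^ (- t i).
  rewrite /t; case: (eqVneq i i0) => [->|ii0]; case: (eqVneq j i0) => [->|ji0].
  - by rewrite !(chixx T) expr1n !exp1rz mulr1.
  - by rewrite (chixx T) exp1rz mul1r opprK -exprnP.
  - by rewrite (chixx T) exp1rz mulr1 -exprz_inv -exprnP; congr (_ ^+ _); apply: (mulfI (c0 x (e i))); rewrite (chiV T) mulfV.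
  rewrite /x; have := congr1 lead_coef (H i j).
  rewrite !lead_coefM !lead_coef_exp !lead_coefM !lead_sg lead_coefC.
  set qi := chi tau (e i0) (e i); set qj := chi tau (e i0) (e j); set qij := chi tau (e i) (e j).
  have qi0 : qi != 0 := c0 _ _; have qj0 : qj != 0 := c0 _ _; clearbody qi qj qij.
  have L (r : {poly F}) : r != 0 -> lead_coef r != 0 by rewrite lead_coef_eq0.
  have := L _ (d0 j); have := L _ (d0 i); have := L _ (dl0 j); have := L _ (dl0 i).
  rewrite -/(deg _) -/(deg (dl j)) -/(deg (d i)) -/(deg (d j)).
  move: (lead_coef (dl i)) (lead_coef (dl j)) (lead_coef (d i)) (lead_coef (d j)) => a b f g a0 b0 f0 g0 E.
  have E1 : qj ^+ deg (dl i) * qi ^+ (k * deg (d j)) = qij ^+ k * qi ^+ deg (dl j) * qj ^+ (k * deg (d i)).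
    have X0 : a * b * (f * g) ^+ k != 0 by rewrite !mulf_neq0 // expf_neq0 // mulf_neq0.
    apply: (mulfI X0); move: E; rewrite !exprMn -!exprM ![(deg _ * k)%N]mulnC => E.
    transitivity (b * (a * qj ^+ deg (dl i)) * (g ^+ k * qi ^+ (k * deg (d j)) * f ^+ k)); first by ring.
    by rewrite E; ring.
  have expz (z : F) (m' n' : nat) : z != 0 -> z ^+ m' * z ^ (n'%:Z - m'%:Z) = z ^+ n'.
    by move=> z0; rewrite exprnP -expfzDr // addrC subrK.
  have Y0 : qi ^+ deg (dl j) * qj ^+ (k * deg (d i)) != 0 by rewrite mulf_neq0 // expf_neq0.
  apply: (mulfI Y0); rewrite opprB mulrACA !expz // mulrC mulrA -E1 mulrC //.
pose psi a := \sum_j co a j * t j.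
have psiD a b : psi (a + b) = psi a + psi b.
  by rewrite -big_split; apply: eq_bigr => j _; rewrite (coD C) mulrDl.
have psie j : psi (e j) = t j.
  rewrite /psi (bigD1 j) //= (co_e C) eqxx mul1r big1 ?addr0 // => i ij.
  by rewrite (co_e C) eq_sym (negbTE ij) mul0r.
have xz (z : F) (u v' : int) : z != 0 -> z ^ (u + v') = z ^ u * z ^ v' by move=> z0; rewrite expfzDr.
(* The left side is multiplicative in [a] and in [b], so [key] suffices. *)
have G a b : chi tau a b ^+ k * chi tau x a ^ (- psi b) * chi tau x b ^ psi a = 1.
  have f0 a' b' : chi tau a' b' ^+ k * chi tau x a' ^ (- psi b') * chi tau x b' ^ psi a' != 0.
    by rewrite !mulf_neq0 // ?expf_neq0 ?expfz_neq0 ?c0.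
  move: b; apply: (morph_coord C) => [//|b b'|j].
    rewrite psiD !(chiDr T) opprD !xz ?c0 // exprMn expfzMl; ring.
  move: a; apply: (morph_coord C) => [//|a a'|i].
    rewrite psiD (chiDl T) (chiDr T) !xz ?c0 // exprMn expfzMl; ring.
  rewrite !psie key -/x -[X in X = _]mulrA mulrACA -!xz ?c0 // subrr addNr.
  by rewrite !expr0z mulr1.
exists psi; split=> //; first by exists (e i0); rewrite psie /t eqxx oppr_eq0 -lt0n.
by exists k => // a b pa pb; have := G a b; rewrite pa pb oppr0 !expr0z !mulr1.
Qed.

End Torsionfree.

Lemma ev_lead i (c : {poly F}) : c != 0 ->
  exists q, [/\ ev i c = Phi q, q != 0 & mlead q = (U_(i) *+ (size c).-1)%MM].
Proof.
move=> c0.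
have ex s : exists k, k != 0 /\ bar (e i) ^+ s = k *: bar (e i *+ s).
  by have [k k0 kE] := bar_exp i s; exists k.
have [k kP] := choice ex.
pose q : {mpoly F[n]} := \sum_(s < size c) (c`_s * k s) *: 'X_[U_(i) *+ s].
have Uinj a b : (U_(i) *+ a)%MM = (U_(i) *+ b)%MM -> a = b.
  by move/mnmP/(_ i); rewrite !mulmnE mnm1E eqxx !mul1n.
have lc : q@_(U_(i) *+ (size c).-1)%MM != 0.
  have sc : ((size c).-1 < size c)%N by rewrite prednK // size_poly_gt0.
  rewrite linear_sum (bigD1 (Ordinal sc)) //= mcoeffZ mcoeffX eqxx mulr1 big1 ?addr0 => [|j js].
    by rewrite mulf_neq0 ?(kP _).1 // -lead_coefE lead_coef_eq0.
  rewrite mcoeffZ mcoeffX; case: eqP => [/Uinj h|]; last by rewrite mulr0.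
  by case/eqP: js; apply/val_inj.
exists q; split.
- rewrite evE (linear_sum Phi); apply: eq_bigr => s _.
  by rewrite linearZ /= PhiX (monAMn C) (kP s).2 scalerA.
- by apply: contraNneq lc => ->; rewrite mcoeff0.
apply: mlead_eq => // m qm.
have [s ms] : exists s : 'I_(size c), m = (U_(i) *+ s)%MM.
  apply: contrapT => /forallNP ns; case/eqP: qm.
  rewrite linear_sum big1 // => s _; rewrite /= mcoeffZ mcoeffX.
  by case: eqP => [h|]; rewrite ?mulr0 //; case: (ns s).
rewrite ms; apply: lem_leo; apply/mnm_lepP => j; rewrite !mulmnE leq_mul2l.
by apply/orP; right; rewrite -ltnS prednK ?ltn_ord // size_poly_gt0.
Qed.

(* Here [S] modulo [{s | Phi p * s in N}] has finite dimension. *)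
Lemma torsion_commutative (N : S -> Prop) (i0 : 'I_n) p : rideal N -> ~ N (Phi p) ->
  (forall i, exists2 c, c != 0 & N (Phi p * ev i c)) -> virtually_commutative.
Proof.
move=> [N0 [ND NM]] nNp tors.
pose N' s := N (Phi p * s).
have rN' : rideal N'.
  split; first by rewrite /N' mulr0.
  by split=> [x y|x s]; rewrite /N' ?mulrDr ?mulrA => *; [apply: ND|apply: NM].
pose P' (s : S) := True.
have rP' : rideal P' by [].
have sP := pull_subsp (rideal_subsp rP'); have sN := pull_subsp (rideal_subsp rN').
(* Torsion puts a pure power of every variable into the leading set of [N'], so every orthant of
   positive dimension meets it. *)
have dim0 : mdim_le (lead_set (pull P')) (lead_set (pull N')) 0.
  move=> a J /card_gt0P [j jJ] aO.
  have [c c0 cN] := tors j; have [q [qE q0 qm]] := ev_lead j c0.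
  have [|_] := aO (U_(j) *+ (size c).-1)%MM.
    apply/supportedP => i iJ; rewrite mulmnE mnm1E; case: eqP => [ji|//].
    by rewrite -ji jJ in iJ.
  apply; apply: (pull_upclosed rN' (a := mlead q)); last by rewrite qm lem_addl.
  by exists q; split=> //; rewrite /pull /N' -qE.
have [s cov] := mdim_covered (pull_upclosed rP') (pull_upclosed rN') dim0.
pose Q (x : S) := exists p, x = Phi p.
pose act (x : S) (r : F) := x * r%:A.
have act0 v : act v 0 = 0 by rewrite /act scale0r mulr0.
have bnd k (v : 'I_k -> S) : (forall i, Q (v i)) -> indep act (fun=> True) N' v -> (k <= size s)%N.
  move=> Qv iv; have [r rE] := choice Qv.
  have [t tP] := max_of (fun i => msize (r i)).
  have [w [wsz _ wP]] := lead_spans sP sN (fun _ _ => Logic.I) cov t.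
  rewrite expn0 muln1 in wsz; apply: leq_trans wsz.
  rewrite -(size_map Phi) -[k in (k <= _)%N]card_ord.
  apply: (spans_card (v := v) (rideal_subsp rN')) => [i|a].
    by rewrite rE; apply: spans_Phi; apply: wP => //; exact: leqW.
  move=> h; apply: (iv a (fun=> Logic.I)); move: h; congr N'; apply: eq_bigr => i _.
  by rewrite /act -scalerAr mulr1.
have [k [v [Qv iv sv]]] := max_indep act0 bnd.
have Qy x j : Q x -> Q (x * bar (e j)).
  by move=> [r ->]; exists (star r U_(j)%MM); rewrite Phi_star -[U_(j)%MM]mulm1n (monAMn C) mulr1n.
have k0 : (0 < k)%N.
  case: k v Qv iv sv => // v _ _ sv; have [|c [d [_ _ d0]]] := sv (bar 0).
    by exists 'X_[0]; rewrite PhiX -[0%MM](mulm0n U_(i0)) (monAMn C) mulr0n.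
  rewrite big_ord0 addr0 /N' /act (bar0 T) -scalerAr mulr1 scalerA -scalerAr mulr1 => h.
  case: nNp; have := subspZ (d * tau 0 0)^-1 (rideal_subsp (conj N0 (conj ND NM))) h.
  by rewrite scalerA mulVf ?scale1r // mulf_neq0 ?(tau_neq0 T).
pose phi : {rmorphism F -> S} := in_alg S.
have phiC x (r : F) : phi r * x = x * phi r by rewrite /phi /= -scalerAl -scalerAr mul1r mulr1.
have yy i j : bar (e i) * bar (e j) = bar (e j) * bar (e i) * phi (chi tau (e i) (e j)).
  by rewrite (bar_comm T) /phi /= -scalerAr mulr1.
have sv' u : Q u -> exists c : 'I_k -> F, exists2 d : F, d != 0 &
    N' (u * phi d + \sum_a v a * phi (c a)).
  by move=> /sv [c [d [_ _ d0 h]]]; exists c; exists d.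
have [dl [d [dl0 [d0 H]]]] := semilinear_det (fun j => barK T (e j))
  (sg := fun=> idfun) (sg' := fun _ => id) (fun j => @frefl _ _ id) (fun j r => phiC (bar (e j)) r)
  yy (N := N') rN'.1 rN'.2.1 rN'.2.2 Qy Qv (iv ^~ (fun=> Logic.I)) sv'.
(* Here the pairing is torsion on all of [A], so any coordinate serves as [psi]. *)
exists (co ^~ i0); split; first by move=> a b; exact: (coD C).
  by exists (e i0); rewrite (co_e C) eqxx.
have c0 := chi_neq0 T.
exists k => // a b _ _; move: b; apply: (morph_coord C) => [b|b b'|j].
- by rewrite expf_neq0.
- by rewrite (chiDr T) exprMn.
move: a; apply: (morph_coord C) => [a|a a'|i].
- by rewrite expf_neq0.
- by rewrite (chiDl T) exprMn.
have := H i j; rewrite /= => E.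
have X0 : dl j * dl i * (d j * d i) ^+ k != 0 by rewrite !mulf_neq0 // expf_neq0 // mulf_neq0.
apply: (mulfI X0); rewrite mulr1 [RHS]E [d i * d j]mulrC; ring.
Qed.

(** An element of [P] outside [N], moved to a polynomial by a unit, is either torsion-free modulo
    [N] over the polynomials in one basis element or torsion over each of them. *)
Lemma dim1_commutative (P N : S -> Prop) (i0 : 'I_n) : rideal P -> rideal N ->
  (forall x, N x -> P x) -> mdim_le (lead_set (pull P)) (lead_set (pull N)) 1 ->
  forall x, P x -> ~ N x -> virtually_commutative.
Proof.
move=> rP rN NP dim1 x Px nNx.
have [m [p pE]] := pushX x.
have Pp : P (Phi p) by rewrite -pE; exact: rP.2.2.
have nNp : ~ N (Phi p).
  move=> Np; apply: nNx; rewrite -[x]mulr1 -(barK T (monA m)) mulrA pE; exact: rN.2.2.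
have [[i fi]|nf] := pselect (exists i, forall r, N (Phi p * ev i r) -> r = 0).
  exact: torsionfree_commutative rP rN NP dim1 p Pp fi.
apply: (torsion_commutative i0 rN nNp) => i; apply: contrapT => h; apply: nf; exists i => r Nr.
by apply/eqP; apply: contrapT => /negP r0; apply: h; exists r.
Qed.

End RightIdeals.

(** * Simple modules *)

Section RightModule.
Variables (F : fieldType) (S : algType F) (M : lmodType S^c).

Definition act (m : M) (x : S) : M := (x : S^c) *: m.

Lemma actA m x y : act (act m x) y = act m (x * y).
Proof. by rewrite /act scalerA. Qed.
Lemma act1 m : act m 1 = m.
Proof. exact: scale1r. Qed.
Lemma actDr m x y : act m (x + y) = act m x + act m y.
Proof. exact: scalerDl. Qed.
Lemma actDl m m' x : act (m + m') x = act m x + act m' x.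
Proof. exact: scalerDr. Qed.
Lemma act0r m : act m 0 = 0.
Proof. exact: scale0r. Qed.
Lemma act0l x : act 0 x = 0.
Proof. exact: scaler0. Qed.
Lemma actNl m x : act (- m) x = - act m x.
Proof. exact: scalerN. Qed.
Lemma act_suml (I : Type) (r : seq I) (P : pred I) (f : I -> M) x :
  act (\sum_(i <- r | P i) f i) x = \sum_(i <- r | P i) act (f i) x.
Proof. exact: scaler_sumr. Qed.
Lemma act_sumr (I : Type) (r : seq I) (P : pred I) m (f : I -> S) :
  act m (\sum_(i <- r | P i) f i) = \sum_(i <- r | P i) act m (f i).
Proof. by elim/big_rec2 : _ => [|i x y _ <-]; rewrite ?act0r ?actDr. Qed.

(** An alias of [M] that carries the vector space structure over [F], apart from the one over
    [S^c]. *)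
Definition resF : Type := M.
HB.instance Definition _ := GRing.Zmodule.on resF.
Definition scaleF (c : F) (m : resF) : resF := act m c%:A.
Let scaleFA a b v : scaleF a (scaleF b v) = scaleF (a * b) v.
Proof. by rewrite /scaleF actA -scalerAl mul1r scalerA mulrC. Qed.
Let scaleF1 : left_id 1 scaleF.
Proof. by move=> v; rewrite /scaleF scale1r act1. Qed.
Let scaleFDr : right_distributive scaleF +%R.
Proof. by move=> c x y; rewrite /scaleF actDl. Qed.
Let scaleFDl v : {morph scaleF^~ v : a b / a + b}.
Proof. by move=> a b; rewrite /scaleF scalerDl actDr. Qed.
HB.instance Definition _ := GRing.Zmodule_isLmodule.Build F resF scaleFA scaleF1 scaleFDr scaleFDl.

Lemma actZr (m : resF) (c : F) x : act m (c *: x) = c *: (act m x : resF).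
Proof. by rewrite -[RHS]/(act (act m x) c%:A) actA -scalerAr mulr1. Qed.

Lemma actZl (m : resF) (c : F) x : act (c *: m) x = c *: (act m x : resF).
Proof. by rewrite -[c *: m]/(act m c%:A) actA -scalerAl mul1r actZr. Qed.

Lemma subsp0 : subsp (fun v : resF => v = 0).
Proof. by split=> // c x y -> ->; rewrite scaler0 addr0. Qed.

End RightModule.

(** * Polynomials in commuting basis elements *)

Section Laurent.
Variables (F : fieldType) (A : zmodType) (S : algType F) (bar : A -> S) (tau : A -> A -> F).
Hypothesis T : tbasis bar tau.
Variables (n : nat) (b : 'I_n -> A).
Hypothesis chi_bb : forall i j, chi tau (b i) (b j) = 1.

Local Notation monB := (monA b).

(** It agrees with [bar (monB m)] up to a scalar, but these products multiply without a cocycle, so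
    [Ps] is a ring morphism. *)
Definition PX (m : 'X_{1..n}) : S := \prod_i bar (b i) ^+ m i.

Lemma bar_bC i j : bar (b i) * bar (b j) = bar (b j) * bar (b i).
Proof. by rewrite (bar_comm T) chi_bb scale1r. Qed.

Lemma PXD m m' : PX (m + m') = PX m * PX m'.
Proof.
have cX i j k l : GRing.comm (bar (b i) ^+ k) (bar (b j) ^+ l).
  by apply/commrX/commr_sym/commrX; exact: bar_bC.
have cP (r : seq 'I_n) i k : GRing.comm (bar (b i) ^+ k) (\prod_(j <- r) bar (b j) ^+ m j).
  by elim/big_rec : _ => [|j x _ H]; [exact: commr1 | apply: commrM].
rewrite /PX; elim: (index_enum _) => [|i r IH]; first by rewrite !big_nil mulr1.
rewrite !big_cons mnmDE exprD IH -!mulrA; congr (_ * _).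
by rewrite mulrA cP -mulrA.
Qed.

Lemma PX0 : PX 0%MM = 1.
Proof. by rewrite /PX big1 // => i _; rewrite mnm0E expr0. Qed.

Lemma PX_bar m : exists2 c, c != 0 & PX m = c *: bar (monB m).
Proof.
rewrite /PX /monA; elim: (index_enum _) => [|i r [c c0 IH]].
  exists (tau 0 0)^-1; first by rewrite invr_eq0 (tau_neq0 T).
  by rewrite !big_nil (bar0 T) scalerA mulVf ?scale1r ?(tau_neq0 T).
have [d d0 dE] := bar_exp T b i (m i).
exists (d * c * tau (b i *+ m i) (\sum_(j <- r) b j *+ m j)).
  by rewrite !mulf_neq0 ?(tau_neq0 T).
by rewrite !big_cons IH dE -scalerAl -scalerAr (barM T) !scalerA.
Qed.

Definition Ps : {mpoly F[n]} -> S := mlin PX.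
HB.instance Definition _ := GRing.Linear.on Ps.

Lemma PsX m : Ps 'X_[m] = PX m.
Proof. exact: mlinX. Qed.

Lemma PsM p q : Ps (p * q) = Ps p * Ps q.
Proof.
rewrite {1}[p]mpolyE {1}[q]mpolyE mulr_suml (linear_sum Ps) /= [in RHS]/Ps /mlin mulr_suml.
apply: eq_bigr => i _; rewrite mulr_sumr (linear_sum Ps) mulr_sumr.
apply: eq_bigr => j _; rewrite -scalerAl -scalerAr -mpolyXD scalerA linearZ /= PsX PXD.
by rewrite -scalerAl -scalerAr scalerA.
Qed.

Lemma PsD p q : Ps (p + q) = Ps p + Ps q.
Proof. exact: linearD. Qed.

Lemma PsZ c p : Ps (c *: p) = c *: Ps p.
Proof. exact: linearZ. Qed.

Lemma Ps0 : Ps 0 = 0.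
Proof. exact: linear0. Qed.

Lemma Ps_sum (I : Type) (r : seq I) (P : pred I) (f : I -> {mpoly F[n]}) :
  Ps (\sum_(i <- r | P i) f i) = \sum_(i <- r | P i) Ps (f i).
Proof. exact: linear_sum. Qed.

Lemma Ps1 : Ps 1 = 1.
Proof. by rewrite -mpolyX0 PsX PX0. Qed.

Lemma PsC p q : Ps p * Ps q = Ps q * Ps p.
Proof. by rewrite -!PsM mulrC. Qed.

(** Conjugation by [bar g] on polynomials; the monomials are its eigenvectors. *)
Definition twist (g : A) (p : {mpoly F[n]}) : {mpoly F[n]} :=
  \sum_(m <- msupp p) (p@_m * chi tau (monB m) g) *: 'X_[m].

Lemma mcoeff_tw g p m : (twist g p)@_m = p@_m * chi tau (monB m) g.
Proof.
rewrite /twist linear_sum /=; have [mp|mp] := boolP (m \in msupp p).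
  rewrite (bigD1_seq m) ?msupp_uniq //= mcoeffZ mcoeffX eqxx mulr1 big1 ?addr0 // => k km.
  by rewrite mcoeffZ mcoeffX (negbTE km) mulr0.
rewrite memN_msupp_eq0 // mul0r big_seq big1 // => k kp.
by rewrite mcoeffZ mcoeffX; case: eqP => [km|]; rewrite ?mulr0 //; rewrite km (negbTE mp) in kp.
Qed.

Lemma Ps_tw g p : Ps p * bar g = bar g * Ps (twist g p).
Proof.
rewrite /twist (linear_sum Ps) mulr_sumr [in LHS]/Ps /mlin mulr_suml; apply: eq_bigr => m _.
rewrite linearZ /= PsX; have [c c0 ->] := PX_bar m.
rewrite -!scalerAl -!scalerAr (bar_comm T) scalerA scalerA.
rewrite scalerA; congr (_ *: _); ring.
Qed.

Lemma tw_id d p : (forall i, chi tau (b i) d = 1) -> twist d p = p.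
Proof.
move=> h; have chi1 m : chi tau (monB m) d = 1.
  rewrite /monA; elim/big_rec : _ => [|i x _ IH]; first exact: (chi0l T).
  by rewrite (chiDl T) IH mulr1 (chiMn_l T) h expr1n.
by apply/mpolyP => m; rewrite mcoeff_tw chi1 mulr1.
Qed.

Lemma twK g : cancel (twist (- g)) (twist g).
Proof.
move=> p; apply/mpolyP => m; rewrite !mcoeff_tw (chiNr T) divfK //; exact: chi_neq0 T _ _.
Qed.

End Laurent.

Lemma lead_set_upclosed (F : fieldType) n (P : {mpoly F[n]} -> Prop) :
  (forall p q, P p -> P (p * q)) -> upclosed (lead_set P).
Proof.
move=> PM a b [p [Pp p0 pa]] ab; have X0 : 'X_[b - a] != 0 :> {mpoly F[n]}.
  by rewrite -msize_poly_eq0 msizeX.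
exists (p * 'X_[b - a]); split; [exact: PM | by rewrite mulf_neq0 |].
by rewrite mleadM // mleadXm pa addmC submK.
Qed.

Section SupportedPolynomials.
Variables (F : fieldType) (n : nat) (J : {set 'I_n}).
Implicit Types p q : {mpoly F[n]}.

Definition poly_on p := forall m, p@_m != 0 -> supported J m.

Lemma poly_on_sum (I : Type) (r : seq I) (P : pred I) (f : I -> {mpoly F[n]}) :
  (forall i, P i -> poly_on (f i)) -> poly_on (\sum_(i <- r | P i) f i).
Proof.
move=> H; elim/big_rec : _ => [m|i p Pi pJ m]; first by rewrite mcoeff0 eqxx.
rewrite mcoeffD; have [E|/(H _ Pi)//] := eqVneq (f i)@_m 0.
by rewrite E add0r => /pJ.
Qed.

Lemma poly_on_X m : supported J m -> poly_on 'X_[m].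
Proof. by move=> mJ k; rewrite mcoeffX; have [<-|] := eqVneq m k; rewrite ?eqxx. Qed.

Lemma poly_onZ c p : poly_on p -> poly_on (c *: p).
Proof. by move=> pJ m; rewrite mcoeffZ mulf_eq0 negb_or => /andP [_ /pJ]. Qed.

Lemma poly_onD p q : poly_on p -> poly_on q -> poly_on (p + q).
Proof.
move=> pJ qJ m; rewrite mcoeffD; have [->|/pJ//] := eqVneq p@_m 0.
by rewrite add0r => /qJ.
Qed.

Lemma poly_on1 : poly_on 1.
Proof. by rewrite -mpolyX0; apply: poly_on_X; exact: supported0. Qed.

Lemma poly_onM p q : poly_on p -> poly_on q -> poly_on (p * q).
Proof.
move=> pJ qJ; rewrite [p]mpolyE [q]mpolyE mulr_suml big_seq; apply: poly_on_sum => i ip.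
rewrite mulr_sumr big_seq; apply: poly_on_sum => j jq.
rewrite -scalerAl -scalerAr -mpolyXD; do 2! apply: poly_onZ; apply: poly_on_X.
by apply: supportedD; [apply: pJ | apply: qJ]; rewrite -mcoeff_msupp.
Qed.

Lemma poly_on_exp p k : poly_on p -> poly_on (p ^+ k).
Proof. by move=> pJ; elim: k => [|k IH]; rewrite ?expr0 ?exprS; [exact: poly_on1 | exact: poly_onM]. Qed.

Lemma poly_on_prod (I : Type) (r : seq I) (P : pred I) (f : I -> {mpoly F[n]}) :
  (forall i, P i -> poly_on (f i)) -> poly_on (\prod_(i <- r | P i) f i).
Proof. by move=> H; elim/big_rec : _ => [|i p Pi pJ]; [exact: poly_on1 | apply: poly_onM => //; exact: H]. Qed.

End SupportedPolynomials.

(** Modulo [1 + f * 'X_i] the element [f * 'X_i] is -1, so [f] is a unit there; a power of [f]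
    divisible by this polynomial would make it a unit, although its degree is positive. *)
Lemma power_not_multiple (F : fieldType) n (f r : {mpoly F[n]}) (i : 'I_n) s :
  f != 0 -> f ^+ s != r * (1 + f * 'X_i).
Proof.
move=> f0; apply/eqP => E; set h := f * 'X_i in E.
have X0 : 'X_i != 0 :> {mpoly F[n]} by rewrite -msize_poly_eq0 msizeX.
have sh : (1 < msize h)%N.
  rewrite /h msizeM // msizeX mdeg1 addn2 /=.
  by rewrite ltnS lt0n msize_poly_eq0.
(* [1 - (- h) ^+ s] is a multiple of [1 + h], and by [E] so is [h ^+ s]. *)
have [q qE] : exists q, 1 = (1 + h) * q.
  have Eh : h ^+ s = r * 'X_i ^+ s * (1 + h) by rewrite exprMn E mulrAC.
  have := subrXX 1 (- h) s; rewrite expr1n opprK => E1.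
  set q0 := \sum_(_ < s) _ in E1.
  exists (q0 + (-1) ^+ s * (r * 'X_i ^+ s)).
  rewrite mulrDr -E1 [(- h) ^+ s]exprNn Eh; ring.
have q0 : q != 0 by apply: contraNneq (oner_neq0 {mpoly F[n]}) => q0; rewrite qE q0 mulr0.
have h10 : 1 + h != 0 by apply: contraNneq (oner_neq0 {mpoly F[n]}) => h0; rewrite qE h0 mul0r.
have := congr1 (fun p : {mpoly F[n]} => msize p) qE; rewrite msizeM // msize1.
have hh : msize (1 + h) = msize h.
  have h0 : h != 0 by rewrite -msize_poly_eq0 -lt0n ltnW.
  have l1 : (mlead (1 : {mpoly F[n]}) < mlead h)%O.
    by rewrite mlead1 lt_mdeg_ltmc // mdeg0 -ltnS mlead_deg.
  by rewrite -!mlead_deg // mleadDr.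
have : (0 < msize q)%N by rewrite lt0n msize_poly_eq0.
rewrite hh; move: sh; case: (msize h) => [//|[//|k]] _; case: (msize q) => //= j _; lia.
Qed.

(** * A vector of maximal annihilator in a simple module *)

Section SimpleModule.
Variables (F : fieldType) (A : zmodType) (S : algType F) (bar : A -> S) (tau : A -> A -> F).
Hypothesis T : tbasis bar tau.
Variables (n : nat) (b : 'I_n -> A) (psi : A -> int).
Hypothesis psiD : forall x y, psi (x + y) = psi x + psi y.
Hypothesis psib : forall i, psi (b i) = 0.
Hypothesis chib : forall i d, psi d = 0 -> chi tau (b i) d = 1.
Variable M : lmodType S^c.
Hypothesis simpleM : forall v w : M, v != 0 -> exists x, w = act v x.

Local Notation Ps := (Ps bar b).
Local Notation PX := (PX bar b).
Local Notation twist := (twist tau b).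
Local Notation ibar := (ibar bar tau).

Let chi_bb i j : chi tau (b i) (b j) = 1.
Proof. by apply: chib; exact: psib. Qed.
Let psi0 : psi 0 = 0.
Proof. by apply: (addrI (psi 0)); rewrite -psiD !addr0. Qed.
Let psiN x : psi (- x) = - psi x.
Proof. by apply: (addrI (psi x)); rewrite -psiD !subrr psi0. Qed.

Let barI (v : M) g : act v (bar g) = 0 -> v = 0.
Proof. by move/(congr1 (fun x => act x (ibar g))); rewrite actA (barK T) act1 act0l. Qed.

Let Ps_d d p : psi d = 0 -> Ps p * bar d = bar d * Ps p.
Proof. by move=> d0; rewrite (Ps_tw T) (tw_id T) // => i; exact: chib. Qed.

Definition Ann (v : M) p := act v (Ps p) = 0.

Lemma AnnM v p q : Ann v p -> Ann v (p * q).
Proof. by rewrite /Ann (PsM T chi_bb) -actA => ->; rewrite act0l. Qed.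

Lemma Ann_subsp v : subsp (Ann v).
Proof.
split; first by rewrite /Ann linear0 act0r.
move=> c p q; rewrite /Ann linearP actDr actZr => -> ->.
by rewrite addr0; exact: (@scaler0 _ (resF M)).
Qed.

(** In an ascending chain of annihilators the leading sets stabilise by [upclosed_acc], and nested
    subspaces with equal leading sets coincide. *)
Lemma exists_max_Ann : (exists v : M, v != 0) -> exists2 u : M, u != 0 &
  forall v, v != 0 -> (forall p, Ann u p -> Ann v p) -> forall p, Ann v p -> Ann u p.
Proof.
move=> [v0 v00]; apply: contrapT => nu.
have nxt (u : M) : exists v, u != 0 -> [/\ v != 0, forall p, Ann u p -> Ann v p &
    exists p, Ann v p /\ ~ Ann u p].
  have [-> |u0] := eqVneq u 0; first by exists 0.
  apply: contrapT => /forallNP nv; apply: nu; exists u => // v vn0 uv p vp.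
  apply: contrapT => nup; apply: (nv v) => _; split=> //; by exists p.
have [f fP] := choice nxt.
pose s i := iter i f v0.
have s0 i : s i != 0 by elim: i => [|i IH] //=; case: (fP _ IH).
have [|i a|i iP] := @upclosed_acc n (fun i => lead_set (Ann (s i))).
- by move=> i; apply: lead_set_upclosed => p q; exact: AnnM.
- by move=> [p [Pp p0 pa]]; exists p; split=> //; have [_ H _] := fP _ (s0 i); exact: H.
have [_ H [p [Pp nPp]]] := fP _ (s0 i); apply: nPp.
exact: (lead_set_eq (Ann_subsp (s i.+1)) (Ann_subsp (s i)) H iP).
Qed.

Variable u : M.
Hypothesis u0 : u != 0.
Hypothesis umax : forall v, v != 0 -> (forall p, Ann u p -> Ann v p) -> forall p, Ann v p -> Ann u p.

Local Notation ub g := (act u (bar g)).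

Lemma Ann_tw v g p : Ann (act v (bar g)) (twist g p) <-> Ann v p.
Proof.
rewrite /Ann actA -(Ps_tw T) -actA; split=> [/barI|->] //; exact: act0l.
Qed.

Lemma Ann_u_proper : ~ Ann u 1.
Proof. by rewrite /Ann Ps1 act1; apply/eqP. Qed.

(* The elements killed by the conjugate of [Ann u] by [g]. *)
Definition V g (v : M) := forall p, Ann (ub g) p -> Ann v p.

(** Translation by [ibar g] reduces this to the maximality of the annihilator of [u]. *)
Lemma V_max g v : v != 0 -> V g v -> forall p, Ann v p -> Ann (ub g) p.
Proof.
move=> v0 Vv p Avp; pose v' := act v (ibar g).
have v'g : act v' (bar g) = v by rewrite actA (ibarK T) act1.
rewrite -[p](twK T b g) Ann_tw; apply: (umax (v := v')).
- by apply: contraNneq v0 => v'0; rewrite -v'g v'0 act0l.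
- by move=> q uq; rewrite -(Ann_tw _ g) v'g; apply: Vv; rewrite Ann_tw.
- by rewrite -(Ann_tw _ g) v'g (twK T b g).
Qed.

Lemma V_add g v w : V g v -> V g w -> V g (v + w).
Proof. by move=> Vv Vw p gp; rewrite /Ann actDl (Vv _ gp) (Vw _ gp) addr0. Qed.

Lemma V_zero g : V g 0.
Proof. by move=> p _; exact: act0l. Qed.

Lemma V_scale g (c : F) v : V g v -> V g (act v c%:A).
Proof.
move=> Vv p gp; rewrite /Ann actA -scalerAl mul1r actZr (Vv _ gp).
exact: (@scaler0 _ (resF M)).
Qed.

Lemma V_sum g (I : Type) (r : seq I) (P : pred I) (f : I -> M) :
  (forall i, P i -> V g (f i)) -> V g (\sum_(i <- r | P i) f i).
Proof.
by move=> H; elim/big_rec : _ => [|i x Pi Vx]; [exact: V_zero | apply: V_add; [exact: H|]].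
Qed.

Lemma V_Ps g v p : V g v -> V g (act v (Ps p)).
Proof. by move=> Vv q gq; rewrite /Ann actA (PsC T chi_bb) -actA (Vv _ gq) act0l. Qed.

Lemma Ann_ubD g h p : Ann (ub (g + h)) p -> Ann (act (ub g) (bar h)) p.
Proof.
have -> : act (ub g) (bar h) = tau g h *: (ub (g + h) : resF M).
  by rewrite actA (barM T) actZr.
by rewrite /Ann (actZl (M := M)) => ->; exact: (@scaler0 _ (resF M)).
Qed.

Lemma V_bar g h v : V g v -> V (g + h) (act v (bar h)).
Proof. by move=> Vv p; rewrite -[p](twK T b h) => /Ann_ubD; rewrite !Ann_tw; exact: Vv. Qed.

(** The kernel of [psi] centralises the [b i], so conjugation by it changes no annihilator. *)
Lemma V_psi g g' v : psi g = psi g' -> V g v -> V g' v.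
Proof.
move=> gg' Vv p; pose d := g' - g.
have d0 : psi d = 0 by rewrite psiD psiN gg' subrr.
have -> : g' = g + d by rewrite addrC subrK.
move=> /Ann_ubD; rewrite -{1}[p](@tw_id _ _ _ _ _ T _ b d) => [|i]; last exact: chib.
by rewrite Ann_tw; exact: Vv.
Qed.

(** * Distinct conjugates: the grading by [psi] *)

Section Graded.
Hypothesis Ann_graded : forall h, psi h != 0 -> exists p, Ann u p /\ ~ Ann (ub h) p.

Lemma Ann_distinct g g' : psi g != psi g' -> exists p, Ann (ub g) p /\ ~ Ann (ub g') p.
Proof.
move=> gg'; have [|p [up nup]] := Ann_graded (h := g' - g).
  by rewrite psiD psiN subr_eq0 eq_sym.
exists (twist g p); rewrite Ann_tw; split=> // H; apply: nup.
rewrite -(Ann_tw _ g).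
have -> : act (ub (g' - g)) (bar g) = tau (g' - g) g *: (ub g' : resF M).
  by rewrite actA (barM T) subrK actZr.
by rewrite /Ann (actZl (M := M)) H; exact: (@scaler0 _ (resF M)).
Qed.

(** A polynomial [p] killing the component at [g] must, by induction, kill all the others; by
    [V_max] a nonzero one at [g'] would force [p] into the conjugate annihilator at [g'], from which
    [p] was chosen away. *)
Lemma V_direct (s : seq A) (v : A -> M) : uniq (map psi s) -> (forall g, g \in s -> V g (v g)) ->
  \sum_(g <- s) v g = 0 -> forall g, g \in s -> v g = 0.
Proof.
elim: s v => [//|g s IH] v /= /andP [gs us] Vv; rewrite big_cons => E.
have vs g' : g' \in s -> v g' = 0.
  move=> g's; have [|p [gp ng'p]] := @Ann_distinct g g'.
    by apply: contraNneq gs => ->; exact: map_f.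
  apply/eqP; apply: contrapT => /negP vg'0; apply: ng'p.
  apply: (V_max vg'0 (Vv _ _)); first by rewrite inE g's orbT.
  apply: (IH (fun x => act (v x) (Ps p))) => // [x xs|].
    by apply: V_Ps; apply: Vv; rewrite inE xs orbT.
  have := congr1 (fun x => act x (Ps p)) E; rewrite actDl act0l act_suml.
  by rewrite (Vv g _ p gp) ?mem_head // add0r.
move=> g'; rewrite inE => /orP[/eqP->|/vs//].
by move: E; rewrite big_seq big1 ?addr0 // => x /vs.
Qed.

(** Simplicity of [V 0] over the kernel of [psi]: writing [v = act w x] and sorting the terms of [x]
    by [psi], directness leaves only those of degree 0. *)
Lemma V0_generated w v : w != 0 -> V 0 w -> V 0 v ->
  exists (l : seq A) (c : A -> F), v = \sum_(a <- l | psi a == 0) act w (c a *: bar a).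
Proof.
move=> w0 Vw Vv; have [x xE] := simpleM v w0.
have [l [c cE]] := bar_span T x; exists l, c.
pose L := undup (0 :: map psi l).
have exr (k : int) : exists a, k \in L -> psi a = k.
  have [kL|] := boolP (k \in L); last by exists 0.
  move: kL; rewrite mem_undup inE => /orP[/eqP->|/mapP [a _ ->]]; first by exists 0.
  by exists a.
have [r rP] := choice exr.
pose f a := act w (c a *: bar a).
(* The component of [act w x - v] in degree [psi g]. *)
pose y (g : A) := \sum_(a <- l | psi a == psi g) f a - (if psi g == 0 then v else 0).
have Vf a : V a (f a).
  rewrite /f actZr -[_ *: _]/(act (act w (bar a)) (c a)%:A); apply: V_scale.
  by rewrite -[a in V a]add0r; exact: V_bar.
have psir : map psi (map r L) = L.
  by rewrite -map_comp -[RHS]map_id; apply/eq_in_map => k /rP.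
have y0 : y (r 0) = 0.
  apply: (V_direct (s := map r L)); last by apply: map_f; rewrite mem_undup mem_head.
  - by rewrite psir undup_uniq.
  - move=> g _; apply: V_add; first by apply: V_sum => a /eqP ag; exact: V_psi ag (Vf a).
    case: eqP => g0; last by rewrite oppr0; exact: V_zero.
    by move=> p gp; rewrite /Ann actNl (V_psi (g := 0) _ Vv gp) ?oppr0 ?psi0.
  rewrite big_map /y sumrB.
  have -> : \sum_(k <- L) (if psi (r k) == 0 then v else 0) = v.
    rewrite (bigD1_seq 0) ?undup_uniq ?mem_undup ?mem_head //= rP ?mem_undup ?mem_head // eqxx.
    by rewrite big_seq_cond big1 ?addr0 // => k /andP [kL k0]; rewrite rP // (negbTE k0).
  rewrite {1}xE cE act_sumr; apply/eqP; rewrite subr_eq0; apply/eqP.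
  rewrite (exchange_big_dep xpredT) //= big_seq [RHS]big_seq; apply: eq_bigr => a al.
  have aL : psi a \in L by rewrite mem_undup inE map_f ?orbT.
  rewrite big_mkcond (bigD1_seq (psi a)) ?undup_uniq //= rP // eqxx.
  rewrite big_seq_cond big1 ?addr0 // => k /andP [kL ka]; rewrite rP // eq_sym (negbTE ka) //.
move: y0; rewrite /y rP ?mem_undup ?mem_head // eqxx => /eqP; rewrite subr_eq0 => /eqP <-.
by [].
Qed.

Lemma V0_u : V 0 u.
Proof.
move=> p; rewrite /Ann (bar0 T) actZr act1 (actZl (M := M)) => /eqP.
by rewrite (@scaler_eq0 _ (resF M)) (negbTE (tau_neq0 T _ _)) => /eqP.
Qed.

Lemma V0_Ann v p : V 0 v -> Ann u p -> Ann v p.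
Proof.
move=> Vv up; apply: Vv; rewrite /Ann (bar0 T) actZr act1 (actZl (M := M)).
by move: up; rewrite /Ann => ->; exact: (@scaler0 _ (resF M)).
Qed.

Lemma V0_bar d v : psi d = 0 -> V 0 v -> V 0 (act v (bar d)).
Proof. by move=> d0 Vv; apply: V_psi (V_bar (h := d) Vv); rewrite add0r psi0. Qed.

(** The nonzero vector [act u (Ps q)] generates [V 0], and [Ps q] commutes past the elements of
    degree 0. *)
Lemma V0_surj q v : V 0 v -> ~ Ann u q -> exists2 v', V 0 v' & v = act v' (Ps q).
Proof.
move=> Vv nuq; have w0 : act u (Ps q) != 0 by apply/eqP.
have [l [c ->]] := V0_generated w0 (V_Ps q V0_u) Vv.
exists (\sum_(a <- l | psi a == 0) act u (c a *: bar a)).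
  apply: V_sum => a /eqP a0; rewrite actZr -[_ *: _]/(act (ub a) (c a)%:A).
  by apply: V_scale; apply: V0_bar => //; exact: V0_u.
rewrite act_suml; apply: eq_bigr => a /eqP a0.
by rewrite !actA -scalerAl -scalerAr Ps_d.
Qed.

Variables (I0 : finType) (t : I0 -> A).
Hypothesis psit : forall x, psi (t x) = 0.
Hypothesis reps : forall d, psi d = 0 -> exists x (c : 'I_n -> int), d = t x + \sum_i b i *~ c i.

Lemma PX_inj m (v : M) : act v (PX m) = 0 -> v = 0.
Proof.
have [c c0 ->] := PX_bar T b m; rewrite actZr => /eqP.
by rewrite (@scaler_eq0 _ (resF M)) (negbTE c0) => /eqP /barI.
Qed.

(** Up to a monomial, [V 0] is generated over the polynomials by the finitely many coset
    representatives. *)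
Lemma V0_repr v : V 0 v -> exists m (p : I0 -> {mpoly F[n]}),
  act v (PX m) = \sum_x act (ub (t x)) (Ps (p x)).
Proof.
move=> Vv; have [l [c ->]] := V0_generated u0 V0_u Vv.
elim/big_rec : _ => [|a w /eqP a0 [m [p E]]].
  exists 0%MM, (fun=> 0); rewrite act0l big1 // => x _.
  by rewrite linear0 act0r.
have [x [d aE]] := reps a0.
(* [d] is the difference [m2 - m1] of nonnegative exponents. *)
pose m1 := [multinom absz (d i) | i < n].
pose m2 := [multinom absz (d i + (absz (d i))%:Z)%R | i < n].
have ae : a + monA b m1 = t x + monA b m2.
  rewrite aE -addrA -big_split; congr (_ + _); apply: eq_bigr => i _ /=.
  rewrite !mnmE !pmulrn -mulrzDr.
  by congr (_ *~ _); lia.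
have [c1 c10 PE1] := PX_bar T b m1; have [c2 c20 PE2] := PX_bar T b m2.
pose k := c a * c1 * tau a (monA b m1) / (c2 * tau (t x) (monA b m2)).
have E1 : act (act u (c a *: bar a)) (PX m1) = act (ub (t x)) (Ps (k *: 'X_[m2])).
  rewrite !actA linearZ /= PsX PE1 PE2 -!scalerAr -scalerAl !(barM T) ae !scalerA; congr act.
  congr (_ *: _); rewrite /k; move: (tau_neq0 T (t x) (monA b m2)) c20.
  move: (tau (t x) _) (tau a _) => t1 t2 t10 c20; field.
  by rewrite t10 c20.
exists (m1 + m)%MM, (fun y => (if y == x then k *: 'X_[m2 + m] else 0) + p y * 'X_[m1]).
rewrite (PXD T chi_bb) actDl -actA E1.
rewrite -[X in _ + act _ X](PXD T chi_bb) addmC (PXD T chi_bb) -[act w _]actA E act_suml.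
have sp y : act (ub (t y)) (Ps ((if y == x then k *: 'X_[m2 + m] else 0) + p y * 'X_[m1])) =
    (if y == x then act (ub (t x)) (Ps (k *: 'X_[m2 + m])) else 0) + act (act (ub (t y)) (Ps (p y))) (PX m1).
  rewrite PsD actDr (PsM T chi_bb) [Ps 'X_[m1]]PsX -[act _ (_ * PX m1)]actA; congr (_ + _).
  by case: eqP => [->//|_]; rewrite linear0 act0r.
rewrite (eq_bigr _ (fun y _ => sp y)) big_split /= -big_mkcond big_pred1_eq; congr (_ + _).
by rewrite actA !PsZ !PsX (PXD T chi_bb) scalerAl.
Qed.

Definition actP (v : M) (p : {mpoly F[n]}) := act v (Ps p).

Lemma actPM v p q : actP (actP v p) q = actP v (p * q).
Proof. by rewrite /actP actA (PsM T chi_bb). Qed.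

Lemma actPC v p q : actP (actP v p) q = actP (actP v q) p.
Proof. by rewrite !actPM mulrC. Qed.

Lemma actP_suml (I : Type) (r : seq I) (P : pred I) (f : I -> M) p :
  actP (\sum_(i <- r | P i) f i) p = \sum_(i <- r | P i) actP (f i) p.
Proof. exact: act_suml. Qed.

Section Rank.
Variables (J : {set 'I_n}) (s : seq ('X_{1..n} * {set 'I_n})).
Hypothesis J_free : forall m, supported J m -> ~ lead_set (Ann u) m.
Hypothesis cov : covered (lead_set (fun _ : {mpoly F[n]} => True)) (lead_set (Ann u)) s #|J|.

Lemma poly_on_Ann p : poly_on J p -> Ann u p -> p = 0.
Proof.
move=> pJ up; apply/eqP; apply: contrapT => /negP p0.
apply: (@J_free (mlead p)); last by exists p.
by apply: pJ; rewrite mleadc_eq0.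
Qed.

(** Multiplying the [v i] by the monomials in [J] with exponents at most [d] gives [k * d.+1 ^ e]
    independent vectors. By [V0_repr] they lie in a space of dimension at most
    [#|I0| * size s * (d + e * d).+1 ^ e], and the powers differ by a factor at most [e.+1 ^ e]. *)
Lemma V0_rank_bound k (v : 'I_k -> M) : (forall i, V 0 (v i)) ->
  indep actP (poly_on J) (fun w => w = 0) v -> (k <= #|I0| * size s * #|J|.+1 ^ #|J|)%N.
Proof.
move=> Vv iv; set e := #|J|.
have [m mP] : exists m, forall i, exists p : I0 -> {mpoly F[n]},
    act (v i) (PX m) = \sum_x act (ub (t x)) (Ps (p x)).
  have [m mP] := choice (fun i => V0_repr (Vv i)).
  exists (\sum_i m i)%MM => i; have [p pE] := mP i.
  exists (fun x => p x * 'X_[\sum_(j | j != i) m j]).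
  rewrite (bigD1 i) //= (PXD T chi_bb) -actA pE act_suml; apply: eq_bigr => x _.
  by rewrite (PsM T chi_bb) actA PsX.
have [p pE] := choice mP.
have [d dP] := max_of (fun x : 'I_k * I0 => msize (p x.1 x.2)).
have sT : subsp (fun _ : {mpoly F[n]} => True) by [].
have [w [wsz _ wP]] := lead_spans sT (Ann_subsp u) (fun _ _ => Logic.I) cov (d + e * d).
pose mono (f : {ffun {j | j \in J} -> 'I_d.+1}) : 'X_{1..n} :=
  [multinom (if insub i is Some x then nat_of_ord (f x) else 0%N) | i < n].
have monoJ f : supported J (mono f).
  by apply/supportedP => i iJ; rewrite mnmE insubN.
have mono_inj : injective mono.
  move=> f g fg; apply/ffunP => [[j jJ]]; apply/val_inj.
  by move/mnmP/(_ j): fg; rewrite !mnmE insubT.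
have mono_deg f : (mdeg (mono f) <= e * d)%N.
  rewrite mdegE (bigID (mem J)) /= [X in (_ + X)%N]big1 ?addn0; last first.
    by move=> i iJ; rewrite mnmE insubN.
  rewrite -sum_nat_const; apply: leq_sum => i iJ; rewrite mnmE insubT //= -ltnS; exact: ltn_ord.
pose E := ('I_k * {ffun {j | j \in J} -> 'I_d.+1})%type.
pose z (x : E) : resF M := act (act (v x.1) (PX m)) (PX (mono x.2)).
pose W : seq (resF M) := flatten [seq [seq (act (ub (t x)) (Ps q) : resF M) | q <- w] | x <- enum I0].
have Wsz : size W = (#|I0| * size w)%N.
  rewrite size_flatten sumnE !big_map (eq_bigr (fun=> size w)) => [|x _]; last by rewrite size_map.
  by rewrite big_const_seq count_predT iter_addn_0 mulnC cardE enumT.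
have : (#|{: E}| <= size W)%N.
  apply: (spans_card (v := z) (subsp0 M)) => [[i f]|a].
    rewrite /z /= pE act_suml -big_enum.
    apply: (spans_sum _ (subsp0 M)) => x; rewrite actA -PsX -(PsM T chi_bb).
    apply: (spans_map (L := fun q => act (ub (t x)) (Ps q) : resF M) (N := Ann u)).
    - by move=> c q q'; rewrite PsD PsZ actDr actZr.
    - by move=> q; exact: V0_Ann (V0_bar (psit x) V0_u).
    apply: wP => //; have [-> |p0] := eqVneq (p i x) 0; first by rewrite mul0r msize0.
    have X0 : 'X_[mono f] != 0 :> {mpoly F[n]} by rewrite -msize_poly_eq0 msizeX.
    rewrite msizeM // msizeX addnS /=.
    by apply/leqW/leq_add; [exact: (dP (i, x))|].
  pose r i : {mpoly F[n]} := \sum_f a (i, f) *: 'X_[mono f].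
  have -> : \sum_x a x *: z x = act (\sum_i actP (v i) (r i)) (PX m).
    rewrite (eq_bigr (fun x => a (x.1, x.2) *: z (x.1, x.2))) => [|[i f] _ //].
    rewrite -(pair_bigA _ (fun i f => a (i, f) *: z (i, f))) act_suml /=; apply: eq_bigr => i _.
    rewrite /actP /r Ps_sum act_sumr act_suml; apply: eq_bigr => f _.
    by rewrite PsZ actZr actZl /z /= PsX !actA -(PXD T chi_bb) addmC (PXD T chi_bb).
  move=> /PX_inj /(iv r (fun i => _)) r0 [i f].
  have := congr1 (mcoeff (mono f)) (r0 _ i); rewrite mcoeff0 linear_sum (bigD1 f) //= mcoeffZ mcoeffX.
  rewrite eqxx mulr1 big1 ?addr0 => [->//|g gf]; last first.
    by rewrite mcoeffZ mcoeffX (inj_eq mono_inj) (negbTE gf) mulr0.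
  by move=> i'; apply: poly_on_sum => g _; apply/poly_onZ/poly_on_X.
rewrite Wsz card_prod card_ord card_ffun card_ord card_sig.
rewrite (eq_card (B := mem J)) // -/e => h.
have {}h : (k * d.+1 ^ e <= #|I0| * (size s * (d + e * d).+1 ^ e))%N.
  by apply: leq_trans h _; rewrite leq_mul2l wsz orbT.
rewrite -(@leq_pmul2r (d.+1 ^ e)) ?expn_gt0 //; apply: leq_trans h _.
rewrite -!mulnA leq_mul2l leq_mul2l -expnMn; apply/orP; right; apply/orP; right.
by have [->|e0] := posnP e; rewrite ?expn0 ?leq_exp2r //; lia.
Qed.

Lemma max_rank_V0 : exists k (m : 'I_k -> M), [/\ forall i, V 0 (m i),
  indep actP (poly_on J) (fun w => w = 0) m & forall v, V 0 v ->
    exists c : 'I_k -> {mpoly F[n]}, exists d : {mpoly F[n]}, [/\ forall i, poly_on J (c i), poly_on J d, d != 0 &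
      actP v d + \sum_i actP (m i) (c i) = 0]].
Proof.
apply: (max_indep (act := actP) (Q := V 0) _ V0_rank_bound).
by move=> v; rewrite /actP Ps0 act0r.
Qed.

(* Let [f] be a common denominator for the action of [F * D] on a maximal
   independent family [m]; then [m i0] is a multiple of [1 + f * 'X_j], which forces
   [1 + f * 'X_j] to divide a power of [f]. *)
Lemma no_free_variable j : j \in J -> False.
Proof.
move=> jJ; have [k [m [Vm im sm]]] := max_rank_V0.
pose gen (g : I0 + ('I_n + 'I_n)) := match g with
  inl x => t x | inr (inl i) => b i | inr (inr i) => - b i end.
have psig g : psi (gen g) = 0.
  by case: g => [x|[i|i]] /=; rewrite ?psit ?psiN ?psib ?oppr0.
have ex (x : 'I_k * (I0 + ('I_n + 'I_n))) : exists y : {mpoly F[n]} * ('I_k -> {mpoly F[n]}),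
    [/\ poly_on J y.1, y.1 != 0, forall i, poly_on J (y.2 i) &
      actP (act (m x.1) (bar (gen x.2))) y.1 = \sum_i actP (m i) (y.2 i)].
  have [c [d [cJ dJ d0 E]]] := sm _ (V0_bar (psig x.2) (Vm x.1)).
  exists (d, fun i => - c i); split=> //= [i|].
    by rewrite -scaleN1r; exact: poly_onZ.
  move/eqP: E; rewrite addr_eq0 => /eqP ->; rewrite -sumrN; apply: eq_bigr => i _.
  by rewrite /actP -[- c i]scaleN1r PsZ actZr scaleN1r.
have [y yP] := choice ex.
(* A common denominator for all generators of the kernel of [psi] on all the [m i]. *)
pose f := \prod_x (y x).1.
have fJ : poly_on J f by apply: poly_on_prod => x _; case: (yP x).
have f0 : f != 0 by rewrite prodf_seq_neq0; apply/allP => x _; case: (yP x).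
have gen_f a g : exists c : 'I_k -> {mpoly F[n]}, (forall i, poly_on J (c i)) /\
    actP (act (m a) (bar (gen g))) f = \sum_i actP (m i) (c i).
  have [y1J _ y2J E] := yP (a, g).
  exists (fun i => (y (a, g)).2 i * \prod_(x | x != (a, g)) (y x).1); split.
    by move=> i; apply: poly_onM => //; apply: poly_on_prod => x _; case: (yP x).
  rewrite /f (bigD1 (a, g)) //= -actPM E actP_suml; apply: eq_bigr => i _.
  by rewrite actPM.
(* The vectors that a power of [f] brings into the polynomial span of [m]. They are stable under
   degree 0, hence fill [V 0]. *)
pose Ed (v : M) := V 0 v /\ exists s' (c : 'I_k -> {mpoly F[n]}), (forall i, poly_on J (c i)) /\
    actP v (f ^+ s') = \sum_i actP (m i) (c i).
have EdD v w : Ed v -> Ed w -> Ed (v + w).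
  move=> [Vv [s1 [c1 [c1J E1]]]] [Vw [s2 [c2 [c2J E2]]]]; split; first exact: V_add.
  exists (s1 + s2)%N, (fun i => c1 i * f ^+ s2 + c2 i * f ^+ s1); split=> [i|].
    by apply: poly_onD; apply: poly_onM => //; exact: poly_on_exp.
  rewrite /actP actDl -![act _ (Ps _)]/(actP _ _) exprD -actPM E1 mulrC -actPM E2 !actP_suml.
  rewrite -big_split; apply: eq_bigr => i _; rewrite !actPM.
  by rewrite /actP PsD actDr.
have EdZ v (c : F) : Ed v -> Ed (act v c%:A).
  move=> [Vv [s1 [c1 [c1J E1]]]]; split; first exact: V_scale.
  exists s1, (fun i => c *: c1 i); split=> [i|]; first exact: poly_onZ.
  have -> : actP (act v c%:A) (f ^+ s1) = act (actP v (f ^+ s1)) c%:A.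
    by rewrite /actP !actA -scalerAl -scalerAr mul1r mulr1.
  rewrite E1 act_suml; apply: eq_bigr => i _.
  by rewrite /actP PsZ actA -scalerAr mulr1.
have Ed0 : Ed 0.
  split; first exact: V_zero.
  exists 0%N, (fun=> 0); split=> [i|]; first by move=> x; rewrite mcoeff0 eqxx.
  by rewrite /actP act0l big1 // => i _; rewrite Ps0 act0r.
have Ed_gen v g : Ed v -> Ed (act v (bar (gen g))).
  move=> [Vv [s1 [c1 [c1J E1]]]]; split; first exact: V0_bar.
  have [c cP] := choice (fun a => gen_f a g).
  exists s1.+1, (fun i => \sum_a c a i * c1 a); split=> [i|].
    by apply: poly_on_sum => a _; apply: poly_onM => //; case: (cP a).
  have -> : actP (act v (bar (gen g))) (f ^+ s1.+1) = actP (act (actP v (f ^+ s1)) (bar (gen g))) f.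
    by rewrite /actP exprSr (PsM T chi_bb) !actA !mulrA Ps_d.
  rewrite E1 act_suml actP_suml.
  transitivity (\sum_a \sum_i actP (m i) (c a i * c1 a)).
    apply: eq_bigr => a _; rewrite (_ : actP _ f = actP (actP (act (m a) (bar (gen g))) f) (c1 a)).
      by rewrite (cP a).2 actP_suml; apply: eq_bigr => i _; rewrite actPM.
    by rewrite actPC /actP !actA !mulrA Ps_d.
  rewrite exchange_big; apply: eq_bigr => i _ /=.
  by rewrite /actP Ps_sum act_sumr.
have Ed_bar_add v d d' : (forall w, Ed w -> Ed (act w (bar d))) -> (forall w, Ed w -> Ed (act w (bar d'))) ->
    Ed v -> Ed (act v (bar (d + d'))).
  move=> Hd Hd' /Hd /Hd'; rewrite actA (barM T) actZr => H.
  have := EdZ _ (tau d d')^-1 H.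
  rewrite -[act _ (_)%:A]/((tau d d')^-1 *: (tau d d' *: (act v (bar (d + d')) : resF M))).
  by rewrite scalerA mulVf ?scale1r ?(tau_neq0 T).
have Ed_bar d v : psi d = 0 -> Ed v -> Ed (act v (bar d)).
  move=> d0; have [x [c ->]] := reps d0.
  have Hb0 w : Ed w -> Ed (act w (bar 0)) by rewrite (bar0 T) -[tau 0 0 *: 1]/((tau 0 0)%:A); exact: EdZ.
  apply: (Ed_bar_add) => [w|w]; first exact: (Ed_gen _ (inl x)).
  elim/big_rec : _ w => [//|i d' _ IH w]; apply: (Ed_bar_add) => // {}w.
  have Hn (g : I0 + ('I_n + 'I_n)) k' w' : Ed w' -> Ed (act w' (bar (gen g *+ k'))).
    elim: k' w' => [|k' IHk] w'; first by rewrite mulr0n; exact: Hb0.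
    by rewrite mulrS; apply: (Ed_bar_add) => // w''; exact: Ed_gen.
  case: (c i) => k'; first exact: (Hn (inr (inl i))).
  by rewrite NegzE mulrNz -mulNrz; exact: (Hn (inr (inr i))).
have kpos : (0 < k)%N.
  case: k m sm {Vm im y ex yP f fJ f0 gen_f Ed EdD EdZ Ed0 Ed_gen Ed_bar_add Ed_bar} => // m sm.
  have [c [d [_ dJ d0]]] := sm u V0_u; rewrite big_ord0 addr0.
  by move=> /(poly_on_Ann dJ) d0'; rewrite d0' eqxx in d0.
pose i0 := Ordinal kpos.
pose delta (i : 'I_k) : {mpoly F[n]} := (i == i0)%:R.
have mdelta (r : {mpoly F[n]}) : actP (m i0) r = \sum_i actP (m i) (delta i * r).
  rewrite (bigD1 i0) //= /delta eqxx mul1r big1 ?addr0 // => i /negbTE ->.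
  by rewrite mul0r /actP Ps0 act0r.
have Edm : Ed (m i0).
  split=> //; exists 0%N, (fun i => delta i * 1); split; last exact: mdelta.
  move=> i; rewrite mulr1 /delta; case: eqP => _; first exact: poly_on1.
  by move=> x; rewrite mcoeff0 eqxx.
have m0 : m i0 != 0.
  apply/eqP => m0; have := im delta.
  have dJ i : poly_on J (delta i).
    rewrite /delta; case: eqP => _; first exact: poly_on1.
    by move=> x; rewrite mcoeff0 eqxx.
  have := mdelta 1; under [X in _ = X]eq_bigr do rewrite mulr1.
  rewrite {1}/actP m0 act0l => E /(_ dJ (esym E) i0) /eqP.
  by rewrite /delta eqxx oner_eq0.
have EdV v : V 0 v -> Ed v.
  move=> Vv; have [l [c ->]] := V0_generated m0 (Vm i0) Vv.
  elim/big_rec : _ => [//|a x /eqP a0 Ex]; apply: EdD => //.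
  rewrite actZr -[_ *: _]/(act (act (m i0) (bar a)) (c a)%:A); apply: EdZ.
  exact: Ed_bar.
have jS : supported J U_(j)%MM.
  by apply/supportedP => i iJ; rewrite mnm1E; case: eqP => // ji; rewrite -ji jJ in iJ.
pose g0 := 1 + f * 'X_j.
have g0J : poly_on J g0 by apply: poly_onD; [exact: poly_on1 | apply: poly_onM => //; exact: poly_on_X].
have g00 : g0 != 0.
  apply/eqP => /eqP; rewrite /g0 addrC addr_eq0 => /eqP /(congr1 (fun p : {mpoly F[n]} => msize p)).
  rewrite msizeN msize1 msizeM // -?msize_poly_eq0 ?msizeX // mdeg1 addn2 => /eqP.
  by rewrite eqSS msize_poly_eq0 (negbTE f0).
have nug0 : ~ Ann u g0 by move/(poly_on_Ann g0J)/eqP; rewrite (negbTE g00).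
have [v Vv mv] := V0_surj (Vm i0) nug0.
have [_ [s' [c [cJ E]]]] := EdV v Vv.
(* Dividing [m i0] by [g0] and clearing the denominator gives two expansions of
   [actP (m i0) (f ^+ s')]; their coefficients at [i0] make [f ^+ s'] a multiple of [g0]. *)
have := im (fun i => delta i * f ^+ s' - c i * g0).
have dJ i : poly_on J (delta i).
  rewrite /delta; case: eqP => _; first exact: poly_on1.
  by move=> x; rewrite mcoeff0 eqxx.
have cJ' i : poly_on J (delta i * f ^+ s' - c i * g0).
  apply: poly_onD; first by apply: poly_onM => //; exact: poly_on_exp.
  by rewrite -scaleN1r; apply/poly_onZ/poly_onM.
move=> /(_ cJ'); have -> : \sum_i actP (m i) (delta i * f ^+ s' - c i * g0) = 0.
  transitivity (actP (m i0) (f ^+ s') - actP (\sum_i actP (m i) (c i)) g0).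
    rewrite mdelta actP_suml -sumrB; apply: eq_bigr => i _.
    by rewrite actPM /actP -[- (c i * g0)]scaleN1r PsD PsZ actDr actZr scaleN1r.
  by rewrite -E {1}mv -/(actP v g0) actPC subrr.
move=> /(_ erefl i0) /eqP; rewrite /delta eqxx mul1r subr_eq0.
by apply/negP; exact: power_not_multiple.
Qed.

End Rank.

(** [J] is a largest set of variables whose monomials avoid the leading set; [no_free_variable]
    empties it, so the rank from [max_rank_V0] is a dimension over [F]. *)
Lemma V0_finite_dim : exists k (m : 'I_k -> M), forall v, V 0 v ->
  exists c : 'I_k -> F, v = \sum_i act (m i) (c i)%:A.
Proof.
pose free (J : {set 'I_n}) := `[< forall m, supported J m -> ~ lead_set (Ann u) m >].
have upc : upclosed (lead_set (Ann u)).
  by apply: lead_set_upclosed => p q; exact: AnnM.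
have free0 : free finset.set0.
  apply/asboolP => m m0 [p [up p0 pm]]; apply: Ann_u_proper.
  have {m0} m0 : m = 0%MM by apply/mnmP => i; rewrite mnm0E; move/supportedP: m0 => ->; rewrite ?inE.
  have /msize_poly1P [c c0 pc] : msize p == 1%N by rewrite -mlead_deg // pm m0 mdeg0.
  have := subspZ c^-1 (Ann_subsp u) up; rewrite pc -mul_mpolyC -mpolyCM mulVf //.
have [J Jfree Jmax] := arg_maxnP (fun J : {set 'I_n} => #|J|) free0.
have {}Jfree m : supported J m -> ~ lead_set (Ann u) m by move/asboolP: Jfree; apply.
(* If a translated orthant avoids the upward closed leading set, so does the untranslated one. *)
have dimJ : mdim_le (lead_set (fun _ : {mpoly F[n]} => True)) (lead_set (Ann u)) #|J|.
  move=> a J' JJ' aO; suff /Jmax h : free J'; first by move: JJ'; rewrite ltnNge => /negP; apply; exact: h.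
  apply/asboolP => m mJ' /upc h; have [_] := aO _ mJ'; apply; apply: h.
  exact: lem_addl.
have [s cov] := mdim_covered (lead_set_upclosed (fun p q _ => Logic.I)) upc dimJ.
have J0 : J = finset.set0.
  by apply/eqP/finset.set0Pn => -[j /(no_free_variable Jfree cov)].
have [k [m [Vm im sm]]] := max_rank_V0 cov.
have const (p : {mpoly F[n]}) : poly_on J p -> p = (p@_0)%:MP.
  rewrite J0 => pJ; apply/mpolyP => x; rewrite mcoeffC.
  have [->|x0] := eqVneq x 0%MM; first by rewrite mulr1.
  rewrite mulr0; apply/eqP; apply: contraNT x0 => /pJ /supportedP xs.
  by apply/eqP/mnmP => i; rewrite mnm0E xs ?inE.
exists k, m => v /sm [c [d [cJ dJ d0 E]]].
have Psc p : poly_on J p -> Ps p = p@_0%MM *: 1.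
  by move/const => {1}->; rewrite -[_%:MP]mulr1 mul_mpolyC PsZ Ps1.
exists (fun i => - (d@_0%MM)^-1 * (c i)@_0%MM).
have d00 : d@_0%MM != 0 by apply: contraNneq d0 => d00; rewrite (const _ dJ) d00 mpolyC0.
move/eqP: E; rewrite addr_eq0 /actP (Psc _ dJ) actZr act1 => /eqP E.
have -> : v = (d@_0%MM)^-1 *: (d@_0%MM *: (v : resF M)) by rewrite scalerA mulVf // scale1r.
rewrite E scalerN -scaleNr scaler_sumr; apply: eq_bigr => i _.
by rewrite (Psc _ (cJ i)) actZr act1 scalerA.
Qed.

End Graded.

(** Subtracting from [twist h p] the multiple of [p] that cancels the leading monomial gives a
    shorter element, zero by induction; as eigenvalues are distinct, [p] is a single monomial, which
    acts injectively. *)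
Lemma Ann_eigen (I : {set 'I_n}) h :
  (forall p, Ann u p -> Ann (ub h) p) ->
  (forall m m', supported I m -> supported I m' ->
     chi tau (monA b m) h = chi tau (monA b m') h -> m = m') ->
  forall p, poly_on I p -> Ann u p -> p = 0.
Proof.
move=> uh hmu.
have uhn0 : ub h != 0 by apply: contraNneq u0 => /barI ->.
(* Maximality turns the inclusion [uh] into an equality. *)
have twu p : Ann u p -> Ann u (twist h p).
  by move=> up; apply: (umax uhn0 uh); rewrite Ann_tw.
move=> p; move: {2}(size (msupp p)) (leqnn (size (msupp p))) => k.
elim: k p => [|k IH] p; first by rewrite leqn0 size_eq0 msupp_eq0 => /eqP.
move=> pk pI up; apply/eqP; apply: contrapT => /negP p0.
pose mu m := chi tau (monA b m) h; set m0 := mlead p.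
pose q := twist h p - mu m0 *: p.
have qE m : q@_m = (mu m - mu m0) * p@_m.
  by rewrite mcoeffB mcoeffZ mcoeff_tw /mu mulrBl mulrC.
have sqp m : m \in msupp q -> m \in msupp p /\ m != m0.
  rewrite !mcoeff_msupp qE mulf_eq0 negb_or subr_eq0 => /andP [h1 ->]; split=> //.
  by apply: contraNneq h1 => ->.
have q0 : q = 0.
  apply: IH.
  - rewrite -ltnS; apply: leq_trans pk; rewrite ltnNge; apply/negP => le.
    have sub : {subset m0 :: msupp q <= msupp p}.
      by move=> m; rewrite inE => /orP[/eqP->|/sqp []//]; exact: mlead_supp.
    have un : uniq (m0 :: msupp q).
      by rewrite /= msupp_uniq andbT; apply/negP => /sqp [_]; rewrite eqxx.
    by have := uniq_leq_size un sub; rewrite /= leqNgt ltnS le.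
  - by move=> m; rewrite -mcoeff_msupp => /sqp [+ _]; rewrite mcoeff_msupp => /pI.
  - apply: (subspB (Ann_subsp u)); first exact: twu.
    exact: (subspZ _ (Ann_subsp u)).
have pX : p = p@_m0 *: 'X_[m0].
  apply/mpolyP => m; rewrite mcoeffZ mcoeffX.
  have [<-|mm0] := eqVneq m0 m; first by rewrite mulr1.
  rewrite mulr0; apply/eqP; apply: contraNT mm0 => pm.
  have := congr1 (mcoeff m) q0; rewrite mcoeff0 qE => /eqP.
  rewrite mulf_eq0 (negbTE pm) orbF subr_eq0 => /eqP /(hmu _ _ (pI _ pm)) -> //.
  by apply: pI; rewrite mleadc_eq0.
have c0 : p@_m0 != 0 by rewrite mleadc_eq0.
move: up; rewrite /Ann pX PsZ PsX actZr => /eqP.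
rewrite (@scaler_eq0 _ (resF M)) (negbTE c0) /=.
have [c cn0 ->] := PX_bar T b m0; rewrite actZr (@scaler_eq0 _ (resF M)) (negbTE cn0) /=.
by move/eqP/barI/eqP; rewrite (negbTE u0).
Qed.

(** The vectors [ub (g *+ l)] lie in components of distinct degrees. *)
Lemma graded_powers g : (forall h, psi h != 0 -> exists p, Ann u p /\ ~ Ann (ub h) p) ->
  psi g != 0 -> forall k (c : 'I_k -> F),
  \sum_(l < k) act (ub (g *+ l)) (c l)%:A = 0 -> forall l, c l = 0.
Proof.
move=> gr g0 k c E l.
have psiMn j : psi (g *+ j) = psi g *+ j.
  by elim: j => [|j IH]; rewrite ?mulr0n ?psi0 // !mulrS psiD IH.
have inj : injective (fun j : nat => psi (g *+ j)).
  by move=> i j /=; rewrite !psiMn; exact: mulrIn.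
have exj a : exists j : nat, forall i : nat, a = g *+ i -> j = i.
  have [[i ->]|h] := pselect (exists i : nat, a = g *+ i).
    by exists i => i' /(congr1 psi) /inj.
  by exists 0%N => i ai; case: h; exists i.
have [ind indP] := choice exj.
pose cc j := if insub j is Some x then c x else 0.
pose v a : M := act (ub a) (cc (ind a))%:A.
have vE (i : 'I_k) : v (g *+ i) = act (ub (g *+ i)) (c i)%:A.
  by rewrite /v (indP _ _ erefl) /cc valK.
have := V_direct gr (s := [seq g *+ i | i <- iota 0 k]) (v := v).
move=> /(_ _ _ _ (g *+ l) _) H.
have : v (g *+ l) = 0.
  apply: H.
  - by rewrite -map_comp map_inj_uniq ?iota_uniq // => i j; exact: inj.
  - move=> a _; apply: V_scale; rewrite -[a in V a]add0r; apply: V_bar => //.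
    exact: V0_u.
  - have -> : iota 0 k = index_iota 0 k by rewrite /index_iota subn0.
    rewrite big_map big_mkord -[RHS]E.
    by apply: eq_bigr => i _; exact: vE.
  - by apply: map_f; rewrite mem_iota /=.
rewrite vE actZr act1 => /eqP; rewrite (@scaler_eq0 _ (resF M)).
by case/orP=> [/eqP//|/eqP/barI /eqP]; rewrite (negbTE u0).
Qed.

End SimpleModule.

(** * The alternative for a simple module *)

Section Alternative.
Variables (F : fieldType) (A : zmodType) (S : algType F) (bar : A -> S) (tau : A -> A -> F).
Hypothesis T : tbasis bar tau.
Variables (n : nat) (e : 'I_n -> A) (co : A -> 'I_n -> int).
Hypothesis C : coordinates e co.
Variables (psi : A -> int) (K : nat).
Hypothesis psiD : forall x y, psi (x + y) = psi x + psi y.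
Hypothesis K0 : (0 < K)%N.
Hypothesis chiK : forall x y, psi x = 0 -> psi y = 0 -> chi tau x y ^+ K = 1.
Variable i0 : 'I_n.
Hypothesis psi_i0 : psi (e i0) != 0.
Variable M : lmodType S^c.
Hypothesis nzM : exists v : M, v != 0.
Hypothesis simpleM : forall v w : M, v != 0 -> exists x, w = act v x.

Let psi0 : psi 0 = 0.
Proof. by apply: (addrI (psi 0)); rewrite -psiD !addr0. Qed.
Let psiN x : psi (- x) = - psi x.
Proof. by apply: (addrI (psi x)); rewrite -psiD !subrr psi0. Qed.
Let psiMn x k : psi (x *+ k) = psi x *+ k.
Proof. by elim: k => [|k IH]; rewrite ?mulr0n ?psi0 // !mulrS psiD IH. Qed.
Let psiMz x (k : int) : psi (x *~ k) = psi x * k.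
Proof.
by case: k => k; rewrite ?NegzE ?mulrNz ?psiN -?pmulrn psiMn -mulr_natr ?natz // mulrN.
Qed.
Let psi_sum (I : Type) (r : seq I) (P : pred I) (f : I -> A) :
  psi (\sum_(i <- r | P i) f i) = \sum_(i <- r | P i) psi (f i).
Proof. by elim/big_rec2 : _ => [|i x y _ <-]; rewrite ?psi0 ?psiD. Qed.

(* [b i0 = 0], so the morphism [Ps bar b] is not injective; this is harmless. *)
Let b (i : 'I_n) : A := (e i *~ psi (e i0) - e i0 *~ psi (e i)) *+ K.

Let psib i : psi (b i) = 0.
Proof. by rewrite /b psiMn psiD psiN !psiMz [X in _ - X]mulrC subrr mul0rn. Qed.

Let chib i d : psi d = 0 -> chi tau (b i) d = 1.
Proof.
move=> d0; rewrite (chiMn_l T) chiK //.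
by rewrite psiD psiN !psiMz [X in _ - X]mulrC subrr.
Qed.

Let co_b i j : j != i0 -> co (b i) j = (i == j)%:R * (psi (e i0) *+ K).
Proof.
move=> ji; rewrite /b (coMn C) (coD C) (coN C) !(coMz C) !(co_e C).
rewrite [i0 == j]eq_sym (negbTE ji) mul0rz subr0.
by rewrite -mulrzl -mulrzz; case: (i == j); rewrite /= ?mul0r ?mulr0 ?mul0rn ?mul1r ?intz // mulr1.
Qed.

(** The multiples of [e i0] add up to a multiple of [psi a], which vanishes. This gives the [b i]
    finite index in the kernel. *)
Let b_comb a : psi a = 0 -> \sum_i b i *~ co a i = a *~ (psi (e i0) *+ K).
Proof.
move=> a0; have E : \sum_i psi (e i) * co a i = 0.
  by rewrite -[RHS]a0 [X in psi X](coE C a) psi_sum; apply: eq_bigr => i _; rewrite psiMz.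
have -> : a *~ (psi (e i0) *+ K) = (a *~ psi (e i0)) *+ K.
  by rewrite -mulr_natr mulrzA natz pmulrn.
transitivity ((\sum_i (e i *~ psi (e i0) - e i0 *~ psi (e i)) *~ co a i) *+ K).
  by rewrite -sumrMnl; apply: eq_bigr => i _; rewrite /b !pmulrn -!mulrzA mulrC.
congr (_ *+ K).
under eq_bigr do rewrite mulrzBl -!mulrzA.
rewrite sumrB [X in _ - X](_ : _ = 0) ?subr0; last first.
  by rewrite -mulrz_sumr E mulr0z.
rewrite [in RHS](coE C a) mulrz_suml; apply: eq_bigr => i _.
by rewrite -mulrzA mulrC.
Qed.

(** Cosets are indexed by coordinates modulo [L]: a kernel element divisible by [L] is a combination
    of the [b i] by [b_comb]. *)
Let reps : exists t : {ffun 'I_n -> 'I_(K * `|psi (e i0)|)} -> A,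
  (forall x, psi (t x) = 0) /\
  forall d, psi d = 0 -> exists x (c : 'I_n -> int), d = t x + \sum_i b i *~ c i.
Proof.
set L := (K * `|psi (e i0)|)%N.
have L0 : (0 < L)%N by rewrite muln_gt0 K0 absz_gt0.
pose P (x : {ffun 'I_n -> 'I_L}) a := psi a = 0 /\ forall i, (co a i = x i %[mod L])%Z.
have ex x : exists a, psi a = 0 /\ ((exists a, P x a) -> P x a).
  have [[a Pa]|h] := pselect (exists a, P x a); last by exists 0.
  by exists a; split=> //; exact: Pa.1.
have [t tP] := choice ex; exists t; split=> [x|d d0]; first by case: (tP x).
have mL i : (`|(co d i %% L)%Z| < L)%N.
  by rewrite -ltz_nat gez0_abs ?modz_ge0 ?ltz_pmod // eqz_nat -lt0n.
pose x := [ffun i => Ordinal (mL i)].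
have xE i : (x i)%:Z = (co d i %% L)%Z.
  by rewrite ffunE /= gez0_abs ?modz_ge0 // eqz_nat -lt0n.
have [|tx0 tx] := (tP x).2.
  by exists d; split=> // i; rewrite xE modz_mod.
have ex2 i : exists q : int, co (d - t x) i = q * L.
  have : (co d i = co (t x) i %[mod L])%Z by rewrite tx xE modz_mod.
  move/eqP; rewrite eqz_mod_dvd => /dvdzP [q qE]; exists q.
  by rewrite (coD C) (coN C).
have [q qE] := choice ex2.
pose a := \sum_i e i *~ q i.
have coa i : co a i = q i.
  rewrite /a (co_sum C) (bigD1 i) //= (coMz C) (co_e C) eqxx big1 ?addr0 ?intz // => j ji.
  by rewrite (coMz C) (co_e C) (negbTE ji) mul0rz.
have dt : d - t x = a *~ L.
  apply: (co_inj C) => i; rewrite qE (coMz C) coa -mulrzz //.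
have a0 : psi a = 0.
  apply/eqP; have := congr1 psi dt; rewrite psiD psiN d0 tx0 subrr psiMz => /esym/eqP.
  by rewrite mulf_eq0 eqz_nat eqn0Ngt L0 orbF.
exists x, (fun i => sgz (psi (e i0)) * q i).
have -> : \sum_i b i *~ (sgz (psi (e i0)) * q i) = a *~ L.
  transitivity ((\sum_i b i *~ co a i) *~ sgz (psi (e i0))).
    by rewrite mulrz_suml; apply: eq_bigr => i _; rewrite coa -mulrzA mulrC.
  rewrite b_comb // -mulrzA; congr (_ *~ _).
  rewrite mulrnAl [_ * sgz _]mulrC -abszEsg /L; lia.
by rewrite -dt addrC subrK.
Qed.

Definition center_free (I : {set 'I_n}) (v : 'I_n -> A) := forall c : 'I_n -> int,
  (forall i, i \notin I -> c i = 0) ->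
  (forall a, chi tau (\sum_i v i *~ c i) a = 1) -> forall i, c i = 0.

Let choose_free : exists I : {set 'I_n}, center_free I b /\
  exists s : seq A, [/\ (n <= #|I| + size s + 1)%N,
    forall z, z \in s -> forall a, chi tau z a = 1 &
    forall c : 'I_(size s) -> int, \sum_(i < size s) s`_i *~ c i = 0 -> forall i, c i = 0].
Proof.
pose free I := `[< center_free I b >].
have free0 : free finset.set0 by apply/asboolP => c c0 _ i; rewrite c0 ?inE.
have [I /asboolP Ifree Imax] := arg_maxnP (fun I : {set 'I_n} => #|I|) free0.
exists I; split=> //.
have ex j : exists c : 'I_n -> int, j \notin I -> [/\ c j != 0,
    forall i, i \notin I -> i != j -> c i = 0 &
    forall a, chi tau (\sum_i b i *~ c i) a = 1].
  have [jI|jI] := boolP (j \in I); first by exists (fun=> 0).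
  have nf : ~ center_free (j |: I)%SET b.
    move=> /asboolP /Imax h; suff : (#|j |: I| <= #|I|)%N by rewrite cardsU1 jI ltnn.
    exact: h.
  have /existsNP [c /not_implyP [cI /not_implyP [cZ cn]]] := nf.
  exists c => _; split=> //; last first.
    by move=> i iI ij; apply: cI; rewrite !inE negb_or ij iI.
  apply/eqP => cj; apply: cn; apply: Ifree => // i iI.
  by have [->//|ij] := eqVneq i j; apply: cI; rewrite !inE negb_or ij iI.
have [c cP] := choice ex.
pose zeta j := \sum_i b i *~ c j i.
have psiK0 : psi (e i0) *+ K != 0 by rewrite mulrn_eq0 negb_or -lt0n K0 psi_i0.
(* Independence of the [zeta j] is read off the coordinates other than [i0]; dropping [i0] costs the
   1 in the count. *)
pose l := [seq j <- enum 'I_n | (j \notin I) && (j != i0)].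
have ul : uniq l by rewrite filter_uniq ?enum_uniq.
have coz j i : i != i0 -> j \notin I -> i \notin I -> co (zeta j) i = (i == j)%:R * (c j j * (psi (e i0) *+ K)).
  move=> ii0 jI iI; rewrite /zeta (co_sum C) (bigD1 i) //= (coMz C) co_b // eqxx mul1r.
  rewrite big1 ?addr0 => [|k ki]; last by rewrite (coMz C) co_b // (negbTE ki) mul0r mul0rz.
  have [_ c0 _] := cP _ jI; have [->|ij] := eqVneq i j; first by rewrite mul1r mulrzz mulrC.
  by rewrite c0 // mulr0z mul0r.
exists [seq zeta j | j <- l]; split.
- rewrite size_map size_filter.
  have -> : (#|I| = count (mem I) (enum 'I_n))%N by rewrite -sum1_card -sum1_count [RHS]big_enum_cond; apply: eq_bigl => i.
  rewrite -[n in (n <= _)%N]card_ord cardE -(count_predC (mem I)) -addnA leq_add2l.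
  have -> : 1%N = count (pred1 i0) (enum 'I_n) by rewrite count_uniq_mem ?enum_uniq // mem_enum.
  rewrite -count_predUI; apply: leq_trans (leq_addr _ _).
  by apply: sub_count => j /= jI; rewrite jI /= orNb.
- by move=> z /mapP [j jl ->]; move: jl; rewrite mem_filter => /andP [/andP [jI _] _]; case: (cP _ jI).
set s := [seq zeta j | j <- l] => x x0 i; set j := nth i0 l i.
have sl k : (k < size s)%N -> (k < size l)%N by rewrite size_map.
have inl k : (k < size s)%N -> (nth i0 l k \notin I) && (nth i0 l k != i0).
  move=> /sl kl; have : nth i0 l k \in l by rewrite mem_nth.
  by rewrite mem_filter => /andP [].
have /andP [jI ji0] := inl i (ltn_ord i).
have [cj0 _ _] := cP _ jI.
have coeq k : (k < size s)%N -> co (s`_k) j = (j == nth i0 l k)%:R * (c (nth i0 l k) (nth i0 l k) * (psi (e i0) *+ K)).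
  move=> ks; have /andP [kI ki0] := inl k ks.
  by rewrite /s (nth_map i0) ?sl // coz.
have := congr1 (fun a => co a j) x0; rewrite (co0 C) (co_sum C) (bigD1 i) //= big1 => [|k ki].
  rewrite addr0 (coMz C) coeq ?ltn_ord // eqxx mul1r -mulrzr => /eqP.
  by rewrite !mulf_eq0 (negbTE cj0) (negbTE psiK0) /= intz => /eqP.
rewrite (coMz C) coeq ?ltn_ord // /j nth_uniq ?sl ?ltn_ord // eq_sym.
by rewrite [(_ == _)](negbTE ki) mul0r mul0rz.
Qed.

Theorem simple_alternative :
  (exists u : M, u != 0 /\ exists (I : {set 'I_n}) (s : seq A) (v : 'I_n -> A),
     [/\ (n <= #|I| + size s + 1)%N, forall z, z \in s -> forall a, chi tau z a = 1,
     forall c : 'I_(size s) -> int, \sum_(i < size s) s`_i *~ c i = 0 -> forall i, c i = 0 &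
     forall p : {mpoly F[n]}, poly_on I p -> act u (Ps bar v p) = 0 -> p = 0]) \/
  (exists u : M, u != 0 /\ exists k (m : 'I_k -> M),
     (forall d, psi d = 0 -> exists c : 'I_k -> F, act u (bar d) = \sum_i act (m i) (c i)%:A) /\
     forall g, psi g != 0 -> forall k (c : 'I_k -> F),
       \sum_(l < k) act (act u (bar (g *+ l))) (c l)%:A = 0 -> forall l, c l = 0).
Proof.
have [u u0 umax] := exists_max_Ann T psib chib nzM.
have [[h [h0 hP]]|nh] := pselect (exists h, psi h != 0 /\
    forall p, Ann bar b u p -> Ann bar b (act u (bar h)) p).
  left; exists u; split=> //; have [I [Ifree [s [ns sZ sfree]]]] := choose_free.
  exists I, s, b; split=> // p pI up.
  refine (Ann_eigen T u0 umax hP (I := I) _ pI up) => m m' mI m'I E.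
  have monE (x : 'X_{1..n}) : monA b x = \sum_i b i *~ (x i)%:Z by apply: eq_bigr => i _; rewrite -pmulrn.
  pose c i : int := (m i)%:Z - (m' i)%:Z.
  pose w := \sum_i b i *~ c i.
  have wE : w = monA b m - monA b m'.
    by rewrite !monE -sumrB; apply: eq_bigr => i _; rewrite mulrzBr.
  have wh : chi tau w h = 1 by rewrite wE (chiDl T) (chiNl T) E mulfV // (chi_neq0 T).
  have wd d : psi d = 0 -> chi tau w d = 1.
    move=> d0; rewrite /w; elim/big_rec : _ => [|i x _ IH]; first exact: (chi0l T).
    by rewrite (chiDl T) IH mulr1 (chiMz_l T) chib // exp1rz.
  (* [a *~ psi h] is the sum of an element of the kernel of [psi] and a multiple of [h]; [w] pairs
     trivially with both. *)
  have wa a : chi tau (w *~ psi h) a = 1.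
    rewrite (chiMz_l T) -(chiMz_r T).
    have -> : a *~ psi h = (a *~ psi h - h *~ psi a) + h *~ psi a by rewrite subrK.
    rewrite (chiDr T) wd ?mul1r; first by rewrite (chiMz_r T) wh exp1rz.
    by rewrite psiD psiN !psiMz [X in _ - X]mulrC subrr.
  have c0 i : c i * psi h = 0.
    apply: (Ifree (fun i => c i * psi h)) => [k kI|a].
      rewrite /c; move/supportedP: mI => ->//; move/supportedP: m'I => ->//.
      by rewrite subrr mul0r.
    rewrite -(wa a) /w mulrz_suml; congr chi; apply: eq_bigr => k _.
    by rewrite mulrzA.
  apply/mnmP => i; have /eqP := c0 i; rewrite mulf_eq0 (negbTE h0) orbF /c subr_eq0.
  by rewrite eqz_nat => /eqP.
have gr h : psi h != 0 -> exists p, Ann bar b u p /\ ~ Ann bar b (act u (bar h)) p.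
  move=> h0; apply: contrapT => np; apply: nh; exists h; split=> // p up.
  by apply: contrapT => nup; apply: np; exists p.
have [t [psit repst]] := reps.
right; exists u; split=> //.
have [k [m mP]] := V0_finite_dim T psiD psib chib simpleM u0 umax gr psit repst.
exists k, m; split=> [d d0|].
  apply: mP; apply: (V0_bar T psiD chib) => //; exact: (V0_u T).
by move=> g g0 k' c'; exact: (graded_powers T psiD psib chib u0 umax gr g0).
Qed.

Definition expo (I : {set 'I_n}) t (f : {ffun {j | j \in I} -> 'I_t.+1}) (i : 'I_n) : nat :=
  if insub i is Some x then f x else 0%N.

Corollary simple_module_alternative :
  (exists u : M, u != 0 /\ exists (I : {set 'I_n}) (s : seq A) (y : 'I_n -> S),
     [/\ (n <= #|I| + size s + 1)%N, forall z, z \in s -> forall a, chi tau z a = 1,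
     forall c : 'I_(size s) -> int, \sum_(i < size s) s`_i *~ c i = 0 -> forall i, c i = 0 &
     forall t (a : {ffun {j | j \in I} -> 'I_t.+1} -> F),
       \sum_f act (act u (\prod_i y i ^+ expo f i)) (a f)%:A = 0 -> forall f, a f = 0]) \/
  (exists u : M, u != 0 /\ exists k (m : 'I_k -> M),
     (forall d, psi d = 0 -> exists c : 'I_k -> F, act u (bar d) = \sum_i act (m i) (c i)%:A) /\
     forall g, psi g != 0 -> forall k (c : 'I_k -> F),
       \sum_(l < k) act (act u (bar (g *+ l))) (c l)%:A = 0 -> forall l, c l = 0).
Proof.
have [[u [u0 [I [s [v [ns sZ sf H]]]]]]|] := simple_alternative; [left|by right].
exists u; split=> //; exists I, s, (fun i => bar (v i)); split=> // t a E.
pose mono (f : {ffun {j | j \in I} -> 'I_t.+1}) : 'X_{1..n} := [multinom expo f i | i < n].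
have monoI f : supported I (mono f).
  by apply/supportedP => i iI; rewrite mnmE /expo insubN.
have mono_inj : injective mono.
  move=> f g fg; apply/ffunP => [[j jI]]; apply/val_inj.
  by move/mnmP/(_ j): fg; rewrite !mnmE /expo insubT.
pose p : {mpoly F[n]} := \sum_f a f *: 'X_[mono f].
have p0 : p = 0.
  apply: H; first by apply: poly_on_sum => f _; apply/poly_onZ/poly_on_X.
  rewrite -E /p Ps_sum act_sumr; apply: eq_bigr => f _.
  rewrite PsZ PsX actZr -[_ *: _]/(act (act u _) (a f)%:A); congr (act (act u _) _).
  by rewrite /PX; apply: eq_bigr => i _; rewrite mnmE.
move=> f; have := congr1 (mcoeff (mono f)) p0; rewrite mcoeff0 linear_sum (bigD1 f) //=.
rewrite mcoeffZ mcoeffX eqxx mulr1 big1 ?addr0 => [->//|g gf].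
by rewrite mcoeffZ mcoeffX (inj_eq mono_inj) (negbTE gf) mulr0.
Qed.

End Alternative.

End QuantumTorus.

From mathcomp Require Import all_classical all_reals all_analysis.
Import numFieldNormedType.Exports.
Import QuantumTorus.

Local Open Scope classical_set_scope.
Local Open Scope ring_scope.

(** * Gelfand-Kirillov dimension *)

Section Growth.
Variable R : realType.

Lemma ln_natr_large (x : R) : exists n0 : nat, forall k, (n0 <= k)%N -> x <= ln k%:R.
Proof.
exists (Num.bound (expR x)) => k hk.
have h : expR x < k%:R.
  by apply: lt_le_trans (archi_boundP (expR_ge0 x)) _; rewrite ler_nat.
by rewrite -{1}(expRK x) ler_ln ?posrE ?expR_gt0 ?(lt_trans (expR_gt0 x) h) // ltW.
Qed.

(** With [t = N %/ r] one has [t.+1 > N / r], so [ln (D N)] is at least [r * ln N - r * ln r], and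
    the last term is negligible. *)
Lemma growth_lower (D : nat -> nat) r :
  (forall t N, (r * t <= N)%N -> (t.+1 ^ r <= D N)%N) ->
  (r%:R%:E <= limn_esup (fun N => (ln ((D N)%:R : R) / ln N%:R)%:E))%E.
Proof.
move=> HD; apply: le_ereal_inf_tmp => _ [V [n1 _ Vn1] <-].
apply/lee_addgt0Pr => eps eps0.
have [n2 n2P] := ln_natr_large 1.
have [n3 n3P] := ln_natr_large (r%:R * ln r%:R / eps).
pose N := (n1 + n2 + n3)%N.
have lnN1 : 1 <= ln (N%:R : R) by apply: n2P; rewrite /N; lia.
have lnN0 : 0 < ln (N%:R : R) by apply: lt_le_trans lnN1.
have lnN2 : r%:R * ln r%:R / eps <= ln (N%:R : R) by apply: n3P; rewrite /N; lia.
have N0 : (0 < N)%N by rewrite lt0n; apply/negP => /eqP N0; move: lnN0; rewrite N0 ln0 ?ltxx.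
apply: (@le_trans _ _ ((ln ((D N)%:R : R) / ln N%:R)%:E + eps%:E)%E); last first.
  apply: leeD => //; apply: ereal_sup_ubound; exists N => //; apply: Vn1.
  by rewrite /= /N; lia.
rewrite -EFinD lee_fin -lerBlDr ler_pdivlMr //.
case: (posnP r) => [r0|r0].
  rewrite r0 sub0r; apply: (@le_trans _ _ 0).
    by rewrite mulNr oppr_le0 mulr_ge0 ?ltW.
  apply: ln_ge0; rewrite -[1]/(1%:R) ler_nat.
  by have := HD 0%N N; rewrite r0 mul0n expn0; apply.
pose t := (N %/ r)%N.
have tN : (N < r * t.+1)%N by rewrite mulnC ltn_ceil.
have Dt : (t.+1 ^ r <= D N)%N by apply: HD; rewrite mulnC leq_trunc_div.
apply: (@le_trans _ _ (ln ((t.+1 ^ r)%:R : R))); last first.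
  by rewrite ler_ln ?posrE ?ltr0n ?expn_gt0 ?ler_nat // (leq_trans _ Dt) // expn_gt0.
rewrite natrX lnXn ?ltr0n // -mulr_natl.
have lnt : ln (N%:R : R) <= ln r%:R + ln t.+1%:R.
  rewrite -lnM ?posrE ?ltr0n // ler_ln ?posrE ?ltr0n ?muln_gt0 ?mulr_gt0 ?ltr0n //.
  by rewrite -natrM ler_nat ltnW.
move: lnN2; rewrite ler_pdivrMr // => lnN2.
have : r%:R * ln (N%:R : R) <= r%:R * (ln r%:R + ln t.+1%:R) by rewrite ler_pM2l ?ltr0n.
lra.
Qed.

(** For positive [N] the bound is at most [2 * C.+1 * N], whose logarithm exceeds [ln N] by the
    constant [c]. *)
Lemma growth_upper (D : nat -> nat) C : (forall N, (D N <= C * N.+1)%N) ->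
  (limn_esup (fun N => (ln ((D N)%:R : R) / ln N%:R)%:E) <= 1)%E.
Proof.
move=> HD; apply/lee_addgt0Pr => eps eps0.
pose c := ln ((2 * C.+1)%:R : R).
have [n2 n2P] := ln_natr_large 1.
have [n3 n3P] := ln_natr_large (c / eps).
apply: ge_ereal_inf; exists (ereal_sup [set (ln ((D N)%:R : R) / ln N%:R)%:E | N in [set N | (n2 + n3 <= N)%N]]).
  by exists [set N | (n2 + n3 <= N)%N] => //; exists (n2 + n3)%N.
apply: ge_ereal_sup => _ [N /= hN <-]; rewrite -EFinD lee_fin.
have lnN1 : 1 <= ln (N%:R : R) by apply: n2P; lia.
have lnN0 : 0 < ln (N%:R : R) by apply: lt_le_trans lnN1.
have lnN2 : c / eps <= ln (N%:R : R) by apply: n3P; lia.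
have N0 : (0 < N)%N by rewrite lt0n; apply/negP => /eqP N0; move: lnN0; rewrite N0 ln0 ?ltxx.
rewrite ler_pdivrMr // mulrDl mul1r.
apply: (@le_trans _ _ (ln N%:R + c)); last first.
  by rewrite lerD2l; move: lnN2; rewrite ler_pdivrMr // mulrC.
have [->|D0] := posnP (D N).
  by rewrite ln0 //; apply: addr_ge0; [exact: ltW | apply: ln_ge0; rewrite -[1]/(1%:R) ler_nat; lia].
rewrite /c -lnM ?posrE ?ltr0n // ler_ln ?posrE ?mulr_gt0 ?ltr0n //.
by rewrite -natrM ler_nat (leq_trans (HD N)) //; nia.
Qed.

End Growth.

Section SpanDim.
Variables (F : fieldType) (S : algType F) (M : lmodType S^c).

(** Independence makes [z] injective, so its values occupy distinct positions of [s]. *)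
Lemma span_dim_lower (E : finType) (z : E -> M) (s : seq M) :
  (forall x, z x \in s) ->
  (forall c : E -> F, \sum_x act (z x) (c x)%:A = 0 -> forall x, c x = 0) ->
  (#|E| <= span_dim s)%N.
Proof.
move=> zs zi.
have ex x : exists i : 'I_(size s), s`_i = z x.
  have h : (index (z x) s < size s)%N by rewrite index_mem.
  by exists (Ordinal h); rewrite /= nth_index.
have [f fP] := choice ex.
have finj : injective f.
  move=> x y fxy; apply/eqP; apply: contrapT => /negP xy.
  have zxy : z x = z y by rewrite -!fP fxy.
  have yx : (y == x) = false by rewrite eq_sym; exact/negbTE.
  have := zi (fun w => (w == x)%:R - (w == y)%:R).
  rewrite (bigD1 x) //= (bigD1 y) ?yx //= big1 ?addr0 => [|w /andP [wx wy]]; last first.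
    by rewrite (negbTE wx) (negbTE wy) subrr scale0r act0r.
  rewrite !eqxx ?(negbTE xy) ?yx subr0 sub0r zxy -actDr -scalerDl subrr scale0r act0r.
  by move=> /(_ erefl x) /eqP; rewrite eqxx (negbTE xy) subr0 oner_eq0.
rewrite -(card_imset predT finj) /span_dim.
apply: (leq_bigmax_cond (F := fun I : {set 'I_(size s)} => #|I|)).
apply/asboolP => c; rewrite big_imset /=; last by move=> x y _ _; exact: finj.
move=> c0 i /imsetP [x _ ->]; apply: (zi (c \o f)).
by rewrite -[RHS]c0; apply: eq_bigr => y _; rewrite fP.
Qed.

Lemma span_dim_upper (w : seq (resF M)) (s : seq M) :
  (forall m, m \in s -> spans (fun v : resF M => v = 0) w m) -> (span_dim s <= size w)%N.
Proof.
move=> sw; apply/bigmax_leqP => I /asboolP Ii.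
rewrite -[#|I|]card_ord.
apply: (spans_card (v := fun k : 'I_#|I| => (s`_(enum_val k) : resF M)) (subsp0 M)).
  by move=> k; apply: sw; rewrite mem_nth.
move=> a a0 x; pose c i := a (enum_rank_in (enum_valP x) i).
have -> : a x = c (enum_val x) by rewrite /c enum_valK_in.
apply: Ii; last exact: enum_valP.
by rewrite -[RHS]a0 big_enum_val /=; apply: eq_bigr => k _; rewrite /c enum_valK_in.
Qed.

Lemma gk_gens_word (v : seq S) (w : seq M) N m (xs : seq S) :
  m \in w -> {in xs, forall x, x \in v} -> size xs = N ->
  act m (\prod_(x <- xs) x) \in gk_gens v w N.
Proof.
move=> mw xv <- {N}; elim/last_ind: xs xv => [|xs x IH] xv.
  by rewrite big_nil act1.
rewrite size_rcons -cats1 big_cat big_seq1 /= -actA; apply/allpairsP.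
exists (act m (\prod_(x <- xs) x), x); split=> //=; last first.
  by apply: xv; rewrite mem_rcons mem_head.
by apply: IH => y yx; apply: xv; rewrite mem_rcons inE yx orbT.
Qed.

Lemma gk_gens_pad (v : seq S) (w : seq M) N m (xs : seq S) :
  m \in w -> {in xs, forall x, x \in v} -> (size xs <= N)%N ->
  act m (\prod_(x <- xs) x) \in gk_gens (1 :: v) w N.
Proof.
move=> mw xv xN; have -> : \prod_(x <- xs) x = \prod_(x <- xs ++ nseq (N - size xs) 1) x.
  by rewrite big_cat /= big_nseq iter_mulr_1 expr1n mulr1.
apply: gk_gens_word => //; last by rewrite size_cat size_nseq subnKC.
move=> x; rewrite mem_cat inE => /orP[/xv ->|]; first by rewrite orbT.
by rewrite mem_nseq => /andP [_ ->].
Qed.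

Variable R : realType.

Lemma GKdim_lower (v : seq S) (w : seq M) r :
  (forall t N, (r * t <= N)%N -> (t.+1 ^ r <= span_dim (gk_gens (1%R :: v) w N))%N) ->
  (r%:R%:E <= GKdim R M)%E.
Proof.
move=> H; apply: le_trans (growth_lower R H) _.
by apply: ereal_sup_ubound; exists v => //; exists w.
Qed.

(** The [t.+1 ^ #|I|] monomials are words of length at most [#|I| * t], padded by the unit. *)
Lemma GKdim_ge_supported n (I : {set 'I_n}) (y : 'I_n -> S) (u : M) :
  (forall t (a : {ffun {j | j \in I} -> 'I_t.+1} -> F),
     \sum_f act (act u (\prod_i y i ^+ expo f i)) (a f)%:A = 0 -> forall f, a f = 0) ->
  (#|I|%:R%:E <= GKdim R M)%E.
Proof.
move=> H; apply: (@GKdim_lower [seq y i | i <- enum 'I_n] [:: u]) => t N tN.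
have -> : (t.+1 ^ #|I| = #|{: {ffun {j | j \in I} -> 'I_t.+1}}|)%N.
  by rewrite card_ffun card_ord card_sig; congr (_ ^ _)%N; apply: eq_card.
apply: span_dim_lower (H t) => f.
pose xs := flatten [seq nseq (expo f i) (y i) | i <- enum 'I_n].
have -> : \prod_i y i ^+ expo f i = \prod_(x <- xs) x.
  rewrite /xs big_flatten big_map enumT [index_enum _]unlock; apply: eq_bigr => i _.
  by rewrite big_nseq iter_mulr_1.
apply: gk_gens_pad; rewrite ?inE //.
  by move=> x /flattenP [_ /mapP [i _ ->]]; rewrite mem_nseq => /andP [_ /eqP ->]; apply: map_f; rewrite mem_enum.
apply: leq_trans tN; rewrite size_flatten /shape -map_comp sumnE big_map big_enum.
rewrite (bigID (mem I)) /= [X in (_ + X)%N]big1 ?addn0 => [|i iI]; last first.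
  by rewrite size_nseq /expo insubN.
rewrite -sum_nat_const; apply: leq_sum => i iI; rewrite size_nseq /expo insubT.
by rewrite -ltnS ltn_ord.
Qed.

End SpanDim.

Lemma abszD_le (x y : int) L L' :
  (absz x <= L)%N -> (absz y <= L')%N -> (absz (x + y)%R <= L + L')%N.
Proof. lia. Qed.

(** * Linear growth in the graded case *)

Section LinearGrowth.
Variables (R : realType) (F : fieldType) (A : zmodType) (S : algType F) (bar : A -> S) (tau : A -> A -> F).
Hypothesis T : tbasis bar tau.
Variable psi : A -> int.
Hypothesis psiD : forall x y, psi (x + y) = psi x + psi y.
Variable M : lmodType S^c.
Hypothesis simpleM : forall v w : M, v != 0 -> exists x, w = act v x.
Variables (u : M) (k : nat) (m : 'I_k -> M).
Hypothesis u0 : u != 0.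
Hypothesis span0 : forall d, psi d = 0 -> exists c : 'I_k -> F, act u (bar d) = \sum_i act (m i) (c i)%:A.

Let psi0 : psi 0 = 0.
Proof. by apply: (addrI (psi 0)); rewrite -psiD !addr0. Qed.
Let psiN x : psi (- x) = - psi x.
Proof. by apply: (addrI (psi x)); rewrite -psiD !subrr psi0. Qed.

Definition psi_bounded (L : nat) (x : S) := exists s : seq (F * A),
  x = \sum_(p <- s) p.1 *: bar p.2 /\ {in s, forall p, (absz (psi p.2) <= L)%N}.

Lemma psi_bounded_ex x : exists L, psi_bounded L x.
Proof.
have [l [c xE]] := bar_span T x.
exists (\max_(a <- l) absz (psi a))%N, [seq (c a, a) | a <- l]; split.
  by rewrite big_map.
move=> _ /mapP [a al ->] /=.
by apply: (@leq_bigmax_seq _ _ xpredT (fun a => absz (psi a))).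
Qed.

Lemma psi_bounded_mono L L' x : (L <= L')%N -> psi_bounded L x -> psi_bounded L' x.
Proof. by move=> LL [s [xE sL]]; exists s; split=> // p /sL h; exact: leq_trans LL. Qed.

Lemma psi_boundedM L L' x y : psi_bounded L x -> psi_bounded L' y -> psi_bounded (L + L') (x * y).
Proof.
move=> [s [-> sL]] [s' [-> sL']].
exists [seq (p.1 * q.1 * tau p.2 q.2, p.2 + q.2) | p <- s, q <- s']; split; last first.
  move=> _ /allpairsP [[p q] [/= ps qs ->]] /=; rewrite psiD.
  by apply: abszD_le; [exact: sL|exact: sL'].
rewrite big_allpairs_dep mulr_suml; apply: eq_bigr => p _; rewrite mulr_sumr; apply: eq_bigr => q _.
by rewrite -scalerAl -scalerAr (barM T) !scalerA.
Qed.

Lemma spans0_lin (w : seq (resF M)) (c : F) (x y : resF M) :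
  spans (fun v => v = 0) w x -> spans (fun v => v = 0) w y -> spans (fun v => v = 0) w (c *: x + y).
Proof.
move=> [f /eqP fE] [g /eqP gE]; exists (fun i => c * f i + g i).
move: fE gE; rewrite !subr_eq0 => /eqP -> /eqP ->; apply/eqP; rewrite subr_eq0; apply/eqP.
rewrite scaler_sumr -big_split; apply: eq_bigr => i _ /=.
by rewrite scalerDl scalerA.
Qed.

Lemma spans0_0 (w : seq (resF M)) : spans (fun v => v = 0) w 0.
Proof. by exists (fun=> 0); rewrite sub0r big1 ?oppr0 // => i _; rewrite scale0r. Qed.

Lemma spans0_mem (w : seq (resF M)) x : x \in w -> spans (fun v => v = 0) w x.
Proof.
move=> xw; exists (fun i => (i == index x w)%:R); have xi : (index x w < size w)%N by rewrite index_mem.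
rewrite (bigD1 (Ordinal xi)) //= eqxx scale1r nth_index // big1 ?addr0 ?subrr // => i ix.
rewrite (_ : (_ == _) = false) ?scale0r //; apply/negbTE; apply: contraNneq ix => h.
by apply/eqP/val_inj.
Qed.

Definition level_gens (g : int -> A) L : seq (resF M) :=
  [seq (act (m i) (bar (g (j%:Z - L%:Z))) : resF M) | j <- iota 0 (2 * L).+1, i <- enum 'I_k].

(** Up to a scalar, [bar a] is [bar d] with [d] in the kernel of [psi], times the chosen element of
    the same degree; [act u (bar d)] lies in the span of [m]. *)
Lemma level_spans (g : int -> A) L x : (forall a, psi (g (psi a)) = psi a) ->
  psi_bounded L x -> spans (fun v => v = 0) (level_gens g L) (act u x).
Proof.
move=> gP [s [-> sL]]; rewrite act_sumr big_seq.
elim/big_rec : _ => [|p v ps IH]; first exact: spans0_0.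
rewrite actZr; apply: spans0_lin IH; set a := p.2.
pose d := a - g (psi a); have d0 : psi d = 0 by rewrite psiD psiN gP subrr.
have [c cE] := span0 d0.
have -> : bar a = (tau d (g (psi a)))^-1 *: (bar d * bar (g (psi a))).
  by rewrite (barM T) scalerA mulVf ?scale1r ?(tau_neq0 T) // /d subrK.
rewrite actZr -[_ *: _]addr0; apply: spans0_lin; last exact: spans0_0.
rewrite -actA cE act_suml; elim/big_rec : _ => [|i w _ IHw]; first exact: spans0_0.
have -> : act (act (m i) (c i)%:A) (bar (g (psi a))) = c i *: (act (m i) (bar (g (psi a))) : resF M).
  by rewrite actA -scalerAl mul1r actZr.
apply: spans0_lin IHw; apply: spans0_mem; apply/allpairsP.
have aL : (absz (psi a) <= L)%N := sL _ ps.
have E : (absz (psi a + L%:Z)%R)%:Z - L%:Z = psi a by lia.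
exists (absz (psi a + L%:Z), i); split; first by rewrite [_.1]/= mem_iota; lia.
  by rewrite mem_enum.
by rewrite /= E.
Qed.

(** Products of [N] generators have degrees bounded linearly in [N], and each degree contributes at
    most [k] dimensions. *)
Lemma GKdim_le1 : (GKdim R M <= 1)%E.
Proof.
apply: ge_ereal_sup => _ [v _ [w _ <-]].
have exg (l : int) : exists a, forall b, psi b = l -> psi a = l.
  by have [[b bl]|h] := pselect (exists b, psi b = l); [exists b|exists 0 => b bl; case: h; exists b].
have [g gP0] := choice exg; have gP a : psi (g (psi a)) = psi a by exact: gP0 erefl.
have [Lv LvP] : exists L, {in 1 :: v, forall x, psi_bounded L x}.
  elim: (1 :: v) => [|x s [L LP]]; first by exists 0%N.
  have [L' xL] := psi_bounded_ex x; exists (L + L')%N => y; rewrite inE => /orP[/eqP->|/LP].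
    by apply: psi_bounded_mono xL; rewrite leq_addl.
  by apply: psi_bounded_mono; rewrite leq_addr.
have [Lw LwP] : exists L, {in w, forall y, exists2 x, y = act u x & psi_bounded L x}.
  elim: w => [|y s [L LP]]; first by exists 0%N.
  have [x yE] := simpleM y u0; have [L' xL] := psi_bounded_ex x.
  exists (L + L')%N => z; rewrite inE => /orP[/eqP->|/LP [x' -> x'L]].
    by exists x => //; apply: psi_bounded_mono xL; rewrite leq_addl.
  by exists x' => //; apply: psi_bounded_mono x'L; rewrite leq_addr.
have gk N : {in gk_gens (1 :: v) w N, forall y, exists2 x, y = act u x & psi_bounded (Lw + N * Lv) x}.
  elim: N => [|N IH] y; first by rewrite mul0n addn0; exact: LwP.
  move=> /allpairsP [[z x] [/= /IH [x' -> x'L] xv ->]].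
  exists (x' * x); first by rewrite -actA.
  by rewrite mulSnr addnA; apply: psi_boundedM => //; exact: LvP.
apply: (@growth_upper R _ (k * (2 * (Lw + Lv)).+1)%N) => N.
apply: (@leq_trans (size (level_gens g (Lw + N * Lv)))).
  by apply: span_dim_upper => y /gk [x -> xL]; exact: level_spans.
rewrite /level_gens size_allpairs size_iota size_enum_ord; nia.
Qed.

Lemma GKdim_ge1 g : psi g != 0 -> (forall k' (c : 'I_k' -> F),
     \sum_(l < k') act (act u (bar (g *+ l))) (c l)%:A = 0 -> forall l, c l = 0) ->
  (1%:E <= GKdim R M)%E.
Proof.
move=> g0 H; apply: (@GKdim_lower _ _ _ R [:: bar g] [:: u] 1) => t N; rewrite mul1n expn1 => tN.
rewrite -[t.+1]card_ord.
have barX l : exists c, c != 0 /\ bar g ^+ l = c *: bar (g *+ l).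
  elim: l => [|l [c [c0 IH]]].
    by exists (tau 0 0)^-1; rewrite invr_eq0 (tau_neq0 T) expr0 mulr0n (bar0 T) scalerA mulVf ?scale1r ?(tau_neq0 T).
  exists (c * tau (g *+ l) g); rewrite mulf_neq0 ?(tau_neq0 T) //; split=> //.
  by rewrite exprSr IH -scalerAl (barM T) scalerA -mulrSr.
have [c cP] := choice barX.
apply: (span_dim_lower (z := fun l : 'I_t.+1 => act u (bar g ^+ l))) => [l|a E l].
  have -> : bar g ^+ l = \prod_(x <- nseq l (bar g)) x by rewrite big_nseq iter_mulr_1.
  apply: gk_gens_pad; rewrite ?inE //; first by move=> x; rewrite mem_nseq inE => /andP [_ ->].
  by rewrite size_nseq; apply: leq_trans tN; rewrite -ltnS.
have := H t.+1 (fun l => a l * c l); rewrite -[X in _ = X]E => /(_ _ l) h.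
have /eqP : a l * c l = 0.
  apply: h; apply: eq_bigr => j _; rewrite (cP j).2 !actA -!scalerAl -!scalerAr !mulr1 scalerA.
  by rewrite mulrC.
by rewrite mulf_eq0 (negbTE (cP l).1) orbF => /eqP.
Qed.

End LinearGrowth.

(** Independence is the uniqueness of the expansion of 0. *)
Lemma tga_tbasis (F : fieldType) (A : zmodType) (S : algType F) (T : twisted_group_algebra A S) :
  tbasis (tga_bar T) (tga_tau T).
Proof.
split; [exact: tga_tau_neq0|exact: tga_tau_cocycle|exact: tga_mul| |].
  by move=> x; have [l [xE _]] := tga_basis T x; exists (finsupp l), l.
move=> l c ul E a al.
pose f : {fsfun A -> F with 0} := [fsfun x in seq_fset tt l => c x | 0].
have fE x : f x = if x \in l then c x else 0.
  by rewrite fsfun_fun seq_fsetE.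
have [l0 [E0 uniq0]] := tga_basis T 0.
have f0 : l0 = f.
  apply: uniq0; rewrite -[LHS]E.
  transitivity (\sum_(x <- l) f x *: tga_bar T x).
    by rewrite big_seq [RHS]big_seq; apply: eq_bigr => x xl; rewrite fE xl.
  rewrite (bigID (fun x => x \in finsupp f)) /= [X in _ + X]big1 ?addr0; last first.
    by move=> x xf; rewrite fsfun_dflt // scale0r.
  rewrite -big_filter; apply: perm_big; apply: uniq_perm; rewrite ?filter_uniq ?fset_uniq //.
  move=> x; rewrite mem_filter; case: (boolP (x \in finsupp f)) => //=.
  by rewrite mem_finsupp fE; case: (x \in l) => //; rewrite eqxx.
have f00 : l0 = [fsfun].
  by apply: uniq0; rewrite finsupp0 big_seq_fset0.
by have := fE a; rewrite al -f0 f00 fsfun0E.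
Qed.

Lemma fg_free_coordinates (A : zmodType) : fg_free_abelian A ->
  exists n (e : 'I_n -> A) (co : A -> 'I_n -> int), coordinates e co.
Proof.
move=> [n [e H]]; exists n, e.
have [co coP] := choice H.
exists co; split.
- by move=> a; case: (coP a).
- move=> a b i; have [_ U] := coP (a + b).
  have -> : co (a + b) = [ffun j => co a j + co b j].
    apply: U; rewrite {1}(coP a).1 {1}(coP b).1 -big_split; apply: eq_bigr => j _.
    by rewrite ffunE mulrzDr.
  by rewrite ffunE.
- move=> i j; have [_ U] := coP (e i).
  have -> : co (e i) = [ffun j => (i == j)%:R].
    apply: U; rewrite (bigD1 i) //= ffunE eqxx big1 ?addr0 // => k ki.
    by rewrite ffunE eq_sym (negbTE ki) mulr0z.
  by rewrite ffunE.
Qed.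

(** * Rank and Krull dimension *)

Section Rank.
Variables (A : zmodType) (n : nat) (e : 'I_n -> A) (co : A -> 'I_n -> int).
Hypothesis C : coordinates e co.

(** Clearing denominators turns a rational relation between coordinate rows into an integral one. *)
Lemma int_free_size (s : seq A) : int_free s -> (size s <= n)%N.
Proof.
move=> sf.
pose v (i : 'I_(size s)) : 'rV[rat]_n := \row_j (co s`_i j)%:~R.
have N0 : subsp (fun x : 'rV[rat]_n => x = 0).
  by split=> // c x y -> ->; rewrite scaler0 addr0.
rewrite -[size s]card_ord -[n](size_enum_ord n) -(size_map (fun j => delta_mx 0 j : 'rV[rat]_n)).
apply: (spans_card (v := v) N0) => [i|a E].
  exists (fun k => if insub k is Some j then v i 0 j else 0).
  rewrite size_map size_enum_ord {1}(row_sum_delta (v i)) -sumrB big1 // => j _.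
  by rewrite valK (nth_map j) ?size_enum_ord // nth_ord_enum subrr.
pose D : int := \prod_i denq (a i).
have D0 : D != 0 by rewrite prodf_seq_neq0; apply/allP => i _; rewrite /= denq_neq0.
pose D' i : int := \prod_(j | j != i) denq (a j).
pose c i : int := numq (a i) * D' i.
have cE i : (c i)%:~R = a i * D%:~R :> rat.
  rewrite /c /D (bigD1 i) //= !intrM mulrA; congr (_ * _).
  by rewrite -[X in _ = X * _]divq_num_den divfK // intr_eq0 denq_neq0.
have /sf c0 : \sum_(i < size s) s`_i *~ c i = 0.
  apply: (co_inj C) => j; rewrite (co0 C) (co_sum C); apply/eqP.
  rewrite -(intr_eq0 rat) rmorph_sum /=; apply/eqP.
  have /rowP/(_ j) := E; rewrite !summxE => Ej.
  transitivity ((\sum_i (a i *: v i) 0 j) * D%:~R); last by rewrite Ej mxE mul0r.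
  rewrite mulr_suml; apply: eq_bigr => i _.
  by rewrite !mxE (coMz C) mulrzz intrM cE; ring.
move=> i; have := cE i; rewrite c0 => /esym/eqP; rewrite mulf_eq0 intr_eq0 (negbTE D0) orbF.
by move/eqP.
Qed.

Lemma rk_setT (R : realType) : rk R [set: A] = n%:R%:E.
Proof.
apply/eqP; rewrite eq_le; apply/andP; split.
  apply: ge_ereal_sup => _ [s [_ sf] <-]; rewrite lee_fin ler_nat; exact: int_free_size.
apply: ereal_sup_ubound; exists [seq e i | i <- enum 'I_n]; last first.
  by rewrite size_map size_enum_ord.
split=> //; set s := [seq _ | _ <- _] => c E i.
have sn : size s = n by rewrite size_map size_enum_ord.
have sE (k : 'I_(size s)) : s`_k = e (cast_ord sn k).
  have kn : (k < n)%N := ltn_ord (cast_ord sn k).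
  rewrite (nth_map (cast_ord sn k)) ?size_enum_ord //; congr e.
  exact: (nth_ord_enum _ (cast_ord sn k)).
have := congr1 (fun a => co a (cast_ord sn i)) E; rewrite (co0 C) (co_sum C) (bigD1 i) //= big1 => [|k ki].
  by rewrite addr0 sE (coMz C) (co_e C) eqxx intz.
rewrite sE (coMz C) (co_e C) (_ : (_ == _) = false) ?mul0rz //.
by apply/negbTE; apply: contraNneq ki => /cast_ord_inj ->.
Qed.

End Rank.

Section Krull.
Variables (F : fieldType) (A : zmodType) (S : algType F) (bar : A -> S) (tau : A -> A -> F).
Hypothesis T : tbasis bar tau.
Variables (n : nat) (e : 'I_n -> A) (co : A -> 'I_n -> int).
Hypothesis C : coordinates e co.

Lemma submod_rideal (P : set (S^c)^o) : submod_closed (mem P) -> rideal (P : S -> Prop).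
Proof.
move=> [P0 PD]; split; first by have := P0; rewrite in_setE.
split=> [x y Px Py|x s Px].
  have := PD 1 x y; rewrite !in_setE scale1r; exact.
by have := PD (s : S^c) x 0; rewrite !in_setE addr0; apply=> //; have := P0; rewrite in_setE.
Qed.

(** Along a chain [mdim_chain] lowers the dimension of almost all factors. The shift by one comes
    from the base case: factors of dimension at most 1 are zero by [dim1_commutative]. *)
Lemma kdim_lt_lead (i0 : 'I_n) : ~ virtually_commutative tau ->
  forall k (N P : set (S^c)^o), submod_closed (mem N) -> submod_closed (mem P) -> N `<=` P ->
  mdim_le (lead_set (pull bar e (P : S -> Prop))) (lead_set (pull bar e (N : S -> Prop))) k.+1 ->
  kdim_lt k N P.
Proof.
move=> nvc; elim=> [|k IH] N P sN sP NP dimPN.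
  move=> x Px; apply: contrapT => nNx; apply: nvc.
  exact: (dim1_commutative T C i0 (submod_rideal sP) (submod_rideal sN) NP dimPN Px nNx).
move=> /= D sD ND decD.
have up (X : set (S^c)^o) : submod_closed (mem X) -> upclosed (lead_set (pull bar e (X : S -> Prop))).
  by move/submod_rideal/(pull_upclosed T).
have mono (X Y : set (S^c)^o) m : X `<=` Y -> lead_set (pull bar e (X : S -> Prop)) m ->
    lead_set (pull bar e (Y : S -> Prop)) m.
  by move=> XY [p [Xp p0 pm]]; exists p; split=> //; exact: XY.
have [i1 i1P] := mdim_chain (C := fun i => lead_set (pull bar e (D i : S -> Prop)))
   (up _ sP) (up _ sN) dimPN (fun i => up _ (sD i)) (fun i m => mono _ _ m (decD i))
   (fun i m => mono _ _ m (ND i).2) (fun i m => mono _ _ m (ND i).1).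
by exists i1 => i /i1P; exact: (IH _ _ (sD i.+1) (sD i) (decD i)).
Qed.

End Krull.

Theorem theorem5p1 (R : realType) (F : fieldType) (A : zmodType)
    (hA : fg_free_abelian A)
    (S : algType F) (T : twisted_group_algebra A S)
    (d : nat) (hd : right_kdim S d)
    (hdim : d%:R%:E = (rk R [set: A] - 1)%E)
    (Z : set A) (hZ : zmod_closed (mem Z))
    (hcenter : ring_center S = tga_sub T Z)
    (M : lmodType S^c) (hM : simple_module M) :
  GKdim R M = 1%E \/ (rk R [set: A] - rk R Z - 1 <= GKdim R M)%E.
Proof.
have TB := tga_tbasis T; have [n [e [co C]]] := fg_free_coordinates hA.
rewrite (rk_setT C) in hdim *.
have dn : n = d.+1.
  move: hdim; rewrite -EFinB => -[/eqP]; rewrite -subr_eq0 opprB addrA subr_eq0 natr1 eqr_nat.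
  by move/eqP.
subst n; pose i0 : 'I_d.+1 := ord0.
have [[m0 m00] simpleM] := hM.
have act_simple (v w : M) : v != 0 -> exists x, w = act v x.
  move=> v0; pose N : set M := [set act v x | x in [set: S]].
  have sN : submod_closed (mem N).
    split; first by rewrite in_setE; exists 0 => //; exact: act0r.
    move=> a x y; rewrite !in_setE => -[x1 _ <-] [y1 _ <-]; exists (x1 * (a : S) + y1) => //.
    by rewrite actDr -actA.
  have [N0|NT] := simpleM N sN; last first.
    have [x _ <-] : N w by rewrite NT.
    by exists x.
  have : N v by exists 1 => //; exact: act1.
  by rewrite N0 => /= v0'; rewrite v0' eqxx in v0.
have nz : exists v : M, v != 0 by exists m0.
have [vc|nvc] := pselect (virtually_commutative (tga_tau T)); last first.
  (* No orthant has dimension above [d.+1], so the Krull dimension would be below [d]. *)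
  exfalso; case: hd => _; apply.
  apply: (kdim_lt_lead TB C i0 nvc) => //.
  - split; first by rewrite in_setE.
    by move=> a x y; rewrite !in_setE => /= -> ->; rewrite scaler0 addr0.
  - by split=> [|a x y]; rewrite !in_setE.
  - by move=> a J; rewrite ltnNge (leq_trans (max_card _)) // card_ord.
have [psi [psiD [a0 pa0] [K K0 chiK]]] := vc.
have [j0 pj0] : exists j, psi (e j) != 0.
  apply: contrapT => /forallNP h; case/eqP: pa0.
  have psi0 : psi 0 = 0 by apply: (addrI (psi 0)); rewrite -psiD !addr0.
  have psiN x : psi (- x) = - psi x by apply: (addrI (psi x)); rewrite -psiD !subrr psi0.
  have psiMn x k : psi x = 0 -> psi (x *+ k) = 0.
    by move=> x0; elim: k => [|k IH]; rewrite ?mulr0n // mulrS psiD IH x0 addr0.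
  rewrite (coE C a0); elim/big_rec : _ => // j x _ x0.
  have ej0 : psi (e j) = 0 by apply/eqP; apply: contrapT => /negP; exact: h.
  by rewrite psiD x0 addr0; case: (co a0 j) => k; rewrite ?NegzE ?mulrNz ?psiN psiMn ?oppr0.
have [|] := simple_module_alternative TB C psiD K0 chiK pj0 nz act_simple.
  move=> [u [u0 [I [s [y [ns sZ sfree Iind]]]]]]; right.
  apply: le_trans (GKdim_ge_supported R Iind).
  (* A radical element has a central basis element, which lies in [tga_sub T Z]; uniqueness of
     expansions puts [z] in [Z]. *)
  have sZZ z : z \in s -> Z z.
    move=> /sZ zc; apply: contrapT => nZz.
    have : tga_sub T Z (tga_bar T z).
      rewrite -hcenter => x; have [l [c ->]] := bar_span TB x.
      apply: commr_sum => a _; rewrite /GRing.comm -scalerAr -scalerAl.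
      by rewrite (bar_comm TB) zc scale1r.
    move=> [l [lZ lE]].
    have zl : z \notin finsupp l by rewrite mem_finsupp negbK; apply/eqP; exact: lZ.
    have E : \sum_(a <- z :: finsupp l) (if a == z then 1 else - l a) *: tga_bar T a = 0.
      rewrite big_cons eqxx scale1r {1}lE -[X in X + _]opprK -sumrN addrC; apply/eqP; rewrite subr_eq0; apply/eqP.
      rewrite big_seq [RHS]big_seq; apply: eq_bigr => a al.
      by rewrite (_ : (a == z) = false) ?scaleNr //; apply/negbTE; apply: contraNneq zl => <-.
    have uz : uniq (z :: finsupp l) by rewrite /= zl fset_uniq.
    by have := bar_free TB uz E (mem_head z _); rewrite eqxx => /eqP; rewrite oner_eq0.
  have szZ : ((size s)%:R%:E <= rk R Z)%E.
    by apply: ereal_sup_ubound; exists s => //; split=> // c; exact: sfree.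
  case: (rk R Z) szZ => [r| |]; last by rewrite leeNy_eq.
    rewrite -!EFinB !lee_fin => sr.
    have : (d.+1%:R <= (#|I| + size s + 1)%:R :> R) by rewrite ler_nat.
    rewrite !natrD; lra.
  (* If [rk R Z] is [+oo], the lower bound is [-oo]. *)
  by move=> _; rewrite addeC /= leNye.
move=> [u [u0 [k [m [span0 ind]]]]]; left.
apply/eqP; rewrite eq_le (GKdim_le1 R TB psiD act_simple u0 span0) /=.
exact: (GKdim_ge1 R TB pj0 (ind _ pj0)).
Qed.
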